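(* Let the number $p$ of groups be fixed, let $\tau\in(0,1)$, and consider the linear model $Y_i=\sum_{j=1}^p \mathbf{X}_{ij}^t\boldsymbol\beta^0_j+\varepsilon_i=\mathbb{X}_i^t\boldsymbol\beta^0+\varepsilon_i$, $i=1,\dots,n$, with grouped explanatory variables, described in the context. Suppose that assumptions (A1) and (A2) of the context hold, and that the tuning parameter $\mu_n>0$ and the constant $\gamma>0$ satisfy, as $n\to\infty$, $$\mu_n\to\infty,\qquad \frac{\mu_n}{\sqrt n}\to 0,\qquad n^{(\gamma-1)/2}\mu_n\to\infty .$$ Let $\widehat{\boldsymbol\beta}^*_n$ be the adaptive group LASSO quantile estimator defined in the context. Then $$\sqrt n\,\big(\widehat{\boldsymbol\beta}^*_n-\boldsymbol\beta^0\big)_{\mathcal A}\ \xrightarrow[n\to\infty]{\mathcal L}\ \mathcal N\big(\mathbf 0_{r^0},\ \tau(1-\tau)f^{-2}(0)\boldsymbol\Upsilon_{\mathcal A}^{-1}\big),$$ where $\boldsymbol\Upsilon_{\mathcal A}$ is the submatrix of $\boldsymbol\Upsilon$ with row and column indices in $\{1,\dots,r^0\}$, $r^0=\sum_{j=1}^{p_0}d_j$.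
   Context: Model. The number of groups $p$ and the group sizes $d_1,\dots,d_p$ are fixed; $r=\sum_{j=1}^p d_j$. For $i=1,\dots,n$, $\mathbf X_{ij}\in\mathbb R^{d_j}$ is the (nonrandom) design of group $j$, $\mathbb X_i=(\mathbf X_{i1},\dots,\mathbf X_{ip})\in\mathbb R^r$ (column vector), and $Y_i=\mathbb X_i^t\boldsymbol\beta^0+\varepsilon_i$, where $\boldsymbol\beta^0=(\boldsymbol\beta^0_1,\dots,\boldsymbol\beta^0_p)\in\mathbb R^r$, $\boldsymbol\beta^0_j\in\mathbb R^{d_j}$, is the true (unknown) parameter. A generic parameter is $\boldsymbol\beta=(\boldsymbol\beta_1,\dots,\boldsymbol\beta_p)$. $\|\cdot\|$ is the Euclidean norm and $\mathbf 0_k$ is the zero $k$-vector. The groups are ordered so that $\|\boldsymbol\beta^0_j\|\ne0$ for $j\le p_0$ and $\|\boldsymbol\beta^0_j\|=0$ for $j>p_0$, with $p_0\le p$. Let $\mathcal A=\{j:\|\boldsymbol\beta_j^0\|\neq 0\}=\{1,\dots,p_0\}$ and $r^0=\sum_{j=1}^{p_0}d_j$. For $\boldsymbol\beta\in\mathbb R^r$, $\boldsymbol\beta_{\mathcal A}$ is the $r^0$-subvector containing $\boldsymbol\beta_j$, $j=1,\dots,p_0$. Estimators. The check function is $\rho_\tau(u)=u(\tau-\mathbf 1_{u<0})$. The quantile estimator is $\widetilde{\boldsymbol\beta}_n=(\widetilde{\boldsymbol\beta}_{n;1},\dots,\widetilde{\boldsymbol\beta}_{n;p})=\arg\min_{\boldsymbol\beta\in\mathbb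 R^r}\sum_{i=1}^n\rho_\tau(Y_i-\mathbb X_i^t\boldsymbol\beta)$. The weights are $\widehat\omega_{n;j}=\|\widetilde{\boldsymbol\beta}_{n;j}\|^{-\gamma}$. The adaptive group LASSO quantile estimator is $$\widehat{\boldsymbol\beta}^*_n=(\widehat{\boldsymbol\beta}^*_{n;1},\dots,\widehat{\boldsymbol\beta}^*_{n;p})=\arg\min_{\boldsymbol\beta\in\mathbb R^r}\Big\{\sum_{i=1}^n\rho_\tau\Big(Y_i-\sum_{j=1}^p\mathbf X_{ij}^t\boldsymbol\beta_j\Big)+\mu_n\sum_{j=1}^p\widehat\omega_{n;j}\|\boldsymbol\beta_j\|\Big\}.$$ Assumptions. (A1) As $n\to\infty$, $n^{-1}\max_{1\le i\le n}\mathbb X_i^t\mathbb X_i\to0$ and $n^{-1}\sum_{i=1}^n\mathbb X_i\mathbb X_i^t\to\boldsymbol\Upsilon$, with $\boldsymbol\Upsilon$ an $r\times r$ positive definite matrix. (A2) $(\varepsilon_i)_{1\le i\le n}$ are independent and identically distributed, with distribution function $F:\mathcal B\to[0,1]$, where $\mathcal B$ is a real set with $0\in\mathcal B$, and with a density $f$ that is continuous and positive in a neighborhood of $0$. The $\tau$th quantile of $\varepsilon_i$ is zero: $\tau=F(0)$. Moreover, for every $e\in\mathrm{int}(\mathcal B)$, $$\lim_{n\to\infty}n^{-1}\sum_{i=1}^n\int_0^{\mathbb X_i^t\mathbf 1_r}\sqrt n\,\big[F(e+v/\sqrt n)-F(e)\big]\,dv=\tfrac12 f(e)\,\mathbf 1_r^t\boldsymbol\Upsilon\mathbf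 1_r,$$ where $\mathbf 1_r$ is the $r$-vector with all components equal to $1$. *)

(* Defs.v *)
From HB Require Import structures.
From mathcomp Require Import all_boot all_order all_algebra finmap.
From mathcomp Require Import all_classical all_reals all_analysis.

Set Implicit Arguments.
Unset Strict Implicit.
Unset Printing Implicit Defensive.

Import Order.TTheory GRing.Theory Num.Theory.
Import numFieldNormedType.Exports.

Local Open Scope classical_set_scope.
Local Open Scope ring_scope.

(* Observations are numbered from 0: the sample
   of size n is {i | i < n}. A parameter in R^r, r = d_1 + ... + d_p, is a
   column vector of type 'cV_(\sum_j d j); its j-th group is [submxcol b j]. *)

Section Vectors.
Context {R : realType}.

Definition dotv {k} (u v : 'cV[R]_k) : R := (u^T *m v) 0 0.

(* The library norm on matrices is the max norm, hence this definition. *)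
Definition l2norm {k} (u : 'cV[R]_k) : R := Num.sqrt (dotv u u).

Definition onev {k} : 'cV[R]_k := const_mx 1.

Definition posdefmx {k} (A : 'M[R]_k) : Prop :=
  A^T = A /\ forall u : 'cV[R]_k, u != 0 -> 0 < dotv u (A *m u).

Definition active_vec {p : nat} {d : 'I_p -> nat} {p0 : nat} (hp0 : (p0 <= p)%N)
    (b : 'cV[R]_(\sum_(j < p) d j)) :
    'cV[R]_(\sum_(j < p0) d (widen_ord hp0 j)) :=
  \mxcol_(j < p0) submxcol b (widen_ord hp0 j).

(* The blocks (j, k) with j, k < p0, i.e. the leading r0 x r0 submatrix. *)
Definition active_mx {p : nat} {d : 'I_p -> nat} {p0 : nat} (hp0 : (p0 <= p)%N)
    (A : 'M[R]_(\sum_(j < p) d j)) :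
    'M[R]_(\sum_(j < p0) d (widen_ord hp0 j)) :=
  \mxblock_(j < p0, k < p0) submxblock A (widen_ord hp0 j) (widen_ord hp0 k).

(* The integral of h from a to b, with the usual sign when b < a. *)
Definition oriented_integral (a b : R) (h : R -> R) : R :=
  if a <= b then \int[lebesgue_measure]_(v in `[a, b]) h v
  else - \int[lebesgue_measure]_(v in `[b, a]) h v.

End Vectors.

Section Probability.
Context {R : realType}.

Definition mutually_independent {dT} {T : measurableType dT}
    (P : probability T R) (Z : nat -> {RV P >-> R}) : Prop :=
  forall (J : {fset nat}) (A : nat -> set R), (forall i, measurable (A i)) ->
    P (\bigcap_(i in [set` J]) Z i @^-1` A i) =
    (\prod_(i <- J) P (Z i @^-1` A i))%E.

Definition is_density_of (f F : R -> R) : Prop :=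
  [/\ measurable_fun setT f, forall x, 0 <= f x &
      forall x, (\int[lebesgue_measure]_(t in `]-oo, x]) (f t)%:E = (F x)%:E)%E].

(* Measurability for the product (= Borel) sigma-algebra of R^k. *)
Definition random_vector {dT} {T : measurableType dT} {k : nat}
    (Z : T -> 'cV[R]_k) : Prop :=
  forall i, measurable_fun setT (fun w => Z w i 0).

(* The univariate normal law of mean m and variance v >= 0. The library's
   [normal_prob] takes the standard deviation and is not a point mass when the
   latter is 0. *)
Definition normal_law (m v : R) (A : set R) : \bar R :=
  if v == 0 then \d_m A else normal_prob m (Num.sqrt v) A.

(* Z ~ N(m, S): every linear combination of the coordinates of Z is normal,
   with the mean and variance prescribed by m and S. *)
Definition normal_vector {dT} {T : measurableType dT} (P : probability T R)
    {k : nat} (Z : T -> 'cV[R]_k) (m : 'cV[R]_k) (S : 'M[R]_k) : Prop :=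
  random_vector Z /\
  forall (t : 'cV[R]_k) (A : set R), measurable A ->
    P ((fun w => dotv t (Z w)) @^-1` A) =
    normal_law (dotv t m) (dotv t (S *m t)) A.

(* The limit may live on another probability space. *)
Definition cvg_in_law {dT} {T : measurableType dT} (P : probability T R)
    {dT'} {T' : measurableType dT'} (P' : probability T' R)
    {k : nat} (Zn : nat -> T -> 'cV[R]_k) (Z : T' -> 'cV[R]_k) : Prop :=
  forall g : 'cV[R]_k -> R, continuous g ->
    (exists M : R, forall x, `|g x| <= M) ->
    ('E_P[g \o Zn n] @[n --> \oo] --> 'E_P'[g \o Z])%E.

(* Stated with an existential because a normal vector need not exist on the
   original space; the law of the limit is determined by m and S. *)
Definition cvg_in_law_normal {dT} {T : measurableType dT} (P : probability T R)
    {k : nat} (Zn : nat -> T -> 'cV[R]_k) (m : 'cV[R]_k) (S : 'M[R]_k) : Prop :=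
  exists (dT' : measure_display) (T' : measurableType dT')
    (P' : probability T' R) (Z : T' -> 'cV[R]_k),
    normal_vector P' Z m S /\ cvg_in_law P P' Zn Z.

End Probability.

Section Estimators.
Context {R : realType}.

Definition check_fun (tau u : R) : R := u * (tau - (u < 0)%R%:R).

Definition quantile_loss {r : nat} (tau : R) (X : nat -> 'cV[R]_r)
    (Y : nat -> R) (n : nat) (b : 'cV[R]_r) : R :=
  \sum_(i < n) check_fun tau (Y i - dotv (X i) b).

(* ||bt_j||^(-gamma), which is +oo when bt_j = 0 and gamma > 0. *)
Definition adaptive_weight {p : nat} {d : 'I_p -> nat} (gamma : R)
    (bt : 'cV[R]_(\sum_(j < p) d j)) (j : 'I_p) : \bar R :=
  ((l2norm (submxcol bt j) `^ gamma)%:E^-1)%E.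

(* Extended-real valued, with the library's convention +oo * 0 = 0: an infinite
   weight forces the corresponding group to vanish. *)
Definition penalized_loss {p : nat} {d : 'I_p -> nat} (tau gamma mu : R)
    (X : nat -> 'cV[R]_(\sum_(j < p) d j)) (Y : nat -> R) (n : nat)
    (bt b : 'cV[R]_(\sum_(j < p) d j)) : \bar R :=
  ((quantile_loss tau X Y n b)%:E +
   mu%:E * \sum_(j < p) adaptive_weight gamma bt j *
                        (l2norm (submxcol b j))%:E)%E.

Definition is_quantile_estimate {r : nat} (tau : R) (X : nat -> 'cV[R]_r)
    (Y : nat -> R) (n : nat) (bt : 'cV[R]_r) : Prop :=
  forall b, quantile_loss tau X Y n bt <= quantile_loss tau X Y n b.

Definition is_adaptive_group_lasso_estimate {p : nat} {d : 'I_p -> nat}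
    (tau gamma mu : R) (X : nat -> 'cV[R]_(\sum_(j < p) d j)) (Y : nat -> R)
    (n : nat) (bt bs : 'cV[R]_(\sum_(j < p) d j)) : Prop :=
  forall b, (penalized_loss tau gamma mu X Y n bt bs <=
             penalized_loss tau gamma mu X Y n bt b)%E.

End Estimators.

(* Main.v *)
Require Import Defs.
From HB Require Import structures.
From mathcomp Require Import all_boot all_order all_algebra finmap.
From mathcomp Require Import all_classical all_reals all_analysis.
From mathcomp Require Import measurable_realfun ring lra.

Set Implicit Arguments.
Unset Strict Implicit.
Unset Printing Implicit Defensive.

Import Order.TTheory GRing.Theory Num.Theory.
Import numFieldNormedType.Exports.

Local Open Scope classical_set_scope.
Local Open Scope ring_scope.

(* In the variable u = sqrt n (b - beta0), Knight's identity writes the centred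
   quantile loss as - W_n . u + R_n(u), where W_n = n^(-1/2) sum_i psi_i X_i,
   psi_i = tau - 1_(eps_i < 0), and R_n is a sum of nonnegative terms. Since f is
   continuous at 0, E R_n(u) tends to f(0)/2 u^T Upsilon u; Chebyshev's
   inequality and a random Lipschitz bound make the approximation of R_n
   uniform on balls. By convexity the quantile estimator is therefore
   sqrt n-consistent, so that the weights of the active groups stay bounded
   (and mu_n / sqrt n -> 0 kills their penalty), whereas those of the inactive
   groups are at least of order n^(gamma/2). Comparing, again by convexity, the
   penalized loss at its minimizer and at the point u0 supported by the active
   groups whose active part is xi_n = (f(0) Upsilon_A)^(-1) W_(n,A), on small
   spheres around u0, shows that the active part of the rescaled estimator
   differs from xi_n by o_P(1).
   The limit law is obtained from cosine transforms: E cos(t . xi_n + c) is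
   computed by independence up to a Taylor error, and Levy's continuity
   theorem follows, with tightness, from the approximation of a continuous
   function on a box by trigonometric polynomials (discrete Fejer operator). *)

(** Neither minimizer is explicit; only minimality and convexity enter, so the argument covers every
    measurable choice of minimizers. Convexity also replaces any control of the losses far away:
    comparing values on a sphere is enough. The penalized loss is infinite unless the groups
    annihilated by the quantile estimator vanish. The penalized minimizer satisfies this constraint,
    and so does [u0], because on the likely event those groups are inactive; the comparison can thus
    be run with a finite convex function. The approximation has to hold for all [u] in a ball at
    once, a property that need not be measurable, whence statements valid off a small measurable
    set. Characteristic functions are kept real: the transforms [E cos (t . Z + c)], over all phases
    [c], contain both their real and imaginary parts. The score needs no truncation, its summands
    being two-valued with uniformly small coefficients. The limit vector has to be built, from a
    Cholesky factor of its covariance and independent standard normals, whose own transform comes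
    from the moment generating function and a functional equation. *)

(** * Taylor bounds for sine, cosine and exponential *)

Section ElementaryBounds.
Context {R : realType}.
Implicit Types x y : R.

Lemma le_sqr_norm x y : `|x| <= `|y| -> x ^+ 2 <= y ^+ 2.
Proof.
move=> xy; rewrite -[x ^+ 2]real_normK ?num_real//.
by rewrite -[y ^+ 2]real_normK ?num_real// lerXn2r ?nnegrE.
Qed.

(** Mean value theorem. The Taylor bounds below integrate an earlier one with it, or square one
    through a half-angle formula. *)
Lemma ge0_of_derive (f f' : R -> R) :
  (forall x, is_derive x 1 f (f' x)) -> (forall x, 0 <= x -> 0 <= f' x) ->
  f 0 = 0 -> forall x, 0 <= x -> 0 <= f x.
Proof.
move=> df f'0 f0 x x0.
have [|c] := @MVT_segment R f f' 0 x x0 (fun y _ => df y).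
  apply: derivable_within_continuous => y _.
  by have := df y => /@ex_derive.
rewrite in_itv/= => /andP[c0 _]; rewrite f0 subr0 => ->.
by rewrite subr0 mulr_ge0// f'0.
Qed.

Lemma sin_le_id x : 0 <= x -> sin x <= x.
Proof.
move=> x0; rewrite -subr_ge0; move: x x0.
have D x : is_derive x 1 (fun x : R => x - sin x) (1 - cos x) by exact: is_deriveB.
refine (ge0_of_derive D _ _) => [x _|].
- by rewrite subr_ge0 cos_le1.
- by rewrite sin0 subr0.
Qed.

Lemma norm_sin_le x : `|sin x| <= `|x|.
Proof.
wlog x0 : x / 0 <= x => [h|].
  have [/h//|/ltW x0] := leP 0 x.
  by rewrite -normrN -sinN -[leRHS]normrN h// oppr_ge0.
rewrite [leRHS]ger0_norm//; apply/ler_normlP; split; last exact: sin_le_id.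
have [x1|x1] := leP x 1; last by rewrite lerNl (le_trans _ (sin_geN1 x))// lerN2 ltW.
rewrite (le_trans _ x0)// oppr_le0.
have [->|xn0] := eqVneq x 0; first by rewrite sin0.
by rewrite ltW// sin2_gt0// lt0r xn0 x0/= (le_lt_trans x1)// ltr1n.
Qed.

Lemma cos_1Bsqr x : cos x = 1 - 2 * sin (x / 2) ^+ 2.
Proof.
have {1}-> : x = (x / 2) *+ 2 by field.
by rewrite cos_mulr2n cos2sin2; ring.
Qed.

Lemma cos_ge1B x : 1 - x ^+ 2 / 2 <= cos x.
Proof.
rewrite cos_1Bsqr lerD2l lerN2.
have : sin (x / 2) ^+ 2 <= (x / 2) ^+ 2 by exact/le_sqr_norm/norm_sin_le.
by lra.
Qed.

Lemma sin_ge x : 0 <= x -> x - x ^+ 3 / 6 <= sin x.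
Proof.
move=> x0; rewrite -subr_ge0; move: x x0.
have D x : is_derive x 1 (fun x : R => sin x - (x - x ^+ 3 / 6)) (cos x - (1 - x ^+ 2 / 2)).
  by apply: is_derive_eq; rewrite /GRing.scale/= !mulr0; field.
refine (ge0_of_derive D _ _) => [x _|].
- by rewrite subr_ge0 cos_ge1B.
- by rewrite sin0 expr0n/= mul0r !subr0.
Qed.

Lemma cos_le x : cos x <= 1 - x ^+ 2 / 2 + x ^+ 4 / 24.
Proof.
wlog x0 : x / 0 <= x => [h|].
  have [/h//|/ltW x0] := leP 0 x.
  by have := h (- x); rewrite oppr_ge0 cosN sqrrN (_ : (- x) ^+ 4 = x ^+ 4); [exact|ring].
rewrite cos_1Bsqr.
have y0 : 0 <= x / 2 by rewrite divr_ge0.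
have := sin_ge y0; set s := sin _ => sg.
suff : (x / 2) ^+ 2 - (x / 2) ^+ 4 / 3 <= s ^+ 2 by lra.
have s2 : 0 <= s ^+ 2 by rewrite sqr_ge0.
(* Squaring [sg] requires a nonnegative left-hand side. Otherwise, with [y = x / 2], [y < y^3 / 6]
   makes [y^2 - y^4 / 3] nonpositive and the bound is trivial. *)
have [le|lt] := leP ((x / 2) ^+ 3 / 6) (x / 2).
  have : (x / 2 - (x / 2) ^+ 3 / 6) ^+ 2 <= s ^+ 2.
    by apply: le_sqr_norm; rewrite ger0_norm ?subr_ge0// (le_trans sg) ?ler_norm.
  have : 0 <= ((x / 2) ^+ 3 / 6) ^+ 2 by rewrite sqr_ge0.
  move: (x / 2) => y; nra.
have : 0 <= ((x/2) ^+ 3 / 6 - x / 2) * (x / 2) by rewrite mulr_ge0// subr_ge0 ltW.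
have : 0 <= (x / 2) ^+ 4 by rewrite exprn_even_ge0.
move: (x / 2) s2 => y; nra.
Qed.

(* [2 cosh] and [2 sinh]: [cosh2] dominates the Taylor remainder of [cos] and has
   an explicit integral against the normal law. *)
Definition cosh2 x : R := expR x + expR (- x).
Definition sinh2 x : R := expR x - expR (- x).

Lemma cosh2_ge2 x : 2 <= cosh2 x.
Proof. by have := expR_ge1Dx x; have := expR_ge1Dx (- x); rewrite /cosh2; lra. Qed.

Lemma sinh2_ge0 x : 0 <= x -> 0 <= sinh2 x.
Proof. by move=> x0; rewrite subr_ge0 ler_expR; lra. Qed.

Lemma cosh2_half x : cosh2 x = 2 + sinh2 (x / 2) ^+ 2.
Proof.
have {1}-> : x = x / 2 + x / 2 by field.
rewrite /cosh2 /sinh2 opprD !expRD.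
have := expRxMexpNx_1 (x / 2); move: (expR _) (expR _) => a b ab.
by rewrite sqrrB ab; ring.
Qed.

Lemma sinh2_ge x : 0 <= x -> 2 * x <= sinh2 x.
Proof.
move=> x0; rewrite -subr_ge0; move: x x0.
have D x : is_derive x 1 (fun x : R => sinh2 x - 2 * x) (cosh2 x - 2).
  by rewrite /sinh2 /cosh2; apply: is_derive_eq; rewrite /GRing.scale/=; ring.
refine (ge0_of_derive D _ _) => [x _|].
- by rewrite subr_ge0 cosh2_ge2.
- by rewrite /sinh2 oppr0 subrr mulr0 subr0.
Qed.

Lemma sinh2_le x : 0 <= x -> sinh2 x <= x * cosh2 x.
Proof.
move=> x0; rewrite -subr_ge0; move: x x0.
have D x : is_derive x 1 (fun x : R => x * cosh2 x - sinh2 x) (x * sinh2 x).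
  by rewrite /sinh2/cosh2; apply: is_derive_eq; rewrite /GRing.scale/=; ring.
refine (ge0_of_derive D _ _) => [x x0|].
- by rewrite mulr_ge0// sinh2_ge0.
- by rewrite /sinh2 oppr0 subrr mul0r subr0.
Qed.

Lemma cosh2N x : cosh2 (- x) = cosh2 x.
Proof. by rewrite /cosh2 opprK addrC. Qed.

Lemma cosh2_ge x : 2 + x ^+ 2 <= cosh2 x.
Proof.
wlog x0 : x / 0 <= x => [h|].
  have [/h//|/ltW x0] := leP 0 x.
  by rewrite -cosh2N -sqrrN; apply: h; rewrite oppr_ge0.
rewrite cosh2_half lerD2l; apply: le_sqr_norm.
have y0 : 0 <= x / 2 by rewrite divr_ge0.
by have := sinh2_ge y0; have := sinh2_ge0 y0 => s0; rewrite !ger0_norm//; lra.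
Qed.

Lemma cosh2_sqr x : cosh2 x ^+ 2 = cosh2 (2 * x) + 2.
Proof.
have e y : 2 * y = y + y by ring.
rewrite /cosh2 -mulrN !e !expRD.
by have := expRxMexpNx_1 x; move: (expR _) (expR _) => a b ab; rewrite sqrrD ab; ring.
Qed.

(** With [c = cosh2 x], squaring [sinh2_le] at [x / 2] gives [c - 2 <= x^2 (c + 2) / 4]. Since
    [c >= 2] this yields [c - 2 <= x^2 c / 2], which, inserted back into the first bound, produces
    the factor [x^4]. *)
Lemma cosh2_le x : cosh2 x <= 2 + x ^+ 2 + x ^+ 4 * cosh2 x / 4.
Proof.
wlog x0 : x / 0 <= x => [h|].
  have [/h//|/ltW x0] := leP 0 x.
  by have := h (- x); rewrite oppr_ge0 cosh2N sqrrN (_ : (- x) ^+ 4 = x ^+ 4); [exact|ring].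
have y0 : 0 <= x / 2 by rewrite divr_ge0.
have sy := sinh2_le y0; have s0 := sinh2_ge0 y0.
have c2 := cosh2_ge2 x.
have : sinh2 (x / 2) ^+ 2 <= (x / 2) ^+ 2 * (cosh2 x + 2).
  have -> : cosh2 x + 2 = cosh2 (x / 2) ^+ 2 by rewrite cosh2_sqr; congr (cosh2 _ + _); field.
  by rewrite -exprMn; apply: le_sqr_norm; rewrite !ger0_norm// (le_trans _ sy).
rewrite (_ : sinh2 _ ^+ 2 = cosh2 x - 2); last by rewrite [in RHS]cosh2_half addrC addKr.
move=> h1.
have x2 : 0 <= x ^+ 2 by rewrite sqr_ge0.
have h2 : cosh2 x - 2 <= x ^+ 2 * cosh2 x / 2.
  have : 0 <= x ^+ 2 * (cosh2 x - 2) by rewrite mulr_ge0// subr_ge0.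
  by lra.
have h3 : x ^+ 2 * (cosh2 x - 2) <= x ^+ 2 * (x ^+ 2 * cosh2 x / 2) by rewrite ler_wpM2l.
have h4 : 0 <= x ^+ 4 * cosh2 x by rewrite mulr_ge0 ?exprn_even_ge0// (le_trans _ c2).
by move: h1 h3 h4; nra.
Qed.

Lemma expRN_le x : 0 <= x -> expR (- x) <= 1 - x + x ^+ 2 / 2.
Proof.
move=> x0; rewrite -subr_ge0; move: x x0.
have D x : is_derive x 1 (fun x : R => 1 - x + x ^+ 2 / 2 - expR (- x)) (expR (- x) - (1 - x)).
  by apply: is_derive_eq; rewrite /GRing.scale/=; field.
refine (ge0_of_derive D _ _) => [x x0|].
- by rewrite subr_ge0 expR_ge1Dx.
- by rewrite oppr0 expR0 expr0n/= mul0r !addr0 subrr.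
Qed.

Lemma cos_Taylor x : `|cos x - (1 - x ^+ 2 / 2)| <= x ^+ 4 / 24.
Proof. by apply/ler_normlP; have := cos_le x; have := cos_ge1B x; split; nra. Qed.

Lemma sin_Taylor x : `|sin x - x| <= `|x| ^+ 3 / 6.
Proof.
wlog x0 : x / 0 <= x => [h|].
  have [/h//|/ltW x0] := leP 0 x.
  by have := h (- x); rewrite oppr_ge0 sinN -opprD !normrN; exact.
rewrite (ger0_norm x0); apply/ler_normlP.
by have := sin_le_id x0; have := sin_ge x0; have := exprn_ge0 3 x0; split; lra.
Qed.

End ElementaryBounds.

(** * Real-valued integrals against a probability *)

Section ProbabilityIntegral.
Context d (T : measurableType d) (R : realType) (P : probability T R).
Implicit Types f g : T -> R.

Lemma integrable_bounded f (M : R) : measurable_fun setT f ->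
  (forall w, `|f w| <= M) -> P.-integrable setT (EFin \o f).
Proof.
move=> mf fM; apply: measurable_bounded_integrable => //.
  by rewrite (le_lt_trans (probability_le1 P measurableT))// ltry.
by exists M; split; rewrite ?num_real// => y My w _; rewrite /= (le_trans (fM w))// ltW.
Qed.

Lemma integrableDR f g : P.-integrable setT (EFin \o f) ->
  P.-integrable setT (EFin \o g) -> P.-integrable setT (EFin \o (fun w => f w + g w)).
Proof. by move=> fi gi; exact: (integrableD measurableT fi gi). Qed.

Lemma integrableBR f g : P.-integrable setT (EFin \o f) ->
  P.-integrable setT (EFin \o g) -> P.-integrable setT (EFin \o (fun w => f w - g w)).
Proof. by move=> fi gi; exact: (integrableB measurableT fi gi). Qed.

Lemma integrableZR (c : R) f : P.-integrable setT (EFin \o f) ->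
  P.-integrable setT (EFin \o (fun w => c * f w)).
Proof. by move=> fi; exact: (integrableZl measurableT c fi). Qed.

Lemma integrable_cstR (c : R) : P.-integrable setT (EFin \o (fun=> c)).
Proof. exact: (@integrable_bounded _ `|c|). Qed.

Lemma Rintegral_prob_cst (c : R) : \int[P]_w c = c.
Proof.
rewrite Rintegral_cst// [X in _ * fine X](_ : _ = 1%E) ?mulr1//.
exact: probability_setT.
Qed.

Lemma norm_Rintegral_le f g : P.-integrable setT (EFin \o f) ->
  P.-integrable setT (EFin \o g) -> (forall w, `|f w| <= g w) ->
  `|\int[P]_w f w| <= \int[P]_w g w.
Proof.
move=> fi gi fg; rewrite (le_trans (le_normr_Rintegral _ _))//.
apply: le_Rintegral => //; exact: (integrable_norm fi).
Qed.

Lemma norm_Rintegral_le_cst f (M : R) : P.-integrable setT (EFin \o f) ->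
  (forall w, `|f w| <= M) -> `|\int[P]_w f w| <= M.
Proof.
move=> fi fM; rewrite -[leRHS]Rintegral_prob_cst; apply: norm_Rintegral_le => //.
by apply: (@integrable_bounded _ `|M|) => // w; rewrite lexx.
Qed.

Lemma integrable_sumR (I : Type) (s : seq I) (F : I -> T -> R) :
  (forall i, P.-integrable setT (EFin \o F i)) ->
  P.-integrable setT (EFin \o (fun w => \sum_(i <- s) F i w)).
Proof.
move=> iF; elim: s => [|i s IH].
  rewrite (_ : _ \o _ = EFin \o (fun=> 0)); first exact: integrable_cstR.
  by apply/funext => w /=; rewrite big_nil.
rewrite (_ : _ \o _ = EFin \o (fun w => F i w + \sum_(i <- s) F i w)).
  exact: integrableDR.
by apply/funext => w /=; rewrite big_cons.
Qed.

Lemma Rintegral_sum (I : Type) (s : seq I) (F : I -> T -> R) :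
  (forall i, P.-integrable setT (EFin \o F i)) ->
  \int[P]_w (\sum_(i <- s) F i w) = \sum_(i <- s) \int[P]_w F i w.
Proof.
move=> iF; elim: s => [|i s IH].
  under eq_Rintegral do rewrite big_nil.
  by rewrite big_nil Rintegral_prob_cst.
under eq_Rintegral do rewrite big_cons.
rewrite big_cons RintegralD// ?IH//.
exact: integrable_sumR.
Qed.

Lemma Rintegral_EFin f : P.-integrable setT (EFin \o f) ->
  (\int[P]_w (f w)%:E)%E = (\int[P]_w f w)%:E.
Proof. by move=> fi; rewrite /Rintegral fineK//; exact: integrable_fin_num. Qed.

End ProbabilityIntegral.

(** * Normal laws *)

Section DensityIntegral.
Local Open Scope ereal_scope.
Context d (T : measurableType d) (R : realType).
Variables (mu nu : {measure set T -> \bar R}) (h : T -> R).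
Hypotheses (mh : measurable_fun setT h) (h0 : forall x, (0 <= h x)%R).
Hypothesis nuE : forall A, measurable A -> nu A = \int[mu]_(x in A) (h x)%:E.

Import HBNNSimple.

(** Both sides are monotone limits along [nnsfun_approx]; for a simple function the identity is a
    combination of instances of [nuE]. *)
Lemma ge0_integral_density (f : T -> \bar R) : measurable_fun setT f ->
  (forall x, 0 <= f x) -> \int[nu]_x f x = \int[mu]_x (f x * (h x)%:E).
Proof.
move=> mf f0; pose g := nnsfun_approx measurableT mf.
have mhE : measurable_fun setT (EFin \o h) by exact/measurable_EFinP.
have gE x : f x = lim ((EFin \o g n) x @[n --> \oo]).
  by apply/esym/cvg_lim => //; exact: cvg_nnsfun_approx.
have ghE x : f x * (h x)%:E = lim ((EFin \o g n) x * (h x)%:E @[n --> \oo]).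
  by apply/esym/cvg_lim => //; apply: cvgeZr => //; exact: cvg_nnsfun_approx.
under eq_integral do rewrite gE.
under [RHS]eq_integral do rewrite ghE.
rewrite monotone_convergence//; first last.
- by move=> x _ a b ab; rewrite lee_fin; exact/lefP/nd_nnsfun_approx.
- by move=> n x _; rewrite lee_fin.
- by move=> n; exact/measurable_EFinP.
rewrite monotone_convergence//; first last.
- move=> x _ a b ab /=; rewrite lee_wpmul2r ?lee_fin//.
  exact/lefP/nd_nnsfun_approx.
- by move=> n x _ /=; rewrite mule_ge0 ?lee_fin.
- by move=> n; apply: emeasurable_funM => //; exact/measurable_EFinP.
suff s n : \int[nu]_x (EFin \o g n) x = \int[mu]_x ((EFin \o g n) x * (h x)%:E).
  by under eq_fun do rewrite s.
transitivity (\int[nu]_x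
   (\sum_(y \in range (g n)) (y * \1_(g n @^-1` [set y]) x)%:E)).
  by apply: eq_integral => x _; rewrite /= fimfunE -fsumEFin.
have mi y : measurable_fun setT (fun x => (y * \1_(g n @^-1` [set y]) x)%:E).
  by apply/measurable_EFinP/measurable_funM.
rewrite ge0_integral_fsum//; last by move=> y x _; exact: nnfun_muleindic_ge0.
transitivity (\int[mu]_x (\sum_(y \in range (g n))
    (y * \1_(g n @^-1` [set y]) x)%:E * (h x)%:E)); last first.
  apply: eq_integral => x _.
  rewrite -ge0_mule_fsuml => [|y]; last exact: nnfun_muleindic_ge0.
  by rewrite fsumEFin // -(fimfunE _ x).
rewrite ge0_integral_fsum//; last 2 first.
- by move=> y; apply: emeasurable_funM.
- by move=> y x _; rewrite mule_ge0 ?lee_fin// -?lee_fin ?nnfun_muleindic_ge0.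
apply: eq_fsbigr => y /[!inE] -[x _ <-].
under eq_integral do rewrite EFinM.
rewrite ge0_integralZl//; last 2 first.
- exact/measurable_EFinP.
- by rewrite lee_fin.
under [RHS]eq_integral do rewrite EFinM -muleA.
rewrite ge0_integralZl//; last 3 first.
- by apply: emeasurable_funM => //; exact/measurable_EFinP.
- by move=> z _; rewrite mule_ge0 ?lee_fin.
- by rewrite lee_fin.
congr (_ * _); rewrite integral_indic// setIT nuE//.
rewrite integral_mkcond; apply: eq_integral => z _.
rewrite patchE indicE; case: ifP => _; by rewrite ?mul1e ?mul0e.
Qed.

End DensityIntegral.

Section AffineChange.
Local Open Scope ereal_scope.
Context {R : realType}.
Notation mu := (@lebesgue_measure R).

(** Uniqueness of Lebesgue measure: the image of [mu] under [x |-> a x + m], scaled by [|a|], gives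
    half-open intervals their length. *)
Lemma ge0_integral_affine (a m : R) (f : R -> \bar R) : (a != 0)%R ->
  measurable_fun setT f -> (forall x, 0 <= f x) ->
  \int[mu]_x f (a * x + m)%R = (`|a|^-1)%:E * \int[mu]_x f x.
Proof.
move=> a0 mf f0.
pose phi : measurableTypeR R -> measurableTypeR R := fun x => (a * x + m)%R.
have mphi : measurable_fun setT phi.
  by apply: measurable_funD => //; apply: measurable_funM.
have na0 : (0 <= `|a|)%R by [].
pose k : {nonneg R} := NngNum na0.
pose phiM : {mfun measurableTypeR R >-> measurableTypeR R} := HB.pack phi (isMeasurableFun.Build _ _ _ _ phi mphi).
have e A : measurable A -> mu A = mscale k (pushforward mu phiM) A.
  apply: lebesgue_measure_unique => _ [[u v]] _ <-.
  rewrite [RHS](_ : _ = (`|a|)%:E * mu (phi @^-1` `]u, v]%classic)) => [|//].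
  have [agt|alt|/eqP] := ltgtP 0%R a; last by rewrite eq_sym (negbTE a0).
    rewrite (_ : _ @^-1` _ = `](u - m) / a, (v - m) / a]%classic)%R.
      rewrite !lebesgue_measure_itv/= !lte_fin ltr_pM2r ?invr_gt0// ltrD2r.
      case: ifPn => _; last by rewrite mule0.
      by rewrite -!EFinB -EFinM gtr0_norm//; congr EFin; field.
    apply/seteqP; split=> x /=; rewrite !in_itv/= /phi ltr_pdivrMr// ler_pdivlMr// mulrC => /andP[*]; apply/andP; split; lra.
  (* A negative slope moves the closed end to the left, hence the other kind of half-open
     interval. *)
  rewrite (_ : _ @^-1` _ = `[(v - m) / a, (u - m) / a[%classic)%R.
    rewrite !lebesgue_measure_itv/= !lte_fin ltr_nM2r ?invr_lt0// ltrD2r.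
    case: ifPn => _; last by rewrite mule0.
    by rewrite -!EFinB -EFinM ltr0_norm//; congr EFin; field.
  apply/seteqP; split=> x /=; rewrite !in_itv/= /phi ler_ndivrMr// ltr_ndivlMr// mulrC => /andP[*]; apply/andP; split; lra.
rewrite [in RHS](eq_measure_integral (mscale k (pushforward mu phiM))); last first.
  by move=> A mA _; exact: e.
rewrite ge0_integral_mscale//= ge0_integral_pushforward// muleA -EFinM.
by rewrite mulVf ?normr_eq0// mul1e.
Qed.

End AffineChange.

Lemma integral_probability_cst d (T : measurableType d) (R : realType)
    (P : probability T R) (c : \bar R) : (\int[P]_x c = c)%E.
Proof.
rewrite integral_cst//.
rewrite [X in (_ * X)%E](_ : _ = 1%E) ?mule1//; exact: probability_setT.
Qed.

Section NormalCalculus.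
Local Open Scope ereal_scope.
Context {R : realType}.
Notation mu := (@lebesgue_measure R).
Notation gauss := (@normal_prob R 0 1).

Lemma ge0_integral_normal_prob (m s : R) (f : R -> \bar R) :
  measurable_fun setT f -> (forall x, 0 <= f x) ->
  \int[normal_prob m s]_x f x = \int[mu]_x (f x * (normal_pdf m s x)%:E).
Proof.
move=> mf f0; apply: ge0_integral_density => //.
- exact: measurable_normal_pdf.
- exact: normal_pdf_ge0.
Qed.

Lemma normal_pdf_affine (a m x : R) : (0 < a)%R ->
  (a^-1 * normal_pdf 0 1 ((x - m) / a) = normal_pdf m a x)%R.
Proof.
move=> a0; rewrite !normal_pdfE ?oner_eq0 ?gt_eqF//.
rewrite /normal_peak /normal_fun expr1n mul1r subr0.
rewrite -mulrnAr [in RHS]sqrtrM ?sqr_ge0// sqrtr_sqr gtr0_norm// invfM.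
rewrite mulrA; congr (_ * expR _)%R.
by field; rewrite gt_eqF.
Qed.

Lemma ge0_integral_gauss_affine (a m : R) (f : R -> \bar R) : (0 < a)%R ->
  measurable_fun setT f -> (forall x, 0 <= f x) ->
  \int[gauss]_x f (a * x + m)%R = \int[mu]_x (f x * (normal_pdf m a x)%:E).
Proof.
move=> a0 mf f0.
have mp : measurable_fun setT
    (fun y : R => f y * (normal_pdf 0 1 ((y - m) / a))%:E).
  apply: emeasurable_funM => //; apply/measurable_EFinP.
  apply: measurableT_comp; first exact: measurable_normal_pdf.
  by apply: measurable_funM => //; exact: measurable_funB.
have mfa : measurable_fun setT (fun x : R => f (a * x + m)%R).
  by apply: (measurableT_comp mf); apply: measurable_funD => //; exact: measurable_funM.
rewrite (ge0_integral_normal_prob _ _ mfa); last by move=> x; exact: f0.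
transitivity (\int[mu]_x ((fun y : R => f y * (normal_pdf 0 1 ((y - m) / a))%:E) (a * x + m)%R)).
  by apply: eq_integral => x _ /=; congr (_ * (normal_pdf 0 1 _)%:E); field; rewrite gt_eqF.
rewrite (ge0_integral_affine m _ mp) ?gt_eqF//; last first.
  by move=> x; rewrite mule_ge0// lee_fin normal_pdf_ge0.
rewrite -ge0_integralZl//; last first.
  by move=> x _; rewrite mule_ge0// lee_fin normal_pdf_ge0.
apply: eq_integral => x _; rewrite muleCA -EFinM gtr0_norm//.
by rewrite normal_pdf_affine.
Qed.

(** Completing the square in [x]. For [x] standard normal and [z] of law [N(a x, b^2)] given [x],
    the joint density is factored the other way: the law of [z] times the conditional law of [x]
    given [z]. *)
Lemma normal_pdf_mul (a b x z : R) : (0 < a)%R -> (0 < b)%R ->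
  let c := Num.sqrt (a ^+ 2 + b ^+ 2) in
  (normal_pdf (a * x) b z * normal_pdf 0 1 x =
   normal_pdf 0 c z * normal_pdf (a * z / c ^+ 2) (b / c) x)%R.
Proof.
move=> a0 b0 c.
have ab0 : (0 < a ^+ 2 + b ^+ 2)%R by rewrite addr_gt0 ?exprn_gt0.
have c0 : (0 < c)%R by rewrite sqrtr_gt0.
have c2 : (c ^+ 2 = a ^+ 2 + b ^+ 2)%R by rewrite sqr_sqrtr// ltW.
have bc0 : (0 < b / c)%R by rewrite divr_gt0.
rewrite !normal_pdfE ?oner_eq0 ?gt_eqF//.
rewrite /normal_peak /normal_fun mulrACA [RHS]mulrACA; congr (_ * _)%R.
  rewrite -!invfM -!sqrtrM; last 2 first.
    by rewrite mulrn_wge0// mulr_ge0 ?sqr_ge0 ?pi_ge0.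
    by rewrite mulrn_wge0// mulr_ge0 ?sqr_ge0 ?pi_ge0.
  by congr (Num.sqrt _)^-1%R; field; rewrite gt_eqF.
rewrite -!expRD; congr expR.
rewrite expr_div_n c2; field.
by rewrite !gt_eqF.
Qed.

Let gauss_cst (c : \bar R) : \int[gauss]_x c = c.
Proof. exact: integral_probability_cst. Qed.

(** After the inner change of variable [z = a x + b y], [normal_pdf_mul] separates the variables;
    once the integrals are exchanged, the conditional density of [x] integrates to 1. *)
Lemma ge0_gauss_convolution (a b : R) (f : R -> \bar R) :
  (0 <= a)%R -> (0 <= b)%R ->
  measurable_fun setT f -> (forall x, 0 <= f x) ->
  \int[gauss]_x \int[gauss]_y f (a * x + b * y)%R =
  \int[gauss]_x f (Num.sqrt (a ^+ 2 + b ^+ 2) * x)%R.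
Proof.
(* Zero coefficients are treated apart: the density computation divides by both. *)
rewrite !le_eqVlt => /predU1P[<-|a0] /predU1P[<-|b0] mf f0.
- rewrite expr0n addr0 sqrtr0; under eq_integral do under eq_integral do rewrite !mul0r addr0.
  under [RHS]eq_integral do rewrite mul0r.
  by rewrite !gauss_cst.
- rewrite expr0n add0r sqrtr_sqr gtr0_norm//.
  under eq_integral do under eq_integral do rewrite mul0r add0r.
  by rewrite !gauss_cst.
- rewrite expr0n addr0 sqrtr_sqr gtr0_norm//.
  under eq_integral do under eq_integral do rewrite mul0r addr0.
  apply: eq_integral => x _.
  by rewrite !gauss_cst.
set c := Num.sqrt _.
have ab0 : (0 < a ^+ 2 + b ^+ 2)%R by rewrite addr_gt0 ?exprn_gt0.
have c0 : (0 < c)%R by rewrite sqrtr_gt0.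
under eq_integral do under eq_integral do rewrite addrC.
under eq_integral do rewrite ge0_integral_gauss_affine//.
pose h := fun xz : R * R => f xz.2 * (normal_pdf (a * xz.1) b xz.2)%:E * (normal_pdf 0 1 xz.1)%:E.
have mh0 : measurable_fun setT (fun xz : R * R => f xz.2 * (normal_pdf (a * xz.1) b xz.2)%:E).
  apply: emeasurable_funM; first exact: measurableT_comp.
  apply/measurable_EFinP.
  rewrite (_ : (fun _ => _) = (fun xz : R * R => normal_peak b * expR (- (xz.2 - a * xz.1) ^+ 2 / (b ^+ 2 *+ 2)))%R); last first.
    by apply/funext => xz; rewrite normal_pdfE// gt_eqF.
  apply: measurable_funM => //; apply: measurableT_comp => //.
  apply: measurable_funM => //; apply: measurableT_comp => //.
  apply: measurable_funX; apply: measurable_funB => //.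
  exact: measurable_funM.
have mh : measurable_fun setT h.
  apply: emeasurable_funM => //.
  apply/measurable_EFinP; apply: measurableT_comp => //.
  exact: measurable_normal_pdf.
have h0 xz : 0 <= h xz by rewrite !mule_ge0 ?lee_fin ?normal_pdf_ge0.
have hE x : \int[mu]_z (f z * (normal_pdf (a * x) b z)%:E) * (normal_pdf 0 1 x)%:E = \int[mu]_z h (x, z).
  rewrite -ge0_integralZr//.
  - exact: (measurableT_comp mh0 (pair1_measurable _)).
  - by move=> z _; rewrite mule_ge0 ?lee_fin ?normal_pdf_ge0.
  - by rewrite lee_fin normal_pdf_ge0.
have mI : measurable_fun setT (fun x : R => \int[mu]_z (f z * (normal_pdf (a * x) b z)%:E)).
  by apply: (measurable_fun_fubini_tonelli_F (m2 := mu) _ mh0) => xz; rewrite mule_ge0 ?lee_fin ?normal_pdf_ge0.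
rewrite (ge0_integral_normal_prob _ _ mI); last first.
  by move=> x; apply: integral_ge0 => z _; rewrite mule_ge0 ?lee_fin ?normal_pdf_ge0.
under eq_integral do rewrite hE.
rewrite (fubini_tonelli (m1 := mu) (m2 := mu) h mh h0).
transitivity (\int[mu]_z (f z * (normal_pdf 0 c z)%:E)).
  apply: eq_integral => z _.
  rewrite /h /=.
  under eq_integral do rewrite -muleA -EFinM normal_pdf_mul// EFinM muleA.
  rewrite ge0_integralZl//; last 3 first.
  - by apply/measurable_EFinP; exact: measurable_normal_pdf.
  - by move=> x _; rewrite lee_fin normal_pdf_ge0.
  - by rewrite mule_ge0 ?lee_fin ?normal_pdf_ge0.
  by rewrite integral_normal_pdf mule1.
rewrite -ge0_integral_gauss_affine//.
by under eq_integral do rewrite addr0.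
Qed.

End NormalCalculus.

Section GaussVectors.
Local Open Scope ereal_scope.
Context {R : realType}.
Notation mu := (@lebesgue_measure R).
Notation gauss := (@normal_prob R 0 1).

(** Symmetry of the normal density. It extends the convolution formula from nonnegative coefficients
    to arbitrary ones. *)
Lemma ge0_integral_gauss_norm (b : R) (f : R -> \bar R) :
  measurable_fun setT f -> (forall x, 0 <= f x) ->
  \int[gauss]_x f (b * x)%R = \int[gauss]_x f (`|b| * x)%R.
Proof.
move=> mf f0; have [b0|b0] := leP 0%R b; first by rewrite ger0_norm.
rewrite ltr0_norm//.
have mg (a : R) : measurable_fun setT (fun x : R => f (a * x)%R).
  by apply: (measurableT_comp mf); exact: measurable_funM.
have mh (a : R) : measurable_fun setT (fun x : R => f (a * x)%R * (normal_pdf 0 1 x)%:E).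
  by apply: emeasurable_funM => //; apply/measurable_EFinP; exact: measurable_normal_pdf.
rewrite (ge0_integral_normal_prob _ _ (mg b)) => [|x]; last exact: f0.
rewrite (ge0_integral_normal_prob _ _ (mg (- b)%R)) => [|x]; last exact: f0.
have N1 : (-1 != 0 :> R)%R by rewrite oppr_eq0 oner_eq0.
have := ge0_integral_affine 0 N1 (mh b).
rewrite normrN1 invr1 mul1e => <- => [|x]; last first.
  by rewrite mule_ge0// lee_fin normal_pdf_ge0.
apply: eq_integral => x _; rewrite addr0 mulN1r mulrN mulNr.
congr (_ * _%:E); rewrite normal_pdfE ?oner_eq0// /normal_fun.
by rewrite !subr0 sqrrN.
Qed.

(** One standard normal factor is adjoined to the product space at each step. Independence is
    recorded only through the laws of linear combinations, which is all that [normal_vector] asks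
    for. *)
Lemma iid_gauss_exists (k : nat) :
  exists (d : measure_display) (T : measurableType d) (P : probability T R)
    (xi : 'I_k -> T -> R), (forall i, measurable_fun setT (xi i)) /\
  forall (c : 'I_k -> R) (f : R -> \bar R),
  measurable_fun setT f -> (forall x, 0 <= f x) ->
  \int[P]_w f (\sum_i c i * xi i w)%R =
  \int[gauss]_x f (Num.sqrt (\sum_i c i ^+ 2) * x)%R.
Proof.
elim: k => [|k [d [T [P [xi [mxi IH]]]]]].
  exists _, _, (@normal_prob R 0 1), (fun _ => cst 0%R); split => [//|c f mf f0].
  under eq_integral do rewrite big_ord0.
  under [RHS]eq_integral do rewrite big_ord0 sqrtr0 mul0r.
  by [].
pose P2 : probability _ R := (P \x gauss)%E.
exists _, _, P2.
pose xi' (i : 'I_k.+1) (w : T * measurableTypeR R) : R :=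
  if unlift ord_max i is Some j then xi j w.1 else w.2.
exists xi'; split.
  move=> i; rewrite /xi'; case: (unlift ord_max i) => [j|].
    exact: measurableT_comp.
  exact: measurable_snd.
move=> c f mf f0.
have mS : measurable_fun setT (fun w => \sum_(i < k) c (widen_ord (leqnSn k) i) * xi i w)%R.
  by apply: measurable_sum => i; exact: measurable_funM.
pose S w := (\sum_(i < k) c (widen_ord (leqnSn k) i) * xi i w)%R.
pose b := c ord_max.
have SE w : (\sum_i c i * xi' i w)%R = (S w.1 + b * w.2)%R.
  rewrite big_ord_recr/= /S; congr (_ + _)%R.
    apply: eq_bigr => i _; congr (_ * _)%R; rewrite /xi'.
    have -> : widen_ord (leqnSn k) i = lift ord_max i by apply: val_inj; rewrite /= /bump leqNgt ltn_ord.
    by rewrite liftK.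
  by rewrite /xi' unlift_none.
under eq_integral do rewrite SE.
pose g := fun w : T * measurableTypeR R => f (S w.1 + b * w.2)%R.
have mg : measurable_fun setT g.
  apply: (measurableT_comp mf); apply: measurable_funD.
    exact: (measurableT_comp mS).
  by apply: measurable_funM => //; exact: measurable_snd.
rewrite (fubini_tonelli1 g mg) => [|w]; last exact: f0.
rewrite /fubini_F /g /=.
pose F s := \int[gauss]_y f (s + b * y)%R.
have mF : measurable_fun setT F.
  have mh : measurable_fun setT (fun w : R * measurableTypeR R => f (w.1 + b * w.2)%R).
    apply: (measurableT_comp mf); apply: measurable_funD; first exact: measurable_fst.
    by apply: measurable_funM => //; exact: measurable_snd.
  by apply: (measurable_fun_fubini_tonelli_F (m2 := gauss) _ mh) => w; exact: f0.
have F0 s : 0 <= F s by apply: integral_ge0 => y _; exact: f0.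
rewrite (IH (fun i => c (widen_ord (leqnSn k) i)) F mF F0) /F.
rewrite big_ord_recr/=; set v := (\sum_(i < k) _)%R.
have v0 : (0 <= v)%R by apply: sumr_ge0 => i _; exact: sqr_ge0.
under eq_integral => x _.
  rewrite (@ge0_integral_gauss_norm b (fun z => f (Num.sqrt v * x + z)%R)); last 2 first.
  - by apply: (measurableT_comp mf); exact: measurable_funD.
  - by move=> z; exact: f0.
  over.
rewrite ge0_gauss_convolution// ?sqrtr_ge0//.
by rewrite sqr_sqrtr// real_normK ?num_real.
Qed.

End GaussVectors.

(** * Characteristic function of the standard normal law *)

Section GaussCharacteristic.
Context {R : realType}.
Notation mu := (@lebesgue_measure R).
Notation gauss := (@normal_prob R 0 1).

Let mcos (s : R) : measurable_fun setT (fun x : measurableTypeR R => cos (s * x)).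
Proof.
apply: (@measurableT_comp _ _ _ _ _ _ (cos : R -> R)) => //.
exact: (continuous_measurable_fun (@continuous_cos R)).
Qed.

Let msin (s : R) : measurable_fun setT (fun x : measurableTypeR R => sin (s * x)).
Proof.
apply: (@measurableT_comp _ _ _ _ _ _ (sin : R -> R)) => //.
exact: (continuous_measurable_fun (@continuous_sin R)).
Qed.

Let icos (s : R) : gauss.-integrable setT (EFin \o (fun x => cos (s * x))).
Proof. by apply: (@integrable_bounded _ _ _ gauss _ 1 (mcos s)) => x; exact: cos_max. Qed.

Let isin (s : R) : gauss.-integrable setT (EFin \o (fun x => sin (s * x))).
Proof. by apply: (@integrable_bounded _ _ _ gauss _ 1 (msin s)) => x; exact: sin_max. Qed.

Definition gauss_cf (s : R) : R := \int[gauss]_x cos (s * x).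

Lemma gauss_cf_le1 s : `|gauss_cf s| <= 1.
Proof. by apply: (norm_Rintegral_le_cst (icos s)) => x; exact: cos_max. Qed.

Lemma gauss_cf0 : gauss_cf 0 = 1.
Proof.
rewrite /gauss_cf; under eq_Rintegral do rewrite mul0r cos0.
exact: Rintegral_prob_cst.
Qed.

(** By symmetry the integral equals its opposite. Adding 1 makes the integrand nonnegative, as
    [ge0_integral_gauss_norm] requires. *)
Lemma gauss_sin (s : R) : \int[gauss]_x sin (s * x) = 0.
Proof.
have i1 (t : R) : gauss.-integrable setT (EFin \o (fun x => 1 + sin (t * x))).
  by apply: integrableDR => //; exact: integrable_cstR.
have e (t : R) : (\int[gauss]_x (1 + sin (t * x))%:E)%E = (1 + \int[gauss]_x sin (t * x))%:E.
  rewrite (Rintegral_EFin (i1 t)) RintegralD//; last exact: integrable_cstR.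
  by rewrite Rintegral_prob_cst.
have m1 : measurable_fun setT (fun x : R => (1 + sin x)%:E).
  by apply/measurable_EFinP; apply: measurable_funD => //; exact: (continuous_measurable_fun (@continuous_sin R)).
have p1 (x : R) : (0 <= (1 + sin x)%:E)%E.
  by rewrite lee_fin; have := sin_geN1 x; lra.
have := ge0_integral_gauss_norm s m1 p1; have := ge0_integral_gauss_norm (- s) m1 p1.
rewrite !e normrN => <- [].
suff -> : \int[gauss]_x sin (- s * x) = - \int[gauss]_x sin (s * x).
  by move: (\int[gauss]_x _) => r; lra.
rewrite -[RHS]mulN1r -RintegralZl//; apply: eq_Rintegral => x _.
by rewrite mulNr sinN mulN1r.
Qed.

(** The convolution formula at [1 + cos]: the addition formula splits the inner integral, and its
    sine part vanishes by [gauss_sin]. *)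
Lemma gauss_cfM (a b : R) : 0 <= a -> 0 <= b ->
  gauss_cf (Num.sqrt (a ^+ 2 + b ^+ 2)) = gauss_cf a * gauss_cf b.
Proof.
move=> a0 b0.
have m1 : measurable_fun setT (fun x : R => (1 + cos x)%:E).
  by apply/measurable_EFinP; apply: measurable_funD => //; exact: (continuous_measurable_fun (@continuous_cos R)).
have p1 (x : R) : (0 <= (1 + cos x)%:E)%E.
  by rewrite lee_fin; have := cos_geN1 x; lra.
have e (t : R) : (\int[gauss]_x (1 + cos (t * x))%:E)%E = (1 + gauss_cf t)%:E.
  rewrite Rintegral_EFin; last by apply: integrableDR => //; exact: integrable_cstR.
  by rewrite RintegralD// ?Rintegral_prob_cst//; exact: integrable_cstR.
have inner x : (\int[gauss]_y (1 + cos (a * x + b * y))%:E)%E = (1 + cos (a * x) * gauss_cf b)%:E.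
  under eq_integral do rewrite cosD addrA.
  have i1 : gauss.-integrable setT (EFin \o (fun y => 1 + cos (a * x) * cos (b * y))).
    by apply: integrableDR; [exact: integrable_cstR|exact: integrableZR].
  have i2 : gauss.-integrable setT (EFin \o (fun y => sin (a * x) * sin (b * y))).
    exact: integrableZR.
  rewrite Rintegral_EFin; last exact: integrableBR.
  rewrite (RintegralB measurableT i1 i2) RintegralD//; last 2 first.
  - exact: integrable_cstR.
  - exact: integrableZR.
  by rewrite Rintegral_prob_cst !RintegralZl// gauss_sin mulr0 subr0.
have := ge0_gauss_convolution a0 b0 m1 p1; rewrite e.
under eq_integral do rewrite inner.
have iz : gauss.-integrable setT (EFin \o (fun x => cos (a * x) * gauss_cf b)).
  rewrite (_ : (fun _ => _) = (fun x => gauss_cf b * cos (a * x))).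
    exact: integrableZR.
  by apply/funext => x; rewrite mulrC.
rewrite Rintegral_EFin; last by apply: integrableDR => //; exact: integrable_cstR.
rewrite RintegralD//; last exact: integrable_cstR.
rewrite Rintegral_prob_cst RintegralZr// -/(gauss_cf a) => -[].
by move: (gauss_cf a) (gauss_cf b) (gauss_cf _) => p q r; lra.
Qed.

(** Completing the square: [expR (s x)] times the standard density is [expR (s^2 / 2)] times the
    density centred at [s]. *)
Lemma gauss_mgf (s : R) : (\int[gauss]_x (expR (s * x))%:E)%E = (expR (s ^+ 2 / 2))%:E.
Proof.
have mE : measurable_fun setT (fun x : R => (expR (s * x))%:E).
  by apply/measurable_EFinP; apply: (@measurableT_comp _ _ _ _ _ _ (expR : R -> R)).
rewrite (ge0_integral_normal_prob _ _ mE); last first.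
  by move=> x; rewrite lee_fin expR_ge0.
transitivity (\int[mu]_x ((expR (s ^+ 2 / 2))%:E * (normal_pdf s 1 x)%:E))%E.
  apply: eq_integral => x _; rewrite -!EFinM; congr EFin.
  rewrite !normal_pdfE ?oner_eq0// /normal_fun mulrCA [RHS]mulrCA.
  by rewrite -!expRD; congr (_ * expR _); field.
rewrite ge0_integralZl//.
- by rewrite integral_normal_pdf mule1.
- by apply/measurable_EFinP; exact: measurable_normal_pdf.
- by move=> x _; rewrite lee_fin normal_pdf_ge0.
Qed.

Let iexp (s : R) : gauss.-integrable setT (EFin \o (fun x => expR (s * x))).
Proof.
apply/integrableP; split.
  apply/measurable_EFinP; apply: (@measurableT_comp _ _ _ _ _ _ (expR : R -> R)) => //.
under eq_integral do rewrite /= ger0_norm ?expR_ge0//.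
by rewrite gauss_mgf ltry.
Qed.

Let icosh (s : R) : gauss.-integrable setT (EFin \o (fun x => cosh2 (s * x))).
Proof.
rewrite (_ : (fun _ => _) = (fun x => expR (s * x) + expR ((- s) * x))).
  exact: integrableDR.
by apply/funext => x; rewrite /cosh2 mulNr.
Qed.

Lemma gauss_cosh2 (s : R) : \int[gauss]_x cosh2 (s * x) = 2 * expR (s ^+ 2 / 2).
Proof.
transitivity (\int[gauss]_x (expR (s * x) + expR ((- s) * x))).
  by apply: eq_Rintegral => x _; rewrite /cosh2 mulNr.
by rewrite RintegralD// /Rintegral !gauss_mgf/= sqrrN; ring.
Qed.

(** The quadratic terms of [2 cos] and [cosh2] cancel, leaving an error of order [s^4]. The
    dominating function is [cosh2 x ^+ 4], expanded so that its Gaussian integral is finite by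
    [gauss_mgf]. *)
Lemma cos_cosh2_bound (s x : R) : `|s| <= 1 ->
  `|2 * cos (s * x) + cosh2 (s * x) - 4| <=
  s ^+ 4 * (cosh2 (4 * x) + 4 * cosh2 (2 * x) + 6).
Proof.
move=> s1.
have -> : cosh2 (4 * x) + 4 * cosh2 (2 * x) + 6 = cosh2 x ^+ 4.
  rewrite (_ : cosh2 x ^+ 4 = (cosh2 x ^+ 2) ^+ 2); last by rewrite -exprM.
  rewrite cosh2_sqr (_ : cosh2 (4 * x) = cosh2 (2 * x) ^+ 2 - 2); last first.
    by rewrite cosh2_sqr mulrA -natrM addrK.
  by ring.
have c2 := cosh2_ge2 x.
have cs : cosh2 (s * x) <= 2 * cosh2 x.
  suff h y : `|y| <= `|x| -> expR y <= cosh2 x.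
    rewrite /cosh2 (_ : 2 * _ = cosh2 x + cosh2 x); last by rewrite /cosh2; ring.
    by apply: lerD; apply: h; rewrite ?normrN normrM ler_piMl.
  move=> yx; rewrite (le_trans (y := expR `|x|))//.
    by rewrite ler_expR (le_trans (ler_norm _)).
  rewrite /cosh2; have := expR_ge0 x; have := expR_ge0 (- x).
  by case: (ger0P x) => _; lra.
have := cosh2_ge x; have := cosh2_ge (s * x); have := cosh2_le (s * x).
have := cos_le (s * x); have := cos_ge1B (s * x).
set c := cosh2 x in c2 cs *; set C := cosh2 (s * x) in cs *.
set k := cos _.
have -> : (s * x) ^+ 2 = s ^+ 2 * x ^+ 2 by rewrite exprMn.
have -> : (s * x) ^+ 4 = s ^+ 4 * (x ^+ 2) ^+ 2 by rewrite exprMn -exprM.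
have : 0 <= s ^+ 4 by rewrite exprn_even_ge0.
have : 0 <= x ^+ 2 by rewrite sqr_ge0.
move: (s ^+ 4) (x ^+ 2) => t y y0 t0 h1 h2 h3 h4 h5.
have y2 : 0 <= y ^+ 2 <= c ^+ 2 by rewrite sqr_ge0/= lerXn2r ?nnegrE; lra.
move: (y ^+ 2) y2 h2 h3 => z /andP[z0 zc] h2 h3.
have h6 : t * z * C <= t * z * (2 * c) by rewrite ler_wpM2l// mulr_ge0.
have h7 : t * z <= t * c ^+ 2 by rewrite ler_wpM2l.
have h8 : t * z * c <= t * c ^+ 2 * c by rewrite ler_wpM2r//; lra.
have c20 : 0 <= t * c ^+ 2 by rewrite mulr_ge0 ?sqr_ge0.
have h9 : t * c ^+ 2 * 2 <= t * c ^+ 2 * c by rewrite ler_wpM2l.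
have h10 : t * c ^+ 2 * c * 2 <= t * c ^+ 2 * c * c.
  by rewrite ler_wpM2l// mulr_ge0//; lra.
have -> : t * c ^+ 4 = t * c ^+ 2 * c * c by ring.
have tz0 : 0 <= t * z by rewrite mulr_ge0.
by apply/ler_normlP; split; lra.
Qed.

(** No moment of the normal law is computed: integrating [cos_cosh2_bound] gives
    [gauss_cf s = 2 - expR u + O(s^4)] with [u = s^2 / 2], and [2 - expR u] differs from
    [expR (- u)] by [cosh2 u - 2 = O(u^2)]. *)
Lemma gauss_cf_approx : exists2 C : R, 0 <= C &
  forall s, `|s| <= 1 -> `|gauss_cf s - expR (- (s ^+ 2 / 2))| <= C * s ^+ 4.
Proof.
pose K : R := \int[gauss]_x (cosh2 (4 * x) + 4 * cosh2 (2 * x) + 6).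
have iK : gauss.-integrable setT (EFin \o (fun x => cosh2 (4 * x) + 4 * cosh2 (2 * x) + 6)).
  apply: integrableDR; last exact: integrable_cstR.
  by apply: integrableDR => //; exact: integrableZR.
have K0 : 0 <= K.
  apply: Rintegral_ge0 => x _.
  by have := cosh2_ge2 (4 * x); have := cosh2_ge2 (2 * x); lra.
exists (K / 2 + cosh2 1); first by have := cosh2_ge2 (1 : R); lra.
move=> s s1; set u := s ^+ 2 / 2.
have h1 : `|2 * gauss_cf s + 2 * expR u - 4| <= s ^+ 4 * K.
  rewrite -gauss_cosh2 -(Rintegral_prob_cst gauss 4) -RintegralZl//.
  rewrite -RintegralD//; last exact: integrableZR.
  rewrite -RintegralB//; last 2 first.
  - by apply: integrableDR => //; exact: integrableZR.
  - exact: integrable_cstR.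
  rewrite -RintegralZl//; apply: norm_Rintegral_le.
  - apply: integrableBR; last exact: integrable_cstR.
    by apply: integrableDR => //; exact: integrableZR.
  - exact: integrableZR.
  - by move=> x; exact: cos_cosh2_bound.
have h2 := cosh2_le u; have h3 := cosh2_ge u.
have s2 : 0 <= s ^+ 2 <= 1 by rewrite sqr_ge0/= -real_normK ?num_real// exprn_ile1.
have u1 : 0 <= u <= 1 by rewrite /u; lra.
have cu : cosh2 u <= 2 * cosh2 1.
  rewrite /cosh2; have := expR_ge0 (- 1 : R).
  have : expR u <= expR 1 by rewrite ler_expR; lra.
  have : expR (- u) <= expR 1 by rewrite ler_expR; lra.
  lra.
have u2 : u ^+ 2 = s ^+ 4 / 4 by rewrite /u; field.
have u4 : u ^+ 4 <= u ^+ 2.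
  by rewrite -[4%N]/(2 + 2)%N exprD ler_piMr ?sqr_ge0// exprn_ile1; lra.
have s4 : 0 <= s ^+ 4 by rewrite exprn_even_ge0.
have c1 := cosh2_ge2 (1 : R).
have h4 : u ^+ 4 * cosh2 u <= s ^+ 4 / 4 * (2 * cosh2 1).
  rewrite -u2; apply: ler_pM => //; first by rewrite exprn_even_ge0.
  by have := cosh2_ge2 u; lra.
have h5 : s ^+ 4 * 2 <= s ^+ 4 * cosh2 1 by rewrite ler_wpM2l.
have h6 : expR (- u) = cosh2 u - expR u by rewrite /cosh2; ring.
move: h1 => /ler_normlP[h11 h12].
rewrite h6; apply/ler_normlP; rewrite mulrDl; split; nra.
Qed.

(* [gauss_cf] and [expR (- s^2 / 2)] both satisfy [g (sqrt 2 s) = g s ^ 2] and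
   they agree up to [O(s^4)] at 0. *)
Lemma gauss_cfE (s : R) : gauss_cf s = expR (- (s ^+ 2 / 2)).
Proof.
wlog s0 : s / 0 <= s => [h|].
  have [/h//|/ltW s0] := leP 0 s.
  rewrite -[in RHS]sqrrN -h ?oppr_ge0//; apply: eq_Rintegral => x _.
  by rewrite mulNr cosN.
have [C C0 HC] := gauss_cf_approx.
(* One factor is adjoined at a time; both functions are bounded by 1, so the errors [C t^4] add
   up. *)
have step (t : R) (n : nat) : 0 <= t <= 1 ->
    `|gauss_cf (Num.sqrt n%:R * t) - expR (- ((Num.sqrt n%:R * t) ^+ 2 / 2))| <= n%:R * (C * t ^+ 4).
  move=> /andP[t0 t1]; elim: n => [|n IH].
    by rewrite sqrtr0 !mul0r gauss_cf0 expr0n/= mul0r oppr0 expR0 subrr normr0.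
  have -> : Num.sqrt n.+1%:R * t = Num.sqrt ((Num.sqrt n%:R * t) ^+ 2 + t ^+ 2).
    rewrite exprMn sqr_sqrtr// -[X in _ + X]mul1r -mulrDl natr1.
    by rewrite sqrtrM// sqrtr_sqr ger0_norm.
  rewrite sqr_sqrtr ?addr_ge0 ?sqr_ge0// gauss_cfM ?mulr_ge0 ?sqrtr_ge0//.
  rewrite mulrDl opprD expRD.
  set A := gauss_cf _ in IH *; set B := expR _ in IH *.
  have B1 : `|B| <= 1.
    by rewrite ger0_norm ?expR_ge0// expR_le1 oppr_le0 divr_ge0// sqr_ge0.
  have -> : A * gauss_cf t - B * expR (- (t ^+ 2 / 2)) =
     (A - B) * gauss_cf t + B * (gauss_cf t - expR (- (t ^+ 2 / 2))) by ring.
  rewrite (le_trans (ler_normD _ _))//.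
  rewrite [leRHS](_ : _ = n%:R * (C * t ^+ 4) + C * t ^+ 4); last first.
    by rewrite -natr1 mulrDl mul1r.
  apply: lerD; rewrite normrM.
    by rewrite (le_trans _ IH)// ler_piMr// gauss_cf_le1.
  by rewrite (le_trans _ (HC t _))// ?ler_piMl// ger0_norm.
apply/eqP; rewrite -subr_eq0 -normr_le0; apply/ler_addgt0Pr => e e0; rewrite add0r.
(* With [t = s / sqrt n] the accumulated error is [C s^4 / n]; [n] makes it at most [e] and also
   ensures [t <= 1]. *)
have [n hn] : exists n : nat, (0 < n)%N /\ s <= Num.sqrt n%:R /\ C * s ^+ 4 <= e * n%:R.
  have [n hn] := ltr_add_invr (ltr01 : (0 : R) < 1).
  exists (maxn (Num.bound (s ^+ 2)) (Num.bound (C * s ^+ 4 / e))).+1; split => //; split.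
    rewrite -[leLHS](ger0_norm s0) -sqrtr_sqr ler_wsqrtr//.
    rewrite (le_trans (ltW (archi_boundP (sqr_ge0 s))))// ler_nat ltnW// ltnS leq_maxl//.
  rewrite -ler_pdivrMl// mulrC (le_trans (ltW (archi_boundP _)))//.
    by rewrite divr_ge0 ?mulr_ge0 ?exprn_even_ge0// ltW.
  by rewrite ler_nat ltnW// ltnS leq_maxr.
case: hn => n0 [sn Cn].
have sn0 : 0 < Num.sqrt n%:R :> R by rewrite sqrtr_gt0 ltr0n.
have := step (s / Num.sqrt n%:R) n.
rewrite divr_ge0 ?sqrtr_ge0//= ler_pdivrMr// mul1r sn => /(_ isT).
rewrite mulrC divfK ?gt_eqF// => /le_trans; apply.
have -> : n%:R * (C * (s / Num.sqrt n%:R) ^+ 4) = C * s ^+ 4 / n%:R.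
  rewrite expr_div_n -[4%N]/(2 * 2)%N [Num.sqrt _ ^+ _]exprM sqr_sqrtr//.
  by field; rewrite pnatr_eq0 -lt0n.
by rewrite ler_pdivrMr ?ltr0n.
Qed.

Lemma gauss_cos_shift (s c : R) :
  \int[gauss]_x cos (s * x + c) = expR (- (s ^+ 2 / 2)) * cos c.
Proof.
under eq_Rintegral do rewrite cosD [_ * cos c]mulrC [_ * sin c]mulrC.
rewrite RintegralB//; try exact: integrableZR.
by rewrite !RintegralZl// gauss_sin mulr0 subr0 mulrC -/(gauss_cf s) gauss_cfE.
Qed.

End GaussCharacteristic.

(** * Linear algebra *)

Section DotProduct.
Context {R : realType}.

Lemma dotvE k (u v : 'cV[R]_k) : dotv u v = \sum_i u i 0 * v i 0.
Proof. by rewrite /dotv !mxE; apply: eq_bigr => i _; rewrite !mxE. Qed.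

Lemma dotvC k (u v : 'cV[R]_k) : dotv u v = dotv v u.
Proof. by rewrite !dotvE; apply: eq_bigr => i _; rewrite mulrC. Qed.

Lemma dotvDr k (u v w : 'cV[R]_k) : dotv u (v + w) = dotv u v + dotv u w.
Proof. by rewrite /dotv mulmxDr mxE. Qed.

Lemma dotvDl k (u v w : 'cV[R]_k) : dotv (v + w) u = dotv v u + dotv w u.
Proof. by rewrite !(dotvC _ u) dotvDr. Qed.

Lemma dotvZr k a (u v : 'cV[R]_k) : dotv u (a *: v) = a * dotv u v.
Proof. by rewrite /dotv -scalemxAr mxE. Qed.

Lemma dotvZl k a (u v : 'cV[R]_k) : dotv (a *: u) v = a * dotv u v.
Proof. by rewrite dotvC dotvZr dotvC. Qed.

Lemma dotvNr k (u v : 'cV[R]_k) : dotv u (- v) = - dotv u v.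
Proof. by rewrite -scaleN1r dotvZr mulN1r. Qed.

Lemma dotvNl k (u v : 'cV[R]_k) : dotv (- u) v = - dotv u v.
Proof. by rewrite dotvC dotvNr dotvC. Qed.

Lemma dotvBr k (u v w : 'cV[R]_k) : dotv u (v - w) = dotv u v - dotv u w.
Proof. by rewrite dotvDr dotvNr. Qed.

Lemma dotvBl k (u v w : 'cV[R]_k) : dotv (v - w) u = dotv v u - dotv w u.
Proof. by rewrite dotvDl dotvNl. Qed.

Lemma dotv0 k (u : 'cV[R]_k) : dotv u 0 = 0.
Proof. by rewrite /dotv mulmx0 mxE. Qed.

Lemma dot0v k (u : 'cV[R]_k) : dotv 0 u = 0.
Proof. by rewrite dotvC dotv0. Qed.

Lemma dotv_sumr k (I : Type) (s : seq I) (u : 'cV[R]_k) (F : I -> 'cV[R]_k) :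
  dotv u (\sum_(i <- s) F i) = \sum_(i <- s) dotv u (F i).
Proof.
elim/big_rec2: _ => [|i x y _ <-]; first by rewrite dotv0.
by rewrite dotvDr.
Qed.

Lemma dotv_mulmx k l (A : 'M[R]_(k, l)) u v : dotv u (A *m v) = dotv (A^T *m u) v.
Proof. by rewrite /dotv trmx_mul trmxK mulmxA. Qed.

Lemma dotv_outer k (x u : 'cV[R]_k) : dotv u ((x *m x^T) *m u) = dotv u x ^+ 2.
Proof.
rewrite -mulmxA [x^T *m u]mx11_scalar -/(dotv x u) mul_mx_scalar dotvZr.
by rewrite dotvC expr2.
Qed.

Lemma dotvv_ge0 k (u : 'cV[R]_k) : 0 <= dotv u u.
Proof. by rewrite dotvE sumr_ge0// => i _; rewrite -expr2 sqr_ge0. Qed.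

Lemma dotvv_eq0 k (u : 'cV[R]_k) : (dotv u u == 0) = (u == 0).
Proof.
apply/eqP/eqP => [|->]; last by rewrite dotv0.
rewrite dotvE => /psumr_eq0P h; apply/matrixP => i j; rewrite ord1 mxE.
have : u i 0 * u i 0 = 0 by apply: h => // k0 _; rewrite -expr2 sqr_ge0.
by move/eqP; rewrite mulf_eq0 orbb => /eqP.
Qed.

Lemma dotvv_gt0 k (u : 'cV[R]_k) : u != 0 -> 0 < dotv u u.
Proof. by move=> u0; rewrite lt0r dotvv_eq0 u0 dotvv_ge0. Qed.

Lemma posdefmx1 k : posdefmx (1%:M : 'M[R]_k).
Proof. by split; [exact: trmx1|move=> u u0; rewrite mul1mx dotvv_gt0]. Qed.

Lemma posdefmx_ge0 k (A : 'M[R]_k) u : posdefmx A -> 0 <= dotv u (A *m u).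
Proof.
by move=> [_ pA]; have [->|/pA/ltW//] := eqVneq u 0; rewrite mulmx0 dotv0.
Qed.

(** Nonnegativity of the form at [c u - b v], where [b = u . A v] and [c = v . A v]. *)
Lemma posdefmx_CauchySchwarz k (A : 'M[R]_k) (u v : 'cV[R]_k) : posdefmx A ->
  dotv u (A *m v) ^+ 2 <= dotv u (A *m u) * dotv v (A *m v).
Proof.
move=> pA; have [->|v0] := eqVneq v 0.
  by rewrite mulmx0 !dotv0 expr0n mulr0.
have c0 : 0 < dotv v (A *m v) by apply pA.2.
set b := dotv u (A *m v); set c := dotv v _ in c0 *; set a := dotv u (A *m u).
have := posdefmx_ge0 (c *: u - b *: v) pA.
rewrite mulmxBr -!scalemxAr !(dotvBl, dotvBr, dotvZl, dotvZr).
have -> : dotv v (A *m u) = b by rewrite dotv_mulmx pA.1 dotvC.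
rewrite -/a -/b -/c => h.
by rewrite -subr_ge0 -(pmulr_rge0 _ c0); move: h; congr (0 <= _); ring.
Qed.

Lemma l2norm_ge0 k (u : 'cV[R]_k) : 0 <= l2norm u.
Proof. exact: sqrtr_ge0. Qed.

Lemma sqr_l2norm k (u : 'cV[R]_k) : l2norm u ^+ 2 = dotv u u.
Proof. by rewrite sqr_sqrtr// dotvv_ge0. Qed.

Lemma dotv_CauchySchwarz k (u v : 'cV[R]_k) : `|dotv u v| <= l2norm u * l2norm v.
Proof.
rewrite -ler_sqr ?nnegrE ?mulr_ge0 ?l2norm_ge0// exprMn !sqr_l2norm.
rewrite real_normK ?num_real//.
by have := posdefmx_CauchySchwarz u v (posdefmx1 k); rewrite !mul1mx.
Qed.

Lemma l2norm0 k : l2norm (0 : 'cV[R]_k) = 0.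
Proof. by rewrite /l2norm dotv0 sqrtr0. Qed.

Lemma l2norm_eq0 k (u : 'cV[R]_k) : (l2norm u == 0) = (u == 0).
Proof. by rewrite -dotvv_eq0 -sqr_l2norm sqrf_eq0. Qed.

Lemma l2normZ k a (u : 'cV[R]_k) : l2norm (a *: u) = `|a| * l2norm u.
Proof.
by rewrite /l2norm dotvZl dotvZr mulrA -expr2 sqrtrM ?sqr_ge0// sqrtr_sqr.
Qed.

Lemma l2normN k (u : 'cV[R]_k) : l2norm (- u) = l2norm u.
Proof. by rewrite /l2norm dotvNl dotvNr opprK. Qed.

Lemma l2normD k (u v : 'cV[R]_k) : l2norm (u + v) <= l2norm u + l2norm v.
Proof.
rewrite -ler_sqr ?nnegrE ?addr_ge0 ?l2norm_ge0// sqrrD !sqr_l2norm.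
rewrite dotvDl !dotvDr (dotvC v u).
have := dotv_CauchySchwarz u v; have := ler_norm (dotv u v).
by rewrite -mulr_natr; move: (dotv _ _) (l2norm u) (l2norm v) => x y z; lra.
Qed.

Lemma l2norm_distr k (u v : 'cV[R]_k) : `|l2norm u - l2norm v| <= l2norm (u - v).
Proof.
have h (a b : 'cV[R]_k) : l2norm a - l2norm b <= l2norm (a - b).
  by rewrite lerBlDr -{1}(subrK b a) l2normD.
by rewrite ler_norml h andbT lerNl opprB -(l2normN (u - v)) opprB h.
Qed.

Lemma norm_coord_le k (u : 'cV[R]_k) i : `|u i 0| <= l2norm u.
Proof.
rewrite -ler_sqr ?nnegrE ?l2norm_ge0// sqr_l2norm real_normK ?num_real//.
rewrite dotvE (bigD1 i)//= -expr2 lerDl sumr_ge0// => j _.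
by rewrite -expr2 sqr_ge0.
Qed.

Lemma l2norm_le_sum k (u : 'cV[R]_k) : l2norm u <= \sum_i `|u i 0|.
Proof.
have s0 : 0 <= \sum_i `|u i 0| by rewrite sumr_ge0.
rewrite -ler_sqr ?nnegrE ?l2norm_ge0// sqr_l2norm dotvE expr2 mulr_suml.
apply: ler_sum => i _; rewrite -expr2 -real_normK ?num_real// expr2.
by rewrite ler_wpM2l// (bigD1 i)//= lerDl sumr_ge0.
Qed.

Lemma quadratic_form_le k (A : 'M[R]_k) (u : 'cV[R]_k) :
  `|dotv u (A *m u)| <= (\sum_i \sum_j `|A i j|) * dotv u u.
Proof.
rewrite dotvE (le_trans (ler_norm_sum _ _ _))// mulr_suml ler_sum// => i _.
rewrite mxE mulr_sumr (le_trans (ler_norm_sum _ _ _))// mulr_suml ler_sum// => j _.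
rewrite mulrCA normrM ler_wpM2l// normrM -sqr_l2norm expr2.
by rewrite ler_pM ?norm_coord_le.
Qed.

Lemma posdefmx_unit k (A : 'M[R]_k) : posdefmx A -> A \in unitmx.
Proof.
move=> [sA pA]; rewrite -row_free_unit -kermx_eq0.
apply/eqP/row_matrixP => i; rewrite row0; apply/eqP/negPn/negP => r0.
set v := row i (kermx A) in r0 *.
have vA : v *m A = 0 by rewrite -row_mul mulmx_ker row0.
have := pA v^T; rewrite -{1}sA -trmx_mul vA trmx0 dotv0 ltxx => h.
by have /h : v^T != 0 by rewrite -trmx0 (inj_eq trmx_inj).
Qed.

Lemma posdefmx_inv k (A : 'M[R]_k) : posdefmx A -> posdefmx (invmx A).
Proof.
move=> pA; have uA := posdefmx_unit pA; split; first by rewrite trmx_inv pA.1.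
move=> u u0; rewrite -{1}(mulKVmx uA u) dotvC dotv_mulmx -{1}[A]pA.1 trmxK.
rewrite dotvC dotv_mulmx pA.1 dotvC; apply: pA.2.
by apply: contraNneq u0 => e; rewrite -(mulKVmx uA u) e mulmx0.
Qed.

Lemma posdefmxZ k a (A : 'M[R]_k) : 0 < a -> posdefmx A -> posdefmx (a *: A).
Proof.
move=> a0 [sA pA]; split; first by rewrite linearZ/= sA.
by move=> u u0; rewrite -scalemxAl dotvZr mulr_gt0// pA.
Qed.

(** Plays the role of the smallest eigenvalue without spectral theory: Cauchy-Schwarz for the form
    [A], applied to [u] and [A^-1 u], gives [(u . u)^2 <= (u . A u) (u . A^-1 u)], and the last
    factor is at most [M (u . u)]. *)
Lemma posdefmx_lower k (A : 'M[R]_k) : posdefmx A ->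
  exists2 lam : R, 0 < lam & forall u, lam * dotv u u <= dotv u (A *m u).
Proof.
move=> pA; have uA := posdefmx_unit pA.
pose M : R := 1 + \sum_i \sum_j `|invmx A i j|.
have M0 : 0 < M.
  by rewrite ltr_wpDr ?ltr01// sumr_ge0// => i _; rewrite sumr_ge0.
exists M^-1; first by rewrite invr_gt0.
move=> u; have [->|u0] := eqVneq u 0; first by rewrite mulmx0 !dotv0 mulr0.
have d0 := dotvv_gt0 u0.
have := posdefmx_CauchySchwarz u (invmx A *m u) pA; rewrite mulKVmx//.
have := quadratic_form_le (invmx A) u; rewrite (dotvC (invmx A *m u)).
set q := dotv u (invmx A *m u); set a := dotv u (A *m u); set b := dotv u u.
move=> h1 h2; rewrite ler_pdivrMl// -(ler_pM2r d0) -/b.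
have a0 : 0 <= a := posdefmx_ge0 u pA.
rewrite -expr2 (le_trans h2)//.
have : q <= M * b.
  rewrite (le_trans (ler_norm _))// (le_trans h1)// ler_wpM2r// ?ltW//.
  by rewrite /M ltrDr.
by move=> h; rewrite (le_trans (ler_wpM2l a0 h))// mulrCA mulrA.
Qed.

End DotProduct.

(** * Selection of the active coordinates *)

Section ActiveBlock.
Context {R : realType}.
Variables (p : nat) (d : 'I_p -> nat) (p0 : nat) (hp0 : (p0 <= p)%N).
Local Notation r := (\sum_(j < p) d j)%N.
Local Notation r0 := (\sum_(j < p0) d (widen_ord hp0 j))%N.

Definition active_index (s : 'I_r0) : 'I_r :=
  tagnat.Rank (widen_ord hp0 (tagnat.sig1 s)) (tagnat.sig2 s).

Lemma active_index_inj : injective active_index.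
Proof.
move=> s t e; rewrite -[s]tagnat.sig2K -[t]tagnat.sig2K.
have /eqP := congr1 val e; rewrite tagnat.eq_Rank => /andP[e1 e2].
apply/val_inj/eqP; rewrite tagnat.eq_Rank e2 andbT.
by apply/eqP/val_inj; move/eqP/(congr1 val): e1.
Qed.

(** The 0-1 matrix [J] selecting the active coordinates. It turns [active_vec] and [active_mx] into
    the products [J b] and [J A J^T], and [J^T] embeds active vectors by zeros. *)
Definition active_proj : 'M[R]_(r0, r) := rowsub active_index 1%:M.

Lemma active_vecE (b : 'cV[R]_r) : active_vec hp0 b = active_proj *m b.
Proof. by rewrite mul_rowsub_mx mul1mx; apply/matrixP => i j; rewrite !mxE. Qed.

Lemma active_mxE (A : 'M[R]_r) :
  active_mx hp0 A = active_proj *m A *m active_proj^T.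
Proof.
rewrite [active_proj *m A]mul_rowsub_mx mul1mx -[RHS]trmxK trmx_mul trmxK.
by rewrite mul_rowsub_mx mul1mx; apply/matrixP => i j; rewrite !mxE.
Qed.

Lemma active_proj_mulT : active_proj *m active_proj^T = 1%:M.
Proof.
apply/matrixP => i j; rewrite mul_rowsub_mx mul1mx !mxE.
by rewrite (inj_eq active_index_inj) eq_sym.
Qed.

Lemma dotv_submxcol (u v : 'cV[R]_r) :
  dotv u v = \sum_j dotv (submxcol u j) (submxcol v j).
Proof.
rewrite /dotv -{1}(submxcolK u) -{1}(submxcolK v) tr_mxcol mul_mxrow_mxcol.
by rewrite summxE.
Qed.

Lemma submxcol_active (u : 'cV[R]_r) (j : 'I_p0) :
  submxcol u (widen_ord hp0 j) = submxcol (active_proj *m u) j.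
Proof. by rewrite -active_vecE mxcolK. Qed.

Lemma submxcol_active_projT (x : 'cV[R]_r0) (j : 'I_p) : (p0 <= j)%N ->
  submxcol (active_proj^T *m x) j = 0.
Proof.
move=> jp; apply/matrixP => i k; rewrite !mxE big1// => s _; rewrite !mxE.
have [e|_] := eqVneq (active_index s) (tagnat.Rank j i); last by rewrite mul0r.
have := congr1 (fun x => val (tagnat.sig1 x)) e.
rewrite !tagnat.Rank1K/= => e1.
by move: jp; rewrite -e1 leqNgt ltn_ord.
Qed.

Lemma l2norm_submxcol (u : 'cV[R]_r) j : l2norm (submxcol u j) <= l2norm u.
Proof.
apply: ler_wsqrtr; rewrite dotv_submxcol (bigD1 j)//= lerDl sumr_ge0// => i _.
exact: dotvv_ge0.
Qed.

Lemma posdefmx_active (A : 'M[R]_r) : posdefmx A -> posdefmx (active_mx hp0 A).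
Proof.
move=> [sA pA]; rewrite active_mxE; split.
  by rewrite !trmx_mul trmxK sA mulmxA.
move=> u u0; rewrite -!mulmxA dotv_mulmx; apply: pA.
apply: contraNneq u0 => /(congr1 (mulmx active_proj)).
by rewrite mulmxA active_proj_mulT mul1mx mulmx0 => ->.
Qed.

End ActiveBlock.

(** * Cholesky factorization and existence of normal vectors *)

Section Cholesky.
Context {R : realType}.

Lemma dotv_col_mx m k (a c : 'cV[R]_m) (u v : 'cV[R]_k) :
  dotv (col_mx a u) (col_mx c v) = dotv a c + dotv u v.
Proof. by rewrite /dotv tr_col_mx mul_row_col mxE. Qed.

(** Induction on the size. The Schur complement [D - s^-1 b b^T] is again positive definite, because
    its form at [u] is the form of [S] at [(- b . u / s, u)]. *)
Lemma cholesky k (S : 'M[R]_k) : posdefmx S -> exists A : 'M[R]_k, S = A *m A^T.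
Proof.
elim: k S => [|k IH] S pS.
  by exists 0; apply/matrixP => - [].
pose s : R := S 0 0; pose b : 'cV[R]_k := dlsubmx (S : 'M[R]_(1 + k)).
pose D : 'M[R]_k := drsubmx (S : 'M[R]_(1 + k)).
have SE : S = block_mx s%:M b^T b D :> 'M[R]_(1 + k).
  rewrite -[LHS](@submxK _ 1 k 1 k); congr block_mx.
    by rewrite [LHS]mx11_scalar !mxE; congr (S _ _)%:M; apply/val_inj.
  by apply/matrixP => i j; rewrite !mxE -[in LHS]pS.1 mxE.
have form (x : R) (u : 'cV[R]_k) :
   let v : 'cV[R]_k.+1 := (col_mx x%:M u : 'cV[R]_(1 + k)) in
   dotv v (S *m v) = s * x ^+ 2 + 2 * x * dotv b u + dotv u (D *m u).
  rewrite /= SE (mul_block_col s%:M b^T b D) (dotv_col_mx x%:M).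
  have dotv1 (a c : 'cV[R]_1) : dotv a c = a 0 0 * c 0 0 by rewrite dotvE big_ord1.
  rewrite !dotvDr !dotv1 mul_scalar_mx (mul_mx_scalar x b) dotvZr (dotvC u b).
  rewrite (_ : (b^T *m u) 0 0 = dotv b u)// !mxE /= mulr1n.
  by ring.
have s0 : 0 < s.
  have := form 1 0; rewrite mulmx0 !dotv0 mulr0 addr0 addr0 expr1n mulr1 => <-.
  apply: pS.2; apply/negP => /eqP/(congr1 (fun v : 'cV[R]_(1 + k) => usubmx v 0 0)).
  by rewrite /= col_mxKu !mxE /= => /eqP; rewrite oner_eq0.
have DT : D^T = D.
  by apply/matrixP => i j; rewrite !mxE -[in LHS]pS.1 mxE.
have [] := IH (D - s^-1 *: (b *m b^T)).
  split; first by rewrite linearB/= DT linearZ/= trmx_mul trmxK.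
  move=> u u0; rewrite mulmxBl dotvBr -scalemxAl dotvZr dotv_outer.
  set v : 'cV[R]_k.+1 := (col_mx (- (dotv b u / s))%:M u : 'cV[R]_(1 + k)).
  have v0 : v != 0.
    apply: contraNneq u0 => /(congr1 (fun v : 'cV[R]_(1 + k) => dsubmx v)).
    by rewrite /= /v col_mxKd linear0 => ->.
  have := pS.2 v v0; rewrite (form (- (dotv b u / s)) u) (dotvC u b).
  congr (0 < _); field; by rewrite gt_eqF.
move=> A' eA'.
pose M : 'M[R]_(1 + k) := block_mx (Num.sqrt s)%:M 0 ((Num.sqrt s)^-1 *: b) A'.
have ss0 : Num.sqrt s != 0 by rewrite gt_eqF// sqrtr_gt0.
suff e : M *m M^T = block_mx s%:M b^T b D by exists M; rewrite SE -e.
rewrite /M tr_block_mx mulmx_block.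
rewrite trmx0 !mulmx0 !mul0mx !addr0 tr_scalar_mx -eA'.
congr block_mx.
- by rewrite -scalar_mxM -expr2 sqr_sqrtr// ltW.
- by rewrite mul_scalar_mx linearZ/= scalerA mulfV// scale1r.
- by rewrite mul_mx_scalar scalerA mulfV// scale1r.
- rewrite linearZ/= -scalemxAl -scalemxAr scalerA -invfM -expr2 sqr_sqrtr ?ltW//.
  by rewrite addrC subrK.
Qed.

End Cholesky.

Section GaussianVector.
Context {R : realType}.
Notation gauss := (@normal_prob R 0 1).

(** Presents both cases of [normal_law], the point mass included, as images of the standard law
    under scaling, the shape in which [iid_gauss_exists] delivers laws. *)
Lemma normal_lawE (v : R) (A : set R) : 0 <= v -> measurable A ->
  normal_law 0 v A = (\int[gauss]_x (\1_A (Num.sqrt v * x))%:E)%E.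
Proof.
move=> v0 mA; rewrite /normal_law; case: eqVneq => [->|vn0].
  under eq_integral do rewrite sqrtr0 mul0r.
  by rewrite integral_probability_cst diracE indicE.
have sv : 0 < Num.sqrt v by rewrite sqrtr_gt0 lt0r vn0.
have mi : measurable_fun setT (fun x : R => (\1_A x : R)%:E).
  by apply/measurable_EFinP; exact: measurable_indic.
have i0 (x : R) : (0 <= (\1_A x : R)%:E)%E by rewrite lee_fin.
have := ge0_integral_gauss_affine 0 sv mi i0.
under eq_integral do rewrite addr0.
move=> ->.
rewrite /normal_prob integral_mkcond; apply: eq_integral => x _.
by rewrite patchE indicE; case: ifP => _; rewrite ?mul1e ?mul0e.
Qed.

(** [Z = A xi] with [xi] standard normal: [t . Z] has coefficient vector [A^T t], of squared norm
    [t . S t]. The cosine transform is recorded for use in the continuity theorem. *)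
Lemma normal_vector_exists k (S : 'M[R]_k) (A : 'M[R]_k) : S = A *m A^T ->
  exists (d : measure_display) (T : measurableType d) (P : probability T R)
    (Z : T -> 'cV[R]_k), normal_vector P Z 0 S /\
  forall (t : 'cV[R]_k) (c : R),
    \int[P]_w cos (dotv t (Z w) + c) = expR (- (dotv t (S *m t) / 2)) * cos c.
Proof.
move=> SE; have [d [T [P [xi [mxi law]]]]] := @iid_gauss_exists R k.
pose Z w : 'cV[R]_k := A *m (\col_j xi j w).
exists d, T, P, Z.
have tZ t w : dotv t (Z w) = \sum_j (A^T *m t) j 0 * xi j w.
  by rewrite /Z dotv_mulmx dotvE; apply: eq_bigr => j _; rewrite !mxE.
have vE t : \sum_j (A^T *m t) j 0 ^+ 2 = dotv t (S *m t).
  by rewrite SE -mulmxA dotv_mulmx dotvE; apply: eq_bigr => j _; rewrite expr2.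
have v0 t : 0 <= dotv t (S *m t) by rewrite -vE sumr_ge0// => j _; rewrite sqr_ge0.
have mt t : measurable_fun setT (fun w => dotv t (Z w)).
  rewrite (_ : (fun _ => _) = fun w => \sum_j (A^T *m t) j 0 * xi j w); last exact/funext.
  by apply: measurable_sum => j; exact: measurable_funM.
split; first split.
- move=> i; rewrite /Z (_ : (fun _ => _) = fun w => \sum_j A i j * xi j w).
    by apply: measurable_sum => j; exact: measurable_funM.
  by apply/funext => w; rewrite mxE; apply: eq_bigr => j _; rewrite mxE.
- move=> t B mB; rewrite dotv0 normal_lawE// -vE.
  have mi : measurable_fun setT (fun x : R => (\1_B x : R)%:E).
    by apply/measurable_EFinP; exact: measurable_indic.
  have i0 (x : R) : (0 <= (\1_B x : R)%:E)%E by rewrite lee_fin.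
  rewrite -(law _ _ mi i0).
  under eq_integral do rewrite -tZ.
  rewrite (integral_indic _ measurableT) ?setIT//.
  by rewrite -[X in measurable X]setTI; exact: mt.
move=> t c.
have m1 : measurable_fun setT (fun x : R => (1 + cos (x + c))%:E).
  apply/measurable_EFinP; apply: measurable_funD => //.
  apply: (@measurableT_comp _ _ _ _ _ _ (cos : R -> R)).
    exact: (continuous_measurable_fun (@continuous_cos R)).
  exact: measurable_funD.
have p1 (x : R) : (0 <= (1 + cos (x + c))%:E)%E.
  by rewrite lee_fin; have := cos_geN1 (x + c); lra.
have := law (fun j => (A^T *m t) j 0) _ m1 p1.
under eq_integral do rewrite -tZ.
have icos d' (T' : measurableType d') (P' : probability T' R) (f : T' -> R) :
    measurable_fun setT f -> P'.-integrable setT (EFin \o (fun w => cos (f w + c))).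
  move=> mf; apply: (@integrable_bounded _ _ _ P' _ 1) => [|w]; last exact: cos_max.
  apply: (@measurableT_comp _ _ _ _ _ _ (cos : R -> R)).
    exact: (continuous_measurable_fun (@continuous_cos R)).
  exact: measurable_funD.
have icst d' (T' : measurableType d') (P' : probability T' R) :
  P'.-integrable setT (EFin \o (fun=> 1)) by exact: integrable_cstR.
rewrite (Rintegral_EFin (integrableDR (icst _ _ P) (icos _ _ P _ (mt t)))).
have ml (s : R) : measurable_fun setT (fun x : measurableTypeR R => s * x).
  exact: measurable_funM.
rewrite (Rintegral_EFin (integrableDR (icst _ _ gauss) (icos _ _ gauss _ (ml _)))).
rewrite (RintegralD measurableT (icst _ _ P) (icos _ _ P _ (mt t))).
rewrite (RintegralD measurableT (icst _ _ gauss) (icos _ _ gauss _ (ml _))).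
rewrite !Rintegral_prob_cst gauss_cos_shift sqr_sqrtr ?vE//.
by move=> [] /addrI.
Qed.

End GaussianVector.

(** * Central limit theorem for sums of signs *)

Section SignCharacteristic.
Context {R : realType}.
Variable tau : R.
Hypotheses (tau0 : 0 < tau) (tau1 : tau < 1).

Lemma norm_convex_le (p q M : R) : `|p| <= M -> `|q| <= M ->
  `|(1 - tau) * p + tau * q| <= M.
Proof.
move=> pM qM; have t1 : 0 < 1 - tau by rewrite subr_gt0.
rewrite (le_trans (ler_normD _ _))// !normrM (gtr0_norm t1) (gtr0_norm tau0).
rewrite [leRHS](_ : _ = (1 - tau) * M + tau * M); last by ring.
by rewrite lerD// ler_wpM2l// ltW.
Qed.

(** The sign is [tau] with probability [1 - tau] and [tau - 1] with probability [tau]: it has mean 0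
    and variance [tau (1 - tau)]. All Taylor terms up to order two therefore match, and the
    remainders add up to [1/24 + 1/2 + 1/6 < 1] times the cube. *)
Lemma two_point_cos_bound (a c : R) : `|a| <= 1 ->
  `|(1 - tau) * cos (c + a * tau) + tau * cos (c + a * (tau - 1)) -
    expR (- (tau * (1 - tau) * a ^+ 2 / 2)) * cos c| <= `|a| ^+ 3.
Proof.
move=> a1.
have -> : c + a * (tau - 1) = c - a * (1 - tau) by ring.
rewrite cosD cosB.
set x := a * tau; set y := a * (1 - tau).
set z := tau * (1 - tau) * a ^+ 2 / 2.
have [cx sx cy sy] := And4 (cos_Taylor x) (sin_Taylor x) (cos_Taylor y) (sin_Taylor y).
have t1 : 0 < 1 - tau by rewrite subr_gt0.
have a0 : 0 <= `|a| by [].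
have a2 : a ^+ 2 = `|a| ^+ 2 by rewrite real_normK ?num_real.
have z0 : 0 <= z by rewrite divr_ge0// mulr_ge0 ?sqr_ge0// mulr_ge0// ltW.
have ez : `|expR (- z) - (1 - z)| <= z ^+ 2 / 2.
  have := expRN_le z0; have := expR_ge1Dx (- z) => h1 h2.
  by have z2 := sqr_ge0 z; apply/ler_normlP; split; lra.
have xa : `|x| <= `|a| by rewrite normrM ler_piMr// gtr0_norm// ltW.
have ya : `|y| <= `|a| by rewrite normrM (gtr0_norm t1) ler_piMr// gerBl ltW.
have a43 : `|a| ^+ 4 <= `|a| ^+ 3 by rewrite exprS ler_piMl// exprn_ge0.
have x4 : x ^+ 4 <= `|a| ^+ 3.
  rewrite (le_trans _ a43)// -[x ^+ 4]ger0_norm ?exprn_even_ge0// normrX.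
  by rewrite lerXn2r ?nnegrE.
have y4 : y ^+ 4 <= `|a| ^+ 3.
  rewrite (le_trans _ a43)// -[y ^+ 4]ger0_norm ?exprn_even_ge0// normrX.
  by rewrite lerXn2r ?nnegrE.
have x3 : `|x| ^+ 3 <= `|a| ^+ 3 by rewrite lerXn2r ?nnegrE.
have y3 : `|y| ^+ 3 <= `|a| ^+ 3 by rewrite lerXn2r ?nnegrE.
have z2 : z ^+ 2 <= `|a| ^+ 3.
  rewrite (le_trans _ a43)// (_ : `|a| ^+ 4 = (a ^+ 2) ^+ 2); last by rewrite a2 -exprM.
  rewrite lerXn2r ?nnegrE ?sqr_ge0// /z.
  have : tau * (1 - tau) <= 1 by nra.
  by have := sqr_ge0 a => h1 h2; nra.
set A3 := `|a| ^+ 3 in x4 y4 x3 y3 z2 *.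
have -> : (1 - tau) * (cos c * cos x - sin c * sin x) + tau * (cos c * cos y + sin c * sin y) - expR (- z) * cos c =
  cos c * ((1 - tau) * (cos x - (1 - x ^+ 2 / 2)) + tau * (cos y - (1 - y ^+ 2 / 2)) - (expR (- z) - (1 - z)))
  - sin c * ((1 - tau) * (sin x - x) - tau * (sin y - y)).
  by rewrite /x /y /z; field.
have step1 : `|(1 - tau) * (cos x - (1 - x ^+ 2 / 2)) + tau * (cos y - (1 - y ^+ 2 / 2)) - (expR (- z) - (1 - z))| <= A3 / 24 + A3 / 2.
  rewrite (le_trans (ler_normB _ _))// lerD//.
    by apply: norm_convex_le; [apply: (le_trans cx)|apply: (le_trans cy)]; rewrite ler_pM2r.
  by rewrite (le_trans ez)// ler_pM2r.
have step2 : `|(1 - tau) * (sin x - x) - tau * (sin y - y)| <= A3 / 6.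
  rewrite -[X in _ + X]mulrN; apply: norm_convex_le.
    by rewrite (le_trans sx)// ler_pM2r.
  by rewrite normrN (le_trans sy)// ler_pM2r.
rewrite (le_trans (ler_normB _ _))// !normrM.
have A30 : 0 <= A3 by rewrite exprn_ge0.
have h1 := ler_pM (normr_ge0 _) (normr_ge0 _) (cos_max c) step1.
have h2 := ler_pM (normr_ge0 _) (normr_ge0 _) (sin_max c) step2.
by rewrite (le_trans (lerD h1 h2))//; lra.
Qed.

(* The expectation of [cos (c + \sum_(i < n) a i * psi i)], obtained by
   conditioning on the last sign. *)
Fixpoint sign_sum_cf (a : nat -> R) (n : nat) (c : R) : R :=
  if n is m.+1 then
    (1 - tau) * sign_sum_cf a m (c + a m * tau) +
    tau * sign_sum_cf a m (c + a m * (tau - 1))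
  else cos c.

(** Each step trades one sign for its Gaussian factor. The errors simply add, since they are
    averaged with weights [1 - tau] and [tau] and multiplied by factors at most 1. *)
Lemma sign_sum_cf_approx (a : nat -> R) (n : nat) (c : R) :
  (forall i, (i < n)%N -> `|a i| <= 1) ->
  `|sign_sum_cf a n c - expR (- (tau * (1 - tau) * (\sum_(i < n) a i ^+ 2) / 2)) * cos c|
  <= \sum_(i < n) `|a i| ^+ 3.
Proof.
elim: n c => [|n IH] c a1.
  by rewrite /= !big_ord0 mulr0 mul0r oppr0 expR0 mul1r subrr normr0.
have {}IH c' := IH c' (fun i hi => a1 i (ltnW hi)).
rewrite /= !big_ord_recr/= [tau * (1 - tau) * (_ + _)]mulrDr [(_ + _) / 2]mulrDl opprD expRD.
set E := expR (- (_ * (\sum_(i < n) _) / 2)) in IH *.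
have E01 : `|E| <= 1.
  rewrite ger0_norm ?expR_ge0// expR_le1 oppr_le0 divr_ge0// mulr_ge0//.
    by rewrite mulr_ge0// ?subr_ge0 ltW.
  by rewrite sumr_ge0// => i _; rewrite sqr_ge0.
have b := two_point_cos_bound c (a1 n (ltnSn n)).
have := IH (c + a n * tau); have := IH (c + a n * (tau - 1)).
set p := sign_sum_cf _ _ _; set q := sign_sum_cf _ _ _; set s := \sum_(i < n) _ in IH *.
set x := cos _ in b *; set y := cos _ in b *; set e := expR _ in b *; set k := cos c in b *.
move=> h1 h2.
have -> : (1 - tau) * q + tau * p - E * e * k =
  (1 - tau) * (q - E * x) + tau * (p - E * y) + E * ((1 - tau) * x + tau * y - e * k) by ring.
rewrite (le_trans (ler_normD _ _))// lerD//; last first.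
  by rewrite normrM (le_trans _ b)// ler_piMl.
exact: norm_convex_le.
Qed.

End SignCharacteristic.

Section SignSum.
Context {R : realType} {dT : measure_display} {T : measurableType dT}.
Variables (P : probability T R) (tau : R) (eps : nat -> {RV P >-> R}).
Hypotheses (tau0 : 0 < tau) (tau1 : tau < 1).
Hypothesis indep : mutually_independent eps.
Hypothesis Pneg : forall i, P (eps i @^-1` `]-oo, 0[%classic) = tau%:E.

Definition psi (i : nat) (w : T) : R := tau - (eps i w < 0)%R%:R.

Lemma measurable_psi i : measurable_fun setT (psi i).
Proof.
rewrite /psi (_ : (fun _ => _) = fun w => tau - \1_(eps i @^-1` `]-oo, 0[%classic) w).
  apply: measurable_funB => //; apply: measurable_indic.
  by rewrite -[X in measurable X]setTI; exact: measurable_funPT.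
apply/funext => w; rewrite indicE; congr (_ - (nat_of_bool _)%:R).
by apply/idP/idP; rewrite inE /= in_itv.
Qed.

Local Notation event J A := (\bigcap_(i in [set` J]) eps i @^-1` A i).

Let mpre i (A : set R) : measurable A -> measurable (eps i @^-1` A).
Proof. by move=> mA; rewrite -[X in measurable X]setTI; exact: measurable_funPT. Qed.

Let mevent (J : {fset nat}) (A : nat -> set R) : (forall i, measurable (A i)) ->
  measurable (event J A).
Proof. by move=> mA; apply: bigcap_measurableType => i _; exact: mpre. Qed.

(** Adjoins a condition on [eps n] while keeping the event in the form of an intersection over a
    finite set of indices, so that it can be fed back to an induction hypothesis about such
    events. *)
Lemma indep_fsetU1 (n : nat) (J : {fset nat}) (A : nat -> set R) (N : set R) :
  n \notin J -> (forall i, measurable (A i)) -> measurable N ->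
  exists2 A' : nat -> set R, (forall i, measurable (A' i)) &
  event (n |` J)%fset A' = eps n @^-1` N `&` event J A /\
  P (eps n @^-1` N `&` event J A) = (P (eps n @^-1` N) * P (event J A))%E.
Proof.
move=> nJ mA mN; pose A' i := if i == n then N else A i.
have mA' i : measurable (A' i) by rewrite /A'; case: ifP.
have neq i : i \in J -> i != n by apply: contraTneq => ->.
have e : event (n |` J)%fset A' = eps n @^-1` N `&` event J A.
  rewrite (bigcap_fsetU1 (fun i => eps i @^-1` A' i)) /A' eqxx; congr (_ `&` _).
  by apply: eq_bigcapr => i /= iJ; rewrite (negbTE (neq i iJ)).
exists A' => //; split=> //; rewrite -e !indep// big_fsetU1//=.
rewrite /A' eqxx; congr (_ * _)%E; rewrite big_seq [RHS]big_seq.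
by apply: eq_bigr => i iJ; rewrite (negbTE (neq i iJ)).
Qed.

Variable a : nat -> R.

Definition sign_sum (n : nat) (w : T) : R := \sum_(i < n) a i * psi i w.

Lemma measurable_sign_sum n : measurable_fun setT (sign_sum n).
Proof.
by apply: measurable_sum => i; apply: measurable_funM => //; exact: measurable_psi.
Qed.

Let mcos n c : measurable_fun setT (fun w => cos (sign_sum n w + c)).
Proof.
apply: (@measurableT_comp _ _ _ _ _ _ (cos : R -> R)).
  exact: (continuous_measurable_fun (@continuous_cos R)).
by apply: measurable_funD => //; exact: measurable_sign_sum.
Qed.

Let icos n c D : measurable D -> P.-integrable D (EFin \o (fun w => cos (sign_sum n w + c))).
Proof.
move=> mD; apply: (integrableS measurableT) => //.
by apply: (@integrable_bounded _ _ _ P _ 1 (mcos n c)) => w; exact: cos_max.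
Qed.

(* The event [event J A], on errors of index at least [n], is what the induction
   on [n] needs: peeling off the last term adds an event on [eps n]. *)
Lemma integral_cos_sign_sum_event (n : nat) (c : R) (J : {fset nat}) (A : nat -> set R) :
  (forall i, i \in J -> (n <= i)%N) -> (forall i, measurable (A i)) ->
  \int[P]_(w in event J A) cos (sign_sum n w + c) =
  sign_sum_cf tau a n c * fine (P (event J A)).
Proof.
elim: n c J A => [|n IH] c J A nJ mA.
  under eq_Rintegral do rewrite /sign_sum big_ord0 add0r.
  by rewrite Rintegral_cst//; exact: mevent.
have nnJ : n \notin J by apply/negP => /nJ; rewrite ltnn.
have mI : measurable (`]-oo, 0[%classic : set R) by [].
have [A1 mA1 [e1 p1]] := indep_fsetU1 nnJ mA mI.
have [A2 mA2 [e2 p2]] := indep_fsetU1 nnJ mA (measurableC mI).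
have PnegC : P (eps n @^-1` ~` `]-oo, 0[%classic) = (1 - tau)%:E.
  by rewrite preimage_setC (probability_setC P (mpre n mI)) Pneg.
have jn i : i \in (n |` J)%fset -> (n <= i)%N.
  by rewrite in_fset1U => /orP[/eqP->//|/nJ/ltnW].
(* The event is split by the sign of [eps n]; on each piece [psi n] is constant and is absorbed into
   the phase. *)
have eU : event J A = event (n |` J)%fset A1 `|` event (n |` J)%fset A2.
  rewrite e1 e2 -setIUl preimage_setC setUv setTI//.
rewrite [in LHS]eU Rintegral_setU; first last.
- apply/disj_setPS; rewrite e1 e2 => w [] [w1 _] [w2 _]; exact: w2.
- rewrite -eU; apply: icos; exact: mevent.
- exact: mevent.
- exact: mevent.
rewrite [X in X + _](_ : _ = \int[P]_(w in event (n |` J)%fset A1)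
     cos (sign_sum n w + (c + a n * (tau - 1)))); last first.
  apply: eq_Rintegral => w; rewrite e1 inE => -[/=]; rewrite in_itv/= => w0 _.
  have pE : psi n w = tau - 1 by rewrite /psi w0.
  by rewrite /sign_sum big_ord_recr/= pE -addrA; congr (cos (_ + _)); ring.
rewrite [X in _ + X](_ : _ = \int[P]_(w in event (n |` J)%fset A2)
     cos (sign_sum n w + (c + a n * tau))); last first.
  apply: eq_Rintegral => w; rewrite e2 inE => -[/=]; rewrite in_itv/= => /negP w0 _.
  have pE : psi n w = tau by rewrite /psi (negbTE w0) subr0.
  by rewrite /sign_sum big_ord_recr/= pE -addrA; congr (cos (_ + _)); ring.
rewrite !IH// e1 e2 p1 p2 Pneg PnegC.
have Pf : P (event J A) \is a fin_num by apply: fin_num_measure; exact: mevent.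
rewrite !fineM//=; ring.
Qed.

Lemma integral_cos_sign_sum n c :
  \int[P]_w cos (sign_sum n w + c) = sign_sum_cf tau a n c.
Proof.
have := @integral_cos_sign_sum_event n c fset0 (fun=> setT) _ (fun=> measurableT).
rewrite (_ : event _ _ = setT); last by apply/seteqP; split=> // w _ i.
by rewrite probability_setT mulr1 => ->// i; rewrite in_fset0.
Qed.

End SignSum.

Section SignSumCLT.
Context {R : realType} {dT : measure_display} {T : measurableType dT}.
Variables (P : probability T R) (tau : R) (eps : nat -> {RV P >-> R}).
Hypotheses (tau0 : 0 < tau) (tau1 : tau < 1).
Hypothesis indep : mutually_independent eps.
Hypothesis Pneg : forall i, P (eps i @^-1` `]-oo, 0[%classic) = tau%:E.

(** Central limit theorem for a triangular array. The error is a sum of cubes, at most the largest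
    [|a n i|] times the sum of squares: the former tends to 0 and the latter stays bounded. *)
Lemma cvg_cos_sign_sum (a : nat -> nat -> R) (v c : R) :
  (forall e : R, 0 < e -> \forall n \near \oo, forall i, (i < n)%N -> `|a n i| <= e) ->
  (\sum_(i < n) a n i ^+ 2) @[n --> \oo] --> v ->
  \int[P]_w cos (sign_sum tau eps (a n) n w + c) @[n --> \oo] -->
  expR (- (tau * (1 - tau) * v / 2)) * cos c.
Proof.
move=> amax a2.
under eq_fun do rewrite (integral_cos_sign_sum indep Pneg).
pose g n := expR (- (tau * (1 - tau) * (\sum_(i < n) a n i ^+ 2) / 2)) * cos c.
have gl : g n @[n --> \oo] --> expR (- (tau * (1 - tau) * v / 2)) * cos c.
  apply: cvgMl; apply: continuous_cvg; first exact: continuous_expR.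
  apply: cvgN; apply: cvgMl; apply: cvgMr; exact: a2.
suff h : (sign_sum_cf tau (a n) n c - g n) @[n --> \oo] --> (0 : R).
  have : ((sign_sum_cf tau (a n) n c - g n) + g n) @[n --> \oo] -->
      0 + expR (- (tau * (1 - tau) * v / 2)) * cos c by exact: cvgD.
  by rewrite add0r; under eq_fun do rewrite subrK.
apply/cvgrPdist_le => /= e e0.
have [M M0 HM] : exists2 M : R, 0 < M & \forall n \near \oo, \sum_(i < n) a n i ^+ 2 <= M.
  exists (`|v| + 1); first by rewrite ltr_wpDl.
  have /cvgrPdist_le /(_ 1 ltr01) := a2; apply: filterS => n /= h.
  have := ler_norm v; move: h => /ler_normlP[h1 h2]; lra.
near=> n.
rewrite sub0r normrN (le_trans (sign_sum_cf_approx tau0 tau1 _ _))//.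
  by near: n; exact: amax.
have hM : \sum_(i < n) a n i ^+ 2 <= M by near: n.
have he : forall i, (i < n)%N -> `|a n i| <= e / M.
  by near: n; apply: amax; rewrite divr_gt0.
rewrite (@le_trans _ _ (\sum_(i < n) (e / M) * a n i ^+ 2))//.
  apply: ler_sum => i _; rewrite exprS real_normK ?num_real//.
  by rewrite ler_wpM2r ?sqr_ge0// he.
by rewrite -mulr_sumr mulrAC ler_pdivrMr// ler_pM2l.
Unshelve. all: by end_near.
Qed.

End SignSumCLT.

(** * The Levy continuity theorem *)

Section FejerKernel.
Context {R : realType}.
Implicit Types (x y phi : R) (N : nat).

(* The squared modulus of the average of [e^(i a y)] over [a < N]. *)
Definition fejer N y : R :=
  N%:R ^- 2 * ((\sum_(a < N) cos (a%:R * y)) ^+ 2 + (\sum_(a < N) sin (a%:R * y)) ^+ 2).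

Lemma fejer_ge0 N y : 0 <= fejer N y.
Proof. by rewrite mulr_ge0 ?invr_ge0 ?exprn_ge0// addr_ge0 ?sqr_ge0. Qed.

Lemma fejerE N y :
  fejer N y = \sum_(a < N) \sum_(b < N) N%:R ^- 2 * cos ((a%:R - b%:R) * y).
Proof.
rewrite /fejer !expr2 !mulr_suml -big_split/= mulr_sumr; apply: eq_bigr => a _.
rewrite !mulr_sumr -big_split/= mulr_sumr; apply: eq_bigr => b _; congr (_ * _).
by rewrite mulrBl cosB.
Qed.

(** The closed form of the kernel with its denominator cleared. [e1] and [e2] are the real and
    imaginary parts of the geometric sum identity, the sum times [e^(i y)] being the sum plus
    [e^(i N y) - 1]. *)
Lemma fejer_1Bcos N y : (1 - cos y) * fejer N y = N%:R ^- 2 * (1 - cos (N%:R * y)).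
Proof.
rewrite /fejer mulrCA; congr (_ * _).
set C := \sum_(a < N) cos _; set S := \sum_(a < N) sin _.
have e1 : C * cos y - S * sin y = C + cos (N%:R * y) - 1.
  rewrite /C /S !mulr_suml -sumrB.
  under eq_bigr do rewrite -cosD -{2}(mul1r y) -mulrDl natr1.
  elim: (N) => [|n IH]; first by rewrite !big_ord0 mul0r cos0 add0r subrr.
  by rewrite !big_ord_recr/= IH; ring.
have e2 : S * cos y + C * sin y = S + sin (N%:R * y).
  rewrite /C /S !mulr_suml -big_split/=.
  under eq_bigr do rewrite -sinD -{2}(mul1r y) -mulrDl natr1.
  elim: (N) => [|n IH]; first by rewrite !big_ord0 mul0r sin0 add0r.
  by rewrite !big_ord_recr/= IH; ring.
have c1 := cos2Dsin2 y; have c2 := cos2Dsin2 (N%:R * y).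
move: C S (cos y) (sin y) (cos (_ * y)) (sin (_ * y)) e1 e2 c1 c2 => C S c s c' s' e1 e2 c1 c2.
have e1' : c' = C * c - S * s - C + 1 by lra.
have e2' : s' = S * c + C * s - S by lra.
have : (C * c - S * s - C + 1) ^+ 2 + (S * c + C * s - S) ^+ 2 = 1 by rewrite -e1' -e2'.
have -> : (C * c - S * s - C + 1) ^+ 2 + (S * c + C * s - S) ^+ 2 =
  (C ^+ 2 + S ^+ 2) * (c ^+ 2 + s ^+ 2) + (C ^+ 2 + S ^+ 2) - 2 * c * (C ^+ 2 + S ^+ 2) + 2 * (C * c - S * s - C) + 1 by ring.
rewrite c1 e1'; lra.
Qed.

(** Here [h = pi l / N] lies strictly between 0 and [pi], so one may multiply by [2 sin h], which
    makes the sum telescope; its two ends differ by [l] full periods. *)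
Lemma sum_cos_roots N l phi : (0 < l < N)%N ->
  \sum_(m < N) cos (phi + 2 * (pi * l%:R / N%:R) * m%:R) = 0.
Proof.
move=> /andP[l0 lN]; set h := pi * l%:R / N%:R.
have N0 : (0 < N)%N by rewrite (leq_trans _ lN).
have NR : 0 < N%:R :> R by rewrite ltr0n.
have hs : sin h != 0.
  rewrite gt_eqF// sin_gt0_pi// /h divr_gt0 ?mulr_gt0 ?pi_gt0 ?ltr0n//=.
  by rewrite ltr_pdivrMr// ltr_pM2l ?pi_gt0// ltr_nat.
apply: (mulfI (mulf_neq0 (_ : 2 != 0) hs)); first by rewrite pnatr_eq0.
rewrite mulr0 mulr_sumr.
have tel n : \sum_(m < n) 2 * sin h * cos (phi + 2 * h * m%:R) =
    sin (phi + 2 * h * n%:R - h) - sin (phi - h).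
  elim: n => [|n IH]; first by rewrite big_ord0 mulr0 addr0 subrr.
  rewrite big_ord_recr/= IH.
  have -> : phi + 2 * h * n.+1%:R - h = (phi + 2 * h * n%:R) + h.
    by rewrite -natr1; ring.
  by move: (phi + _) (sin (phi - h)) => x y; rewrite sinB sinD; ring.
rewrite tel.
have -> : phi + 2 * h * N%:R - h = (phi - h) + (pi *+ 2) *+ l.
  by rewrite /h -[in RHS]mulr_natr; field; rewrite gt_eqF.
by rewrite (periodicn (@sinD2pi R)) subrr.
Qed.

(** Summation over the nodes kills every pair of distinct frequencies by [sum_cos_roots], and each
    of the [N] diagonal pairs contributes [1 / N]. The kernel thus provides averaging weights on a
    grid. *)
Lemma sum_fejer N phi : (0 < N)%N ->
  \sum_(m < N) fejer N (phi - 2 * pi * m%:R / N%:R) = 1.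
Proof.
move=> N0; have NR : N%:R != 0 :> R by rewrite pnatr_eq0 -lt0n.
under eq_bigr do rewrite fejerE.
rewrite exchange_big/=; under eq_bigr do rewrite exchange_big/=.
transitivity (\sum_(a < N) N%:R^-1 :> R); last first.
  by rewrite sumr_const card_ord -[LHS]mulr_natr mulVf.
apply: eq_bigr => a _; rewrite (bigD1 a)//= [X in _ + X]big1 ?addr0.
  under eq_bigr do rewrite subrr mul0r cos0 mulr1.
  by rewrite sumr_const card_ord -[LHS]mulr_natr; field.
have pos (b c : 'I_N) : (b < c)%N -> \sum_(i < N) N%:R ^- 2 * cos ((c%:R - b%:R) * (phi - 2 * pi * i%:R / N%:R)) = 0.
  move=> bc; rewrite -mulr_sumr.
  rewrite (eq_bigr (fun i : 'I_N => cos (- ((c - b)%N%:R * phi) + 2 * (pi * (c - b)%N%:R / N%:R) * i%:R))).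
    by rewrite sum_cos_roots ?mulr0// subn_gt0 bc/= (leq_ltn_trans (leq_subr _ _)).
  by move=> i _; rewrite -natrB ?(ltnW bc)// -cosN; congr cos; field.
move=> b ba; have [ab|ab|ab] := ltngtP a b.
- rewrite -[RHS](pos _ _ ab); apply: eq_bigr => i _; congr (_ * _).
  by rewrite -cosN; congr cos; ring.
- exact: pos.
- by move: ba; rewrite (val_inj ab) eqxx.
Qed.

(** Each term is at most [2 / N^2] by the closed form. As [1 - cos] measures squared distance on the
    circle, the weights concentrate near [phi]. *)
Lemma fejer_moment N phi : (0 < N)%N ->
  \sum_(m < N) (1 - cos (phi - 2 * pi * m%:R / N%:R)) * fejer N (phi - 2 * pi * m%:R / N%:R)
   <= 2 / N%:R.
Proof.
move=> N0; under eq_bigr do rewrite fejer_1Bcos.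
rewrite (@le_trans _ _ (\sum_(m < N) N%:R ^- 2 * 2))//.
  apply: ler_sum => m _; rewrite ler_wpM2l// ?invr_ge0 ?exprn_ge0//.
  by have := cos_geN1 (N%:R * (phi - 2 * pi * m%:R / N%:R)); lra.
rewrite sumr_const card_ord -[leLHS]mulr_natr le_eqVlt; apply/orP; left; apply/eqP.
by field; rewrite pnatr_eq0 -lt0n.
Qed.

End FejerKernel.

(** * Trigonometric polynomials and approximation on boxes *)

Section TrigPolynomials.
Context {R : realType} {k : nat}.
Implicit Types q : 'cV[R]_k -> R.

Definition is_trigpoly q := exists s : seq (R * 'cV[R]_k * R),
  forall x, q x = \sum_(e <- s) e.1.1 * cos (dotv e.1.2 x + e.2).

Lemma trigpoly_cos a (t : 'cV[R]_k) c : is_trigpoly (fun x => a * cos (dotv t x + c)).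
Proof. by exists [:: (a, t, c)] => x; rewrite big_seq1. Qed.

Lemma trigpoly_cst a : is_trigpoly (fun=> a).
Proof. by exists [:: (a, 0, 0)] => x; rewrite big_seq1 /= dot0v addr0 cos0 mulr1. Qed.

Lemma trigpolyD q1 q2 : is_trigpoly q1 -> is_trigpoly q2 ->
  is_trigpoly (fun x => q1 x + q2 x).
Proof. by move=> [s1 e1] [s2 e2]; exists (s1 ++ s2) => x; rewrite big_cat/= e1 e2. Qed.

Lemma trigpoly_sum (I : Type) (r : seq I) (F : I -> 'cV[R]_k -> R) :
  (forall i, is_trigpoly (F i)) -> is_trigpoly (fun x => \sum_(i <- r) F i x).
Proof.
move=> tF; elim: r => [|i r IH].
  rewrite (_ : (fun _ => _) = (fun=> 0)); first exact: trigpoly_cst.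
  by apply/funext => x; rewrite big_nil.
rewrite (_ : (fun _ => _) = (fun x => F i x + \sum_(i <- r) F i x)).
  exact: trigpolyD.
by apply/funext => x; rewrite big_cons.
Qed.

Lemma trigpolyM q1 q2 : is_trigpoly q1 -> is_trigpoly q2 ->
  is_trigpoly (fun x => q1 x * q2 x).
Proof.
move=> [s1 e1] [s2 e2].
rewrite (_ : (fun _ => _) = fun x => \sum_(e <- s1) \sum_(e' <- s2)
   (e.1.1 * e'.1.1 / 2 * cos (dotv (e.1.2 + e'.1.2) x + (e.2 + e'.2)) +
    e.1.1 * e'.1.1 / 2 * cos (dotv (e.1.2 - e'.1.2) x + (e.2 - e'.2)))); last first.
  apply/funext => x; rewrite e1 e2 mulr_suml; apply: eq_bigr => e _.
  rewrite mulr_sumr; apply: eq_bigr => e' _.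
  rewrite dotvDl dotvBl.
  have -> : dotv e.1.2 x + dotv e'.1.2 x + (e.2 + e'.2) = (dotv e.1.2 x + e.2) + (dotv e'.1.2 x + e'.2) by ring.
  have -> : dotv e.1.2 x - dotv e'.1.2 x + (e.2 - e'.2) = (dotv e.1.2 x + e.2) - (dotv e'.1.2 x + e'.2) by ring.
  move: (dotv e.1.2 x + e.2) (dotv e'.1.2 x + e'.2) => u v.
  by rewrite cosD cosB; field.
apply: trigpoly_sum => e; apply: trigpoly_sum => e'.
by apply: trigpolyD; exact: trigpoly_cos.
Qed.

Lemma trigpoly_prod (I : Type) (r : seq I) (F : I -> 'cV[R]_k -> R) :
  (forall i, is_trigpoly (F i)) -> is_trigpoly (fun x => \prod_(i <- r) F i x).
Proof.
move=> tF; elim: r => [|i r IH].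
  rewrite (_ : (fun _ => _) = (fun=> 1)); first exact: trigpoly_cst.
  by apply/funext => x; rewrite big_nil.
rewrite (_ : (fun _ => _) = (fun x => F i x * \prod_(i <- r) F i x)).
  exact: trigpolyM.
by apply/funext => x; rewrite big_cons.
Qed.

Lemma trigpoly_fejer N (t : 'cV[R]_k) c : is_trigpoly (fun x => fejer N (dotv t x + c)).
Proof.
rewrite (_ : (fun _ => _) = fun x => \sum_(a < N) \sum_(b < N)
   N%:R ^- 2 * cos (dotv ((a%:R - b%:R) *: t) x + (a%:R - b%:R) * c)); last first.
  apply/funext => x; rewrite fejerE; apply: eq_bigr => a _; apply: eq_bigr => b _.
  by rewrite dotvZl -mulrDr.
apply: trigpoly_sum => a; apply: trigpoly_sum => b; exact: trigpoly_cos.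
Qed.

End TrigPolynomials.

Section BoxCompact.
Context {R : realType} {k : nat}.

Definition box (L : R) : set 'cV[R]_k := [set x | forall j, `|x j 0| <= L].

Lemma ball_cVP (x y : 'cV[R]_k) (e : R) : 0 < e ->
  ball x e y <-> (forall j, `|x j 0 - y j 0| < e).
Proof.
move=> e0; split=> [[_ h] j|h]; first exact: h.
by split=> // i j; rewrite ord1; exact: h.
Qed.

Lemma box_compact (L : R) : compact (box L).
Proof.
have ct : continuous (fun x : 'rV[R]_k => x^T : 'cV[R]_k).
  move=> x A /nbhs_ballP[e e0 xeA]; apply/nbhs_ballP; exists e => // y [_ h].
  by apply: xeA; split=> // i j; rewrite !mxE; exact: h.
have -> : box L = (fun x : 'rV[R]_k => x^T : 'cV[R]_k) @` [set v : 'rV[R]_k | forall i, `[- L, L]%classic (v ord0 i)].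
  apply/seteqP; split=> [x xL|_ [v vL <-] j].
    exists x^T; last by rewrite trmxK.
    by move=> i /=; rewrite mxE in_itv/= -ler_norml; exact: xL.
  by have := vL j; rewrite /= in_itv/= mxE -ler_norml.
apply: continuous_compact; first exact: continuous_subspaceT.
by apply: (@rV_compact R k (fun=> `[- L, L]%classic)) => i; exact: segment_compact.
Qed.

Lemma box_unif_continuous (g : 'cV[R]_k -> R) (L e : R) : continuous g -> 0 < e ->
  exists2 del : R, 0 < del & forall x y : 'cV[R]_k, box L x ->
    (forall j, `|x j 0 - y j 0| < del) -> `|g x - g y| <= e.
Proof.
move=> cg e0.
have cov := (compact_near_coveringP _).1 (@box_compact L).
have := cov R 0^'+ (fun del x => forall y : 'cV[R]_k, (forall j, `|x j 0 - y j 0| < del) -> `|g x - g y| <= e) _.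
case.
  move=> x xL.
  have /cvgrPdist_lt /(_ (e / 2)) := cg x; rewrite divr_gt0// => /(_ isT) /nbhs_ballP[del /= del0 hdel].
  exists (ball x (del / 2), [set t | t < del / 2]).
    split; first by apply: nbhsx_ballx; rewrite divr_gt0.
    by apply: nbhs_right_lt; rewrite divr_gt0.
  move=> [x' t] /= [xx' t2] y x'y.
  have h1 : `|g x - g x'| < e / 2.
    apply: hdel; apply/ball_cVP => // j.
    have /ball_cVP : ball x (del / 2) x' by [].
    by rewrite divr_gt0// => /(_ isT) /(_ j) /lt_trans; apply; lra.
  have h2 : `|g x - g y| < e / 2.
    apply: hdel; apply/ball_cVP => // j.
    have /ball_cVP : ball x (del / 2) x' by [].
    rewrite divr_gt0// => /(_ isT) /(_ j) xj.
    have -> : x j 0 - y j 0 = (x j 0 - x' j 0) + (x' j 0 - y j 0) by ring.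
    rewrite (le_lt_trans (ler_normD _ _))//.
    by have := x'y j; lra.
  have -> : g x' - g y = (g x - g y) - (g x - g x') by ring.
  by rewrite (le_trans (ler_normB _ _))//; lra.
move=> del /= del0 hdel.
exists (del / 2); first by rewrite divr_gt0.
move=> x y xL xy; apply: (hdel (del / 2)) => //=.
  by rewrite sub0r normrN gtr0_norm ?divr_gt0//; lra.
by rewrite divr_gt0.
Qed.

End BoxCompact.

Section FejerApprox.
Context {R : realType}.

(** Up to [pi] cosine decreases; from [pi] to [3 pi / 2] it is nonpositive, so that the gap is at
    least 1. *)
Lemma cos_gap (rho : R) : 0 < rho -> exists2 kap : R, 0 < kap &
  forall y, rho <= `|y| -> `|y| <= pi + pi / 2 -> kap <= 1 - cos y.
Proof.
move=> rho0; have pi0 := pi_gt0 R.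
pose r := Num.min rho pi.
have r0 : 0 < r by rewrite lt_min rho0.
have rpi : r <= pi by rewrite ge_min lexx orbT.
have cr : cos r < 1.
  by rewrite -cos0 ltr_cos// ?in_itv/= ?lexx ?(ltW r0) ?(ltW pi0).
exists (Num.min 1 (1 - cos r)); first by rewrite lt_min ltr01 subr_gt0.
move=> y ry ypi; rewrite ge_min; apply/orP.
have -> : cos y = cos `|y| by case: (ger0P y) => // _; rewrite cosN.
have [le|gt] := leP `|y| pi.
  right; rewrite lerD2l lerN2 leNgt ltr_cos ?in_itv/= ?(ltW r0) ?rpi ?normr_ge0// -leNgt.
  by rewrite ge_min ry.
left; rewrite lerBrDl gerDr.
have -> : `|y| = (`|y| - pi) + pi by ring.
rewrite cosDpi oppr_le0 cos_ge0_pihalf//.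
by apply/andP; split; lra.
Qed.

(** The approximant averages the values of [g] on a grid with products of Fejer weights. Since the
    weights are nonnegative with sum 1, [q] is bounded by [M] everywhere and not only on the box, as
    the control of the tails requires. *)
Lemma trigpoly_approx k (g : 'cV[R]_k -> R) (M L e : R) : continuous g ->
  (forall x, `|g x| <= M) -> 0 < L -> 0 < e ->
  exists q : 'cV[R]_k -> R, [/\ is_trigpoly q, forall x, `|q x| <= M &
    forall x, box L x -> `|q x - g x| <= e].
Proof.
move=> cg gM L0 e0; have pi0 := pi_gt0 R.
(* Scaling sends the box into half a period while the nodes fill a whole one: the differences [y]
   stay within [3 pi / 2], away from the nonzero roots of [1 - cos]. *)
pose al : R := pi / (2 * L).
have al0 : 0 < al by rewrite divr_gt0// mulr_gt0.
have M0 : 0 <= M by rewrite (le_trans _ (gM 0)).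
have e20 : 0 < e / 2 by rewrite divr_gt0.
have [del del0 Hdel] := @box_unif_continuous R k g L (e / 2) cg e20.
have [kap kap0 Hkap] := @cos_gap (al * del) (mulr_gt0 al0 del0).
(* [D (1 - cos y)] reaches [2 M], a bound on the oscillation of [g], once a coordinate is [del]-far
   from its node; [N] makes the total of these terms at most [e / 2]. *)
pose D := 2 * M / kap.
have D0 : 0 <= D by rewrite divr_ge0 ?mulr_ge0// ltW.
pose N := (Num.bound (4 * D * k%:R / e)).+1.
have N0 : (0 < N)%N by [].
have NR : 0 < N%:R :> R by rewrite ltr0n.
have HN : D * k%:R * (2 / N%:R) <= e / 2.
  have : 4 * D * k%:R / e <= N%:R.
    rewrite (le_trans (ltW (archi_boundP _)))// ?ler_nat ?leqnSn//.
    by apply: divr_ge0; [do 2 apply: mulr_ge0 => //|exact: ltW].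
  rewrite ler_pdivrMr// => h.
  by rewrite mulrA ler_pdivrMr//; lra.
pose phi (x : 'cV[R]_k) j := al * x j 0 + pi.
pose y (x : 'cV[R]_k) j (m : 'I_N) := phi x j - 2 * pi * m%:R / N%:R.
pose node (m : {ffun 'I_k -> 'I_N}) : 'cV[R]_k :=
  \col_j ((2 * pi * (m j)%:R / N%:R - pi) / al).
pose W x (m : {ffun 'I_k -> 'I_N}) := \prod_j fejer N (y x j (m j)).
have W0 x m : 0 <= W x m by apply: prodr_ge0 => j _; exact: fejer_ge0.
have W1 x : \sum_m W x m = 1.
  rewrite /W -(bigA_distr_bigA (fun j m => fejer N (y x j m))) big1// => j _.
  exact: sum_fejer.
(* The sum over grid points factors over the coordinates: those other than [j] contribute 1, and
   [fejer_moment] remains. *)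
have Wcos x j : \sum_(m : {ffun 'I_k -> 'I_N}) (1 - cos (y x j (m j))) * W x m <= 2 / N%:R.
  have -> : \sum_(m : {ffun 'I_k -> 'I_N}) (1 - cos (y x j (m j))) * W x m =
      \sum_(m : {ffun 'I_k -> 'I_N}) \prod_i ((if i == j then 1 - cos (y x i (m i)) else 1) * fejer N (y x i (m i))).
    apply: eq_bigr => m _; rewrite big_split/=; congr (_ * _).
    by rewrite (bigD1 j)//= eqxx big1 ?mulr1// => i /negbTE ->.
  rewrite -(bigA_distr_bigA (fun i m => (if i == j then 1 - cos (y x i m) else 1) * fejer N (y x i m))).
  rewrite (bigD1 j)//= eqxx [X in _ * X]big1 ?mulr1; first exact: fejer_moment.
  move=> i /negbTE ->; under eq_bigr do rewrite mul1r; exact: sum_fejer.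
exists (fun x => \sum_m g (node m) * W x m); split.
- apply: trigpoly_sum => m; apply: trigpolyM; first exact: trigpoly_cst.
  apply: trigpoly_prod => j.
  rewrite (_ : (fun _ => _) = fun x => fejer N (dotv (al *: delta_mx j 0) x + (pi - 2 * pi * (m j)%:R / N%:R))).
    exact: trigpoly_fejer.
  apply/funext => x; congr fejer; rewrite /y /phi dotvZl dotvE (bigD1 j)//=.
  rewrite big1 ?addr0; last first.
    by move=> i /negbTE ij; rewrite mxE ij mul0r.
  rewrite mxE !eqxx /= mul1r.
  by rewrite -addrA.
- move=> x; rewrite (le_trans (ler_norm_sum _ _ _))//.
  rewrite -[leRHS]mulr1 -(W1 x) mulr_sumr ler_sum// => m _.
  by rewrite normrM (ger0_norm (W0 _ _)) ler_wpM2r.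
move=> x xL.
rewrite -[g x]mulr1 -(W1 x) mulr_sumr -sumrB.
rewrite (le_trans (ler_norm_sum _ _ _))//.
have step m : `|g (node m) * W x m - g x * W x m| <=
    e / 2 * W x m + D * \sum_j (1 - cos (y x j (m j))) * W x m.
  rewrite -mulrBl normrM (ger0_norm (W0 _ _)) -mulr_suml mulrA -mulrDl ler_wpM2r//.
  have S0 : 0 <= \sum_j (1 - cos (y x j (m j))).
    by apply: sumr_ge0 => j _; rewrite subr_ge0 cos_le1.
  (* A near node costs the modulus of continuity; a far one is charged to the moment term of a
     coordinate that is far. *)
  have [near|far] := pselect (forall j, `|x j 0 - node m j 0| < del).
    by rewrite distrC (le_trans (Hdel x _ xL near))// lerDl mulr_ge0.
  move/existsNP : far => [j /negP]; rewrite -leNgt => xj.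
  have yE : y x j (m j) = al * (x j 0 - node m j 0).
    by rewrite /y /phi /node mxE; field; rewrite !gt_eqF.
  have mN : 0 <= ((m j)%:R / N%:R : R) < 1.
    by rewrite divr_ge0//= ltr_pdivrMr// mul1r ltr_nat ltn_ord.
  have k1 : kap <= 1 - cos (y x j (m j)).
    apply: Hkap; first by rewrite yE normrM gtr0_norm// ler_pM2l.
    have xa : `|al * x j 0| <= pi / 2.
      rewrite normrM gtr0_norm// (le_trans (ler_wpM2l (ltW al0) (xL j)))//.
      by rewrite /al le_eqVlt; apply/orP; left; apply/eqP; field; rewrite gt_eqF.
    rewrite /y /phi -[2 * pi * _ / _]mulrA.
    have : 0 <= (pi : R) * ((m j)%:R / N%:R) <= pi.
      by case/andP: mN => m0 m1; rewrite mulr_ge0 ?(ltW pi0)//= ler_piMr ?(ltW pi0)// ltW.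
    move: xa => /ler_normlP[xa1 xa2] /andP[t0 t1].
    by apply/ler_normlP; split; lra.
  have : kap <= \sum_j (1 - cos (y x j (m j))).
    rewrite (le_trans k1)// (bigD1 j)//= lerDl; apply: sumr_ge0 => i _.
    by rewrite subr_ge0 cos_le1.
  move=> /(ler_wpM2l D0); rewrite {1}/D divfK ?gt_eqF// => h.
  have := ler_normB (g (node m)) (g x); have := gM (node m); have := gM x.
  by move: h; lra.
rewrite (le_trans (ler_sum _ (fun m _ => step m)))//.
rewrite big_split/= -mulr_sumr W1 mulr1 -mulr_sumr exchange_big/=.
have : \sum_j \sum_(m : {ffun 'I_k -> 'I_N}) (1 - cos (y x j (m j))) * W x m <= \sum_(j < k) 2 / N%:R.
  by apply: ler_sum => j _.
rewrite sumr_const card_ord -[leRHS]mulr_natl => h.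
have := ler_wpM2l D0 h; rewrite [leRHS]mulrA => /le_trans /(_ HN) h2.
by rewrite [leRHS](_ : e = e / 2 + e / 2) ?lerD2l//; lra.
Qed.

End FejerApprox.

Section RandomVectors.
Context {R : realType} {d : measure_display} {T : measurableType d}.
Variables (P : probability T R) (k : nat).
Implicit Types Z : T -> 'cV[R]_k.

Lemma Rintegral_indic (A : set T) : measurable A -> \int[P]_w \1_A w = fine (P A).
Proof. by move=> mA; rewrite /Rintegral integral_indic// setIT. Qed.

Lemma integrable_indicR (A : set T) : measurable A ->
  P.-integrable setT (EFin \o (\1_A : T -> R)).
Proof.
move=> mA; apply: (@integrable_bounded _ _ _ P _ 1) => // w.
by rewrite indicE; case: (_ \in _); rewrite ?normr1 ?normr0.
Qed.

Lemma random_vector_dotv Z (t : 'cV[R]_k) : random_vector Z ->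
  measurable_fun setT (fun w => dotv t (Z w)).
Proof.
move=> mZ; rewrite (_ : (fun _ => _) = fun w => \sum_i t i 0 * Z w i 0).
  by apply: measurable_sum => i; exact: measurable_funM.
by apply/funext => w; rewrite dotvE.
Qed.

Lemma measurable_cos_dotv Z (t : 'cV[R]_k) c : random_vector Z ->
  measurable_fun setT (fun w => cos (dotv t (Z w) + c)).
Proof.
move=> mZ; apply: (@measurableT_comp _ _ _ _ _ _ (cos : R -> R)).
  exact: (continuous_measurable_fun (@continuous_cos R)).
by apply: measurable_funD => //; exact: random_vector_dotv.
Qed.

Lemma integrable_cos_dotv Z (t : 'cV[R]_k) c : random_vector Z ->
  P.-integrable setT (EFin \o (fun w => cos (dotv t (Z w) + c))).
Proof.
move=> mZ; apply: (@integrable_bounded _ _ _ P _ 1) => [|w]; last exact: cos_max.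
exact: measurable_cos_dotv.
Qed.

Lemma measurable_trigpoly q Z : is_trigpoly q -> random_vector Z ->
  measurable_fun setT (q \o Z).
Proof.
move=> [s e] mZ; rewrite (_ : _ \o _ =
    fun w => \sum_(e <- s) e.1.1 * cos (dotv e.1.2 (Z w) + e.2)).
  apply: measurable_sum => i; apply: measurable_funM => //.
  exact: measurable_cos_dotv.
by apply/funext => w; rewrite /= e.
Qed.

Lemma measurable_box Z (L : R) : random_vector Z -> measurable (Z @^-1` box L).
Proof.
move=> mZ; rewrite (_ : _ @^-1` _ =
    \bigcap_(j in [set: 'I_k]) (fun w => Z w j 0) @^-1` `[- L, L]%classic).
  apply: fin_bigcap_measurable => // j _.
  by rewrite -[X in measurable X]setTI; apply: mZ.
apply/seteqP; split=> w h j; first by move=> _ /=; rewrite in_itv/= -ler_norml; exact: h.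
by have := h j I; rewrite /= in_itv/= -ler_norml.
Qed.

(** Measurability of [Z] is given coordinatewise; [g \o Z] inherits it as the pointwise limit of
    trigonometric polynomials in [Z], accurate on growing boxes. *)
Lemma measurable_bounded_continuous (g : 'cV[R]_k -> R) (M : R) Z :
  continuous g -> (forall x, `|g x| <= M) -> random_vector Z ->
  measurable_fun setT (g \o Z).
Proof.
move=> cg gM mZ.
have H n : exists q : 'cV[R]_k -> R, [/\ is_trigpoly q, forall x, `|q x| <= M &
    forall x, box n.+1%:R x -> `|q x - g x| <= n.+1%:R^-1].
  by apply: trigpoly_approx => //; rewrite ?invr_gt0 ltr0n.
have [q Hq] := choice H.
apply: (@measurable_fun_cvg _ _ _ _ (fun n => q n \o Z)).
  by move=> n; have [tq _ _] := Hq n; exact: measurable_trigpoly.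
move=> w _; apply/cvgrPdist_le => /= e e0.
near=> n; have [_ _ h] := Hq n.
rewrite distrC (le_trans (h _ _))//.
  move=> j; apply: (@le_trans _ _ n%:R); last by rewrite ler_nat.
  rewrite (le_trans (norm_coord_le _ _))//.
  by near: n; exact: nbhs_infty_ger.
by apply: ltW; near: n; exact: (near_infty_natSinv_lt (PosNum e0)).
Unshelve. all: by end_near.
Qed.

Lemma random_vector_tight Z (e : R) : random_vector Z -> 0 < e ->
  exists2 L : R, 0 < L & fine (P (~` (Z @^-1` box L))) <= e.
Proof.
move=> mZ e0; pose F n := ~` (Z @^-1` box n.+1%:R).
have mF n : measurable (F n) by apply: measurableC; exact: measurable_box.
have F0 : \bigcap_n F n = set0.
  apply/seteqP; split=> // w h.
  have := h (Num.bound (l2norm (Z w))) I; apply => j.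
  rewrite (le_trans (norm_coord_le _ _))//.
  by rewrite (le_trans (ltW (archi_boundP (l2norm_ge0 _))))// ler_nat.
have ndF : nonincreasing_seq F.
  move=> m n mn; apply/subsetPset => w h hb; apply: h => j.
  by rewrite (le_trans (hb j))// ler_nat.
have Ffin : (P (F 0%N) < +oo)%E by rewrite (le_lt_trans (probability_le1 P _))// ltry.
have mcap : measurable (\bigcap_n F n) by rewrite F0.
have h : P (F n) @[n --> \oo] --> (0 : \bar R)%E.
  by have := nonincreasing_cvg_mu Ffin mF mcap ndF; rewrite F0 measure0.
have /fine_cvgP[_ /cvgrPdist_le /(_ _ e0) [n _ hn]] := h.
exists n.+1%:R; first by rewrite ltr0n.
have := hn n (leqnn n); rewrite /= sub0r normrN; apply: le_trans.
exact: ler_norm.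
Qed.

Lemma Rintegral_box_approx (g q : 'cV[R]_k -> R) (M L e e' : R) Z :
  measurable_fun setT (g \o Z) -> measurable_fun setT (q \o Z) ->
  (forall x, `|g x| <= M) -> (forall x, `|q x| <= M) -> 0 <= e ->
  (forall x, box L x -> `|q x - g x| <= e) ->
  random_vector Z -> fine (P (~` (Z @^-1` box L))) <= e' ->
  `|\int[P]_w q (Z w) - \int[P]_w g (Z w)| <= e + 2 * M * e'.
Proof.
move=> mg mq gM qM e0 qg mZ Le.
have M0 : 0 <= M by rewrite (le_trans _ (gM 0)).
have ig : P.-integrable setT (EFin \o (fun w => g (Z w))).
  exact: (@integrable_bounded _ _ _ P _ M).
have iq : P.-integrable setT (EFin \o (fun w => q (Z w))).
  exact: (@integrable_bounded _ _ _ P _ M).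
set A := ~` _ in Le.
have mA : measurable A by apply: measurableC; exact: measurable_box.
rewrite -RintegralB//.
apply: (@le_trans _ _ (\int[P]_w (e + 2 * M * \1_A w))).
  apply: norm_Rintegral_le.
  - exact: integrableBR.
  - apply: integrableDR; first exact: integrable_cstR.
    by apply: integrableZR; exact: integrable_indicR.
  move=> w; rewrite indicE.
  have [zL|zL] := pselect (box L (Z w)).
    by rewrite memNset ?mulr0 ?addr0 ?qg// => h; exact: h.
  rewrite mem_set ?mulr1//.
  have := ler_normB (q (Z w)) (g (Z w)); have := gM (Z w); have := qM (Z w).
  lra.
rewrite RintegralD//; last 2 first.
- exact: integrable_cstR.
- by apply: integrableZR; exact: integrable_indicR.
rewrite Rintegral_prob_cst RintegralZl//; last exact: integrable_indicR.
by rewrite Rintegral_indic// lerD2l ler_wpM2l// mulr_ge0.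
Qed.

End RandomVectors.

(** Tightness confines both laws to a common box up to a small mass; there [g] may be replaced by a
    trigonometric polynomial, whose expectations converge because it is a finite sum of cosines. *)
Lemma levy_continuity (R : realType) d (T : measurableType d) (P : probability T R)
    d' (T' : measurableType d') (P' : probability T' R) (k : nat)
    (Zn : nat -> T -> 'cV[R]_k) (Z : T' -> 'cV[R]_k) :
  (forall n, random_vector (Zn n)) -> random_vector Z ->
  (forall e : R, 0 < e -> exists L : R,
     \forall n \near \oo, fine (P (~` (Zn n @^-1` box L))) <= e) ->
  (forall t c, \int[P]_w cos (dotv t (Zn n w) + c) @[n --> \oo] -->
     \int[P']_w cos (dotv t (Z w) + c)) ->
  cvg_in_law P P' Zn Z.
Proof.
move=> mZn mZ tight cf g cg [M gM].
have M0 : 0 <= M by rewrite (le_trans _ (gM 0)).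
have mgn n : measurable_fun setT (g \o Zn n) by exact: measurable_bounded_continuous gM _.
have mg : measurable_fun setT (g \o Z) by exact: measurable_bounded_continuous gM _.
have EE d0 (T0 : measurableType d0) (P0 : probability T0 R) (V : T0 -> 'cV[R]_k) :
    measurable_fun setT (g \o V) -> 'E_P0[g \o V]%E = (\int[P0]_w g (V w))%:E.
  move=> mV; rewrite unlock -Rintegral_EFin//.
  exact: (@integrable_bounded _ _ _ P0 _ M).
rewrite EE//; under eq_fun do rewrite EE//.
apply: cvg_EFin; first by near=> n.
have tc q : is_trigpoly q -> \int[P]_w q (Zn n w) @[n --> \oo] --> \int[P']_w q (Z w).
  move=> [s e].
  have intq d0 (T0 : measurableType d0) (P0 : probability T0 R) (V : T0 -> 'cV[R]_k) :
      random_vector V -> \int[P0]_w q (V w) =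
      \sum_(e <- s) e.1.1 * \int[P0]_w cos (dotv e.1.2 (V w) + e.2).
    move=> mV; transitivity (\int[P0]_w (\sum_(e <- s) e.1.1 * cos (dotv e.1.2 (V w) + e.2))).
      by apply: eq_Rintegral => w _; rewrite e.
    rewrite Rintegral_sum; last first.
      by move=> i; apply: integrableZR; exact: integrable_cos_dotv.
    by apply: eq_bigr => i _; rewrite RintegralZl//; exact: integrable_cos_dotv.
  rewrite intq//; under eq_fun do rewrite intq//.
  apply: cvg_big => [|i _]; first exact: add_continuous.
  by apply: cvgMr; exact: cf.
apply/cvgrPdist_le => /= e e0.
(* Two approximation errors [e1 + 2 M e1] and one convergence error [e1] must fit into
   [e = 3 (e1 + 2 M e1)]. *)
pose e1 := e / (3 * (1 + 2 * M)).
have M10 : 0 < 1 + 2 * M by rewrite ltr_wpDr// mulr_ge0.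
have e10 : 0 < e1 by rewrite divr_gt0// mulr_gt0.
have [L1 L10 HL1] := random_vector_tight P' mZ e10.
have [L2 HL2] := tight _ e10.
pose L := Num.max L1 L2.
have L0 : 0 < L by rewrite lt_max L10.
have mono d0 (T0 : measurableType d0) (P0 : probability T0 R) (V : T0 -> 'cV[R]_k) L' :
    random_vector V -> L' <= L -> fine (P0 (~` (V @^-1` box L'))) <= e1 ->
    fine (P0 (~` (V @^-1` box L))) <= e1.
  move=> mV LL; apply: le_trans; apply: fine_le.
  - by apply: fin_num_measure; apply: measurableC; exact: measurable_box.
  - by apply: fin_num_measure; apply: measurableC; exact: measurable_box.
  apply: le_measure; rewrite ?inE.
  - by apply: measurableC; exact: measurable_box.
  - by apply: measurableC; exact: measurable_box.
  by move=> w h hb; apply: h => j; rewrite (le_trans (hb j)).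
have [q [tq qM qg]] := trigpoly_approx cg gM L0 e10.
have h0 : `|\int[P']_w q (Z w) - \int[P']_w g (Z w)| <= e1 + 2 * M * e1.
  apply: (Rintegral_box_approx (L := L) mg (measurable_trigpoly tq mZ)) => //.
    exact: ltW.
  by apply: (mono _ _ _ _ L1) => //; rewrite le_max lexx.
near=> n.
have hn : `|\int[P]_w q (Zn n w) - \int[P]_w g (Zn n w)| <= e1 + 2 * M * e1.
  apply: (Rintegral_box_approx (L := L) (mgn n) (measurable_trigpoly tq (mZn n))) => //.
    exact: ltW.
  apply: (mono _ _ _ _ L2) => //; first by rewrite le_max lexx orbT.
  by near: n.
have hq : `|\int[P']_w q (Z w) - \int[P]_w q (Zn n w)| <= e1.
  by near: n; move/cvgrPdist_le : (tc q tq); apply.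
have eE : e = 3 * (e1 + 2 * M * e1).
  by rewrite /e1; field; rewrite gt_eqF.
move: h0 hn hq; set a := \int[P']_w q _; set b := \int[P']_w g _.
set a' := \int[P]_w q _; set b' := \int[P]_w g _.
move=> /ler_normlP[h1 h2] /ler_normlP[h3 h4] /ler_normlP[h5 h6].
have Me : 0 <= M * e1 by rewrite mulr_ge0// ltW.
by rewrite eE; apply/ler_normlP; split; lra.
Unshelve. all: by end_near.
Qed.

(** * The law of the errors and Knight's identity *)

Section DensityMeasure.
Context {R : realType}.
Variable f : R -> R.

(** The proofs [mf] and [f0] are arguments so that the measure instance declared below can refer to
    them. *)
Definition density_measure (mf : measurable_fun setT f) (f0 : forall x, 0 <= f x)
  (A : set (measurableTypeR R)) : \bar R :=
  (\int[lebesgue_measure]_(x in A) (f x)%:E)%E.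

Hypotheses (mf : measurable_fun setT f) (f0 : forall x, 0 <= f x).

Let dens0 : density_measure mf f0 set0 = 0%E.
Proof. by rewrite /density_measure integral_set0. Qed.

Let dens_ge0 A : (0 <= density_measure mf f0 A)%E.
Proof. by apply: integral_ge0 => x _; rewrite lee_fin. Qed.

Let dens_sigma_additive : semi_sigma_additive (density_measure mf f0).
Proof.
move=> A mA tA mUA; rewrite /density_measure ge0_integral_bigcup//=; last 2 first.
- by apply/measurable_EFinP; exact: measurable_funTS.
- by move=> x _; rewrite lee_fin.
by apply: is_cvg_ereal_nneg_natsum_cond => n _ _; exact: dens_ge0.
Qed.

HB.instance Definition _ := isMeasure.Build _ _ _
  (density_measure mf f0) dens0 dens_ge0 dens_sigma_additive.

End DensityMeasure.

Section MeasureUniqueCdf.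
Context {R : realType}.

(** Subtracting half-lines, which have finite mass, yields equality on half-open intervals, a
    generating family stable under intersection. *)
Lemma measure_unique_cdf (m1 m2 : {measure set (measurableTypeR R) -> \bar R}) :
  (forall x, m1 `]-oo, x]%classic = m2 `]-oo, x]%classic) ->
  (forall x, m1 `]-oo, x]%classic < +oo)%E ->
  forall A, measurable A -> m1 A = m2 A.
Proof.
move=> m12 m1fin A mA.
have oc a b : m1 `]a, b]%classic = m2 `]a, b]%classic.
  have [ba|ab] := leP b a; first by rewrite set_itv_ge ?measure0// bnd_simp -leNgt.
  have D (m : {measure set (measurableTypeR R) -> \bar R}) : (m `]-oo, b]%classic < +oo)%E ->
      m `]a, b]%classic = (m `]-oo, b]%classic - m `]-oo, a]%classic)%E.
    move=> mb; rewrite (_ : `]a, b]%classic = `]-oo, b]%classic `\` `]-oo, a]%classic).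
      rewrite measureD//; congr (_ - m _)%E.
      apply/seteqP; split=> [x []//|x /=]; rewrite !in_itv/= => xa; split=> //.
      by rewrite (le_trans xa)// ltW.
    apply/seteqP; split=> x /=; rewrite !in_itv/=.
      by move=> /andP[ax ->]; split=> //; apply/negP; rewrite -ltNge.
    by move=> [-> /negP]; rewrite -ltNge => ->.
  by rewrite !D -?m12.
refine (@measure_unique _ R (measurableTypeR R) (@ocitv R) (fun n => `](- n%:R), n%:R]%classic) _ _ _ _ m1 m2 _ _ A mA) => //.
- exact: ocitvI.
- by move=> n; exact: is_ocitv.
- apply/seteqP; split=> // x _; exists (Num.bound `|x|) => //=; rewrite in_itv/=.
  have := archi_boundP (normr_ge0 x); set N := _%:R => h.
  have := ler_norm x; have := ler_norm (- x); rewrite normrN => h1 h2.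
  by apply/andP; split; lra.
- by move=> _ [[a b] _ <-].
- move=> k; rewrite (le_lt_trans _ (m1fin k%:R))//.
  by apply: le_measure; rewrite ?inE//= => x /=; rewrite !in_itv/= => /andP[].
Qed.

End MeasureUniqueCdf.

Section Knight.
Context {R : realType}.
Implicit Types (v e tau : R).

(** Closed form of the integral of [1_(e <= s) - 1_(e < 0)] for [s] from 0 to [v], the remainder in
    Knight's identity. *)
Definition knight v e : R := if 0 <= e then Num.max 0 (v - e) else Num.max 0 (e - v).

Lemma knight_identity tau v e :
  check_fun tau (e - v) - check_fun tau e = - v * (tau - (e < 0)%R%:R) + knight v e.
Proof.
rewrite /knight /check_fun subr_lt0; case: leP => e0; case: ltP => ev; case: leP => h; rewrite ?mulr1n ?mulr0n; lra.
Qed.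

Lemma knight_ge0 v e : 0 <= knight v e.
Proof. by rewrite /knight; case: ifP => _; rewrite le_max lexx. Qed.

Lemma knight0 e : knight 0 e = 0.
Proof. by rewrite /knight !maxEle; case: (leP 0 e) => h; case: (leP 0) => h'; lra. Qed.

(** Because of this locality only errors near 0 matter, both in expectations and in the random
    Lipschitz constant. *)
Lemma knight_eq0 v e : `|v| < `|e| -> knight v e = 0.
Proof.
rewrite /knight !maxEle; case: (ger0P v) => v0; case: (ger0P e) => e0 ve; rewrite ?e0 ?(leNgt 0 e) ?e0 /=; case: (leP 0) => // h; lra.
Qed.

Lemma knight_le v e : knight v e <= `|v|.
Proof.
by rewrite /knight !maxEle; case: (ger0P v) => v0; case: (leP 0 e) => e0; case: (leP 0) => h; lra.
Qed.

Lemma knight_lip v v' e : `|knight v e - knight v' e| <= `|v - v'|.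
Proof.
rewrite /knight !maxEle; apply/ler_normlP.
by case: (ger0P (v - v')) => h1; case: (leP 0 e) => e0; case: (leP 0 _) => h2; case: (leP 0 _) => h3; split; lra.
Qed.

Lemma measurable_knight v : measurable_fun setT (knight v).
Proof.
rewrite /knight; apply: measurable_fun_ifT.
- by apply: measurable_fun_ler.
- by apply: measurable_maxr => //; exact: measurable_funB.
- by apply: measurable_maxr => //; exact: measurable_funB.
Qed.

Lemma integral_affine_itv (a b p q : R) : a < b ->
  (\int[lebesgue_measure]_(x in `[a, b]) (p * x + q)%:E =
   (p * (b ^+ 2 - a ^+ 2) / 2 + q * (b - a))%:E)%E.
Proof.
move=> ab.
have D (x : R) : is_derive x 1 (fun x : R => p * (x ^+ 2 / 2) + q * x) (p * x + q).
  by apply: is_derive_eq; rewrite /GRing.scale/=; field.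
have cF : continuous (fun x : R => p * (x ^+ 2 / 2) + q * x).
  move=> x; apply: (@differentiable_continuous _ R^o R^o).
  by apply/derivable1_diffP; have := D x => /@ex_derive.
rewrite (@continuous_FTC2 _ _ (fun x => p * (x ^+ 2 / 2) + q * x))//.
- by rewrite -EFinB; congr EFin; field.
- apply: continuous_subspaceT => x; apply: cvgD; last exact: cvg_cst.
  by apply: cvgM; [exact: cvg_cst|exact: cvg_id].
- split.
  + by move=> x _; have := D x => /@ex_derive.
  + exact/cvg_at_right_filter/cF.
  + exact/cvg_at_left_filter/cF.
- by move=> x _; rewrite derive1E; have := D x => /@derive_val.
Qed.

(** The area under a right triangle with both legs of length [|v|]; this is the origin of the factor
    [1/2] in the quadratic limit. *)
Lemma integral_knight v :
  (\int[lebesgue_measure]_x (knight v x)%:E = (v ^+ 2 / 2)%:E)%E.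
Proof.
have [v0|v0|<-] := ltgtP 0 v; last first.
- under eq_integral do rewrite knight0.
  by rewrite integral0 expr0n mul0r.
- have E : (\int[lebesgue_measure]_x (knight v x)%:E = \int[lebesgue_measure]_(x in `[v, 0%R[) (1 * x + - v)%:E)%E.
    rewrite [RHS]integral_mkcond; apply: eq_integral => x _.
    rewrite patchE mul1r; case: ifPn => [|/negP]; rewrite inE /= in_itv/= /knight.
      by move=> /andP[vx x0]; rewrite leNgt x0/= max_r// subr_ge0.
    move=> /negP; rewrite negb_and -ltNge -leNgt => /orP[xv|x0].
      by rewrite leNgt (lt_trans xv v0)/= max_l// subr_le0 ltW.
    by rewrite x0 max_l//; lra.
  rewrite E integral_itv_bndo_bndc//; last first.
    by apply/measurable_EFinP; apply: measurable_funD => //; exact: measurable_funM.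
  by rewrite integral_affine_itv//; congr EFin; field.
- have E : (\int[lebesgue_measure]_x (knight v x)%:E = \int[lebesgue_measure]_(x in `[0%R, v]) ((-1) * x + v)%:E)%E.
    rewrite [RHS]integral_mkcond; apply: eq_integral => x _.
    rewrite patchE mulN1r; case: ifPn => [|/negP]; rewrite inE /= in_itv/= /knight.
      by move=> /andP[x0 xv]; rewrite x0/= max_r ?subr_ge0// addrC.
    move=> /negP; rewrite negb_and -!ltNge => /orP[x0|vx].
      by rewrite leNgt x0/= max_l//; lra.
    by rewrite (ltW (lt_trans v0 vx)) max_l// subr_le0 ltW.
  by rewrite E integral_affine_itv//; congr EFin; field.
Qed.

End Knight.

Section ErrorLaw.
Context {R : realType} {dT : measure_display} {T : measurableType dT}.
Variables (P : probability T R) (f F : R -> R) (Z : {RV P >-> R}).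
Hypotheses (hF : forall x, cdf Z x = (F x)%:E) (hf : is_density_of f F).

(** The law of [Z] and the measure of density [f] share the distribution function [F], hence
    coincide. *)
Lemma integral_density_law (g : R -> \bar R) : measurable_fun setT g ->
  (forall x, 0 <= g x)%E ->
  (\int[P]_w g (Z w) = \int[lebesgue_measure]_x (g x * (f x)%:E))%E.
Proof.
have [mf f0 fF] := hf => mg g0.
pose Z0 : T -> measurableTypeR R := Z.
pose Z1 : {mfun T >-> measurableTypeR R} :=
  HB.pack Z0 (isMeasurableFun.Build _ _ T (measurableTypeR R) Z0 (measurable_funPT Z)).
pose nu : {measure set (measurableTypeR R) -> \bar R} := distribution P Z1.
transitivity (\int[nu]_y g y)%E.
  by rewrite (ge0_integral_distribution Z1 mg g0).
apply: (@ge0_integral_density _ _ R lebesgue_measure nu f mf f0 _ g mg g0).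
move=> A mA; rewrite -[RHS]/(density_measure mf f0 A).
apply: measure_unique_cdf => // x.
  by rewrite -[LHS]/(cdf Z x) hF /= /density_measure fF.
by rewrite -[X in (X < _)%E]/(cdf Z x) hF ltry.
Qed.

Lemma density_bounds (eta : R) : 0 < eta ->
  (\forall x \near (0 : R), {for x, continuous f} /\ 0 < f x) ->
  exists2 del : R, 0 < del & forall x, `|x| <= del -> `|f x - f 0| <= eta.
Proof.
move=> eta0 /nbhs_singleton[cf _].
have /cvgrPdist_le /(_ _ eta0) /nbhs_ballP[del /= del0 h] := cf.
exists (del / 2); first by rewrite divr_gt0.
move=> x xd; rewrite distrC; apply: h; rewrite /ball/= sub0r normrN.
by rewrite (le_lt_trans xd)//; lra.
Qed.

Variables (eta del : R).
Hypothesis near_f : forall x, `|x| <= del -> `|f x - f 0| <= eta.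

Lemma integral_indic_comp (A : set R) : measurable (Z @^-1` A) ->
  (\int[P]_w (\1_A (Z w) : R)%:E = P (Z @^-1` A))%E.
Proof. by move=> mA; rewrite -[X in P X]setIT -integral_indic. Qed.

Lemma integrable_knight v : P.-integrable setT (EFin \o (fun w => knight v (Z w))).
Proof.
apply: (@integrable_bounded _ _ _ P _ `|v|).
  by apply: measurableT_comp => //; exact: measurable_knight.
by move=> w; rewrite ger0_norm ?knight_ge0// knight_le.
Qed.

(** [knight v] vanishes outside [[-|v|, |v|]], where [f] lies between [f 0 - eta] and [f 0 + eta];
    the exact integral [v^2 / 2] gives both bounds. *)
Lemma expectation_knight v : `|v| <= del ->
  `|\int[P]_w knight v (Z w) - f 0 * v ^+ 2 / 2| <= eta * v ^+ 2 / 2.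
Proof.
move=> vd; have [mf f0 fF] := hf.
have mk : measurable_fun setT (fun x : R => (knight v x)%:E).
  by apply/measurable_EFinP; exact: measurable_knight.
have k0 (x : R) : (0 <= (knight v x)%:E)%E by rewrite lee_fin knight_ge0.
have := integral_density_law mk k0; rewrite Rintegral_EFin; last exact: integrable_knight.
move=> E.
have kf x : knight v x * f x <= (f 0 + eta) * knight v x /\
            (f 0 - eta) * knight v x <= knight v x * f x.
  have [vx|xv] := ltP `|v| `|x|; first by rewrite knight_eq0// !mulr0 mul0r.
  have /ler_normlP[h1 h2] := near_f (le_trans xv vd).
  by rewrite mulrC; split; rewrite ler_wpM2r ?knight_ge0//; lra.
have cst (c : R) : 0 <= c -> (\int[lebesgue_measure]_x (c * knight v x)%:E = (c * (v ^+ 2 / 2))%:E)%E.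
  move=> c0; under eq_integral do rewrite EFinM.
  by rewrite ge0_integralZl// integral_knight.
have up : \int[P]_w knight v (Z w) <= (f 0 + eta) * (v ^+ 2 / 2).
  rewrite -lee_fin E -cst; last first.
    rewrite addr_ge0//; have := near_f (x := 0); rewrite normr0 subrr normr0; apply.
    by rewrite (le_trans _ vd).
  apply: ge0_le_integral => //.
  - by move=> x _; rewrite mule_ge0 ?k0 ?lee_fin.
  - by apply: emeasurable_funM => //; exact/measurable_EFinP.
  - by apply/measurable_EFinP; apply: measurable_funM => //; exact: measurable_knight.
  - by move=> x _; rewrite -EFinM lee_fin; have [] := kf x.
have lo : (f 0 - eta) * (v ^+ 2 / 2) <= \int[P]_w knight v (Z w).
  (* A negative constant cannot be integrated by the nonnegative theory, but the bound is then
     trivial. *)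
  have [c0|c0] := leP 0 (f 0 - eta); last first.
    rewrite (@le_trans _ _ 0)//; last by apply: Rintegral_ge0 => w _; exact: knight_ge0.
    by rewrite mulr_le0_ge0 ?(ltW c0)// divr_ge0// sqr_ge0.
  rewrite -lee_fin E -cst//; apply: ge0_le_integral => //.
  - by move=> x _; rewrite lee_fin mulr_ge0// knight_ge0.
  - by apply/measurable_EFinP; apply: measurable_funM => //; exact: measurable_knight.
  - by apply: emeasurable_funM => //; exact/measurable_EFinP.
  - by move=> x _; rewrite -EFinM lee_fin; have [] := kf x.
by apply/ler_normlP; split; lra.
Qed.

Lemma prob_small (s : R) : 0 <= s -> s <= del ->
  fine (P (Z @^-1` `[- s, s]%classic)) <= 2 * (f 0 + eta) * s.
Proof.
move=> s0 sd; have [mf f0 fF] := hf.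
have mi : measurable_fun setT (fun x : R => (\1_`[- s, s]%classic x : R)%:E).
  by apply/measurable_EFinP; exact: measurable_indic.
have i0 (x : R) : (0 <= (\1_`[- s, s]%classic x : R)%:E)%E by rewrite lee_fin.
have fe0 : 0 <= f 0 + eta.
  rewrite addr_ge0//; have := near_f (x := 0); rewrite normr0 subrr normr0; apply.
  by rewrite (le_trans s0).
have := integral_density_law mi i0.
have mZ : measurable (Z @^-1` `[- s, s]%classic).
  by rewrite -[X in measurable X]setTI; exact: measurable_funPT.
rewrite (_ : (\int[P]_w _)%E = P (Z @^-1` `[- s, s]%classic)); last first.
  exact: integral_indic_comp.
move=> E; rewrite -lee_fin fineK ?fin_num_measure// E.
apply: (@le_trans _ _ (\int[lebesgue_measure]_x ((f 0 + eta)%:E * (\1_`[- s, s]%classic x : R)%:E))%E).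
  apply: ge0_le_integral => //.
  - by move=> x _; rewrite mule_ge0 ?lee_fin.
  - by apply: emeasurable_funM => //; exact/measurable_EFinP.
  - exact: emeasurable_funM.
  move=> x _; rewrite muleC indicE; case: (boolP (x \in _)); last by rewrite !mule0.
  rewrite inE /= in_itv/= -ler_norml => xs; rewrite !mule1 lee_fin.
  by have /ler_normlP[] := near_f (le_trans xs sd); lra.
rewrite ge0_integralZl// ?lee_fin//.
rewrite [X in (_ * X)%E](_ : _ = lebesgue_measure `[- s, s]%classic); last first.
  by rewrite integral_indic// setIT.
rewrite lebesgue_measure_itv/=.
case: ifPn => _; last by rewrite mule0 lee_fin !mulr_ge0.
by rewrite -EFinB -EFinM lee_fin; lra.
Qed.

(** A law with a density has no atom at 0, so the open half-line has the mass [F 0] of the closed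
    one. *)
Lemma prob_neg : P (Z @^-1` `]-oo, 0[%classic) = (F 0)%:E.
Proof.
have mi : measurable_fun setT (fun x : R => (\1_`]-oo, 0%R[%classic x : R)%:E).
  by apply/measurable_EFinP; exact: measurable_indic.
have i0 (x : R) : (0 <= (\1_`]-oo, 0%R[%classic x : R)%:E)%E by rewrite lee_fin.
have mZ : measurable (Z @^-1` `]-oo, 0%R[%classic).
  by rewrite -[X in measurable X]setTI; exact: measurable_funPT.
have := integral_density_law mi i0.
rewrite (_ : (\int[P]_w _)%E = P (Z @^-1` `]-oo, 0[%classic)); last first.
  exact: integral_indic_comp.
move=> ->; have [mf f0 fF] := hf; rewrite -fF.
rewrite -integral_itv_bndo_bndc; last by apply/measurable_EFinP; exact: measurable_funTS.
rewrite [RHS]integral_mkcond; apply: eq_integral => x _.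
by rewrite patchE indicE; case: ifP => _; rewrite ?mul1e ?mul0e.
Qed.

End ErrorLaw.

(** * Markov and Chebyshev inequalities for independent sums *)

Section Markov.
Context {R : realType} {dT : measure_display} {T : measurableType dT} (P : probability T R).

Lemma measurable_superlevel (Y : T -> R) (e : R) : measurable_fun setT Y ->
  measurable [set w | e <= Y w].
Proof.
move=> mY; rewrite (_ : [set w | _] = Y @^-1` `[e, +oo[%classic).
  by rewrite -[X in measurable X]setTI; exact: mY.
by apply/seteqP; split => w /=; rewrite in_itv/= andbT.
Qed.

Lemma markov_le (Y : T -> R) (A : set T) (e : R) : measurable A ->
  P.-integrable setT (EFin \o Y) -> (forall w, 0 <= Y w) ->
  (forall w, A w -> e <= Y w) -> e * fine (P A) <= \int[P]_w Y w.
Proof.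
move=> mA iY Y0 AY; rewrite -Rintegral_indic// -RintegralZl//; last exact: integrable_indicR.
apply: le_Rintegral => //; first by apply: integrableZR; exact: integrable_indicR.
move=> w _; rewrite indicE; case: (boolP (w \in A)) => [|_]; last by rewrite mulr0.
by rewrite inE mulr1; exact: AY.
Qed.

Lemma fine_le_measure (A B : set T) : measurable A -> measurable B -> A `<=` B ->
  fine (P A) <= fine (P B).
Proof.
move=> mA mB AB; apply: fine_le; rewrite ?fin_num_measure//.
by apply: le_measure; rewrite ?inE.
Qed.

Lemma fine_measureU_le (A B : set T) : measurable A -> measurable B ->
  fine (P (A `|` B)) <= fine (P A) + fine (P B).
Proof.
move=> mA mB; rewrite -fineD ?fin_num_measure//; apply: fine_le.
- by rewrite fin_num_measure//; exact: measurableU.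
- by rewrite fin_numD !fin_num_measure.
exact: measureU2.
Qed.

End Markov.

Section IndependentSums.
Context {R : realType} {dT : measure_display} {T : measurableType dT}.
Variables (P : probability T R) (eps : nat -> {RV P >-> R}).
Hypothesis indep : mutually_independent eps.
Notation RR := (measurableTypeR R).

Lemma indep_pair i j (A B : set R) : i != j -> measurable A -> measurable B ->
  P (eps i @^-1` A `&` eps j @^-1` B) = (P (eps i @^-1` A) * P (eps j @^-1` B))%E.
Proof.
move=> ij mA mB; pose C l := if l == i then A else B.
have mC l : measurable (C l) by rewrite /C; case: ifP.
have Ci : C i = A by rewrite /C eqxx.
have Cj : C j = B by rewrite /C eq_sym (negbTE ij).
have := indep [fset i; j]%fset mC.
rewrite big_fsetU1 ?in_fset1//= big_seq_fset1 Ci Cj => <-.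
rewrite (bigcap_fsetU1 (fun l => eps l @^-1` C l)) Ci; congr (P (_ `&` _)).
by rewrite bigcap_fset big_seq_fset1 Cj.
Qed.

Let epsM l : {mfun T >-> RR} :=
  HB.pack (eps l : T -> RR)
   (isMeasurableFun.Build _ _ T RR (eps l : T -> RR) (measurable_funPT (eps l))).

Lemma ge0_integral_indepM i j (g h : R -> \bar R) : i != j ->
  measurable_fun setT g -> measurable_fun setT h ->
  (forall x, 0 <= g x)%E -> (forall x, 0 <= h x)%E ->
  (\int[P]_w (g (eps i w) * h (eps j w)) =
   \int[P]_w g (eps i w) * \int[P]_w h (eps j w))%E.
Proof.
move=> ij mg mh g0 h0.
pose V w : RR * RR := (eps i w, eps j w).
have mV : measurable_fun setT V.
  exact: (@measurable_fun_pair _ _ _ T RR RR _ _ (measurable_funPT (epsM i)) (measurable_funPT (epsM j))).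
pose VM : {mfun T >-> (RR * RR)%type} := HB.pack V (isMeasurableFun.Build _ _ T (RR * RR)%type V mV).
pose m1 : probability RR R := distribution P (epsM i).
pose m2 : probability RR R := distribution P (epsM j).
have prodE X : measurable X -> (m1 \x m2)%E X = distribution P VM X.
  apply: (@product_measure_unique _ _ _ _ R m1 m2) => A B mA mB.
  by rewrite /= -indep_pair.
pose f (z : RR * RR) : \bar R := (g z.1 * h z.2)%E.
have mf : measurable_fun setT f.
  by apply: emeasurable_funM; apply: measurableT_comp.
have f0 z : (0 <= f z)%E by rewrite mule_ge0.
transitivity (\int[distribution P VM]_z f z)%E.
  by rewrite ge0_integral_distribution.
rewrite (eq_measure_integral (m1 \x m2)%E); last by move=> A mA _; exact/esym/prodE.
rewrite (fubini_tonelli1 f mf f0) /fubini_F /f/=.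
under eq_integral do rewrite ge0_integralZl//.
rewrite ge0_integralZr//; last by apply: integral_ge0.
congr (_ * _)%E.
  by rewrite (ge0_integral_distribution (epsM i)).
by rewrite (ge0_integral_distribution (epsM j)).
Qed.

Variables (h : nat -> R -> R) (M : nat -> R).
Hypotheses (mh : forall i, measurable_fun setT (h i)) (hM : forall i x, `|h i x| <= M i).

Let M0 i : 0 <= M i. Proof. exact: le_trans (hM i 0). Qed.

Let heps i w : R := h i (eps i w).
Let m i := \int[P]_w heps i w.
Let cent i w : R := heps i w - m i.

Let mheps i : measurable_fun setT (heps i).
Proof. exact: measurableT_comp. Qed.

Let ih i : P.-integrable setT (EFin \o heps i).
Proof. by apply: (@integrable_bounded _ _ _ P _ (M i)) => // w; exact: hM. Qed.

Let mcent i : measurable_fun setT (cent i).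
Proof. exact: measurable_funB. Qed.

Let cM i w : `|cent i w| <= M i + M i.
Proof.
rewrite (le_trans (ler_normB _ _))// lerD//; first exact: hM.
by apply: norm_Rintegral_le_cst => // v; exact: hM.
Qed.

Let icc i j : P.-integrable setT (EFin \o (fun w => cent i w * cent j w)).
Proof.
apply: (@integrable_bounded _ _ _ P _ ((M i + M i) * (M j + M j))).
  exact: measurable_funM.
by move=> w; rewrite normrM ler_pM.
Qed.

Let ihh i j : P.-integrable setT (EFin \o (fun w => heps i w * heps j w)).
Proof.
apply: (@integrable_bounded _ _ _ P _ (M i * M j)).
  exact: measurable_funM.
by move=> w; rewrite normrM ler_pM// hM.
Qed.

(** Adding the bounds [M i] and [M j] makes both factors nonnegative; linearity removes the extra
    terms afterwards. *)
Lemma Rintegral_indepM i j : i != j ->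
  \int[P]_w (h i (eps i w) * h j (eps j w)) =
  \int[P]_w h i (eps i w) * \int[P]_w h j (eps j w).
Proof.
move=> ij; rewrite -/(heps i) -/(heps j).
have p0 l (x : R) : (0 <= (h l x + M l)%:E)%E.
  by rewrite lee_fin; have /ler_normlP[h1 h2] := hM l x; lra.
have mp l : measurable_fun setT (fun x : R => (h l x + M l)%:E).
  by apply/measurable_EFinP; exact: measurable_funD.
have iC (c : R) : P.-integrable setT (EFin \o (fun=> c)) by exact: integrable_cstR.
have iM l : P.-integrable setT (EFin \o (fun w => heps l w + M l)).
  exact: integrableDR.
have iMh (c : R) l : P.-integrable setT (EFin \o (fun w => c * heps l w)) by exact: integrableZR.
have ihhM : P.-integrable setT (EFin \o (fun w => heps i w * heps j w + M j * heps i w)).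
  exact: integrableDR.
have ihhMM : P.-integrable setT (EFin \o (fun w => heps i w * heps j w + M j * heps i w + M i * heps j w)).
  exact: integrableDR.
have iall : P.-integrable setT (EFin \o (fun w => (heps i w + M i) * (heps j w + M j))).
  have -> : (fun w => (heps i w + M i) * (heps j w + M j)) =
    (fun w => heps i w * heps j w + M j * heps i w + M i * heps j w + M i * M j).
    by apply/funext => w; ring.
  exact: integrableDR.
have := ge0_integral_indepM ij (mp i) (mp j) (p0 i) (p0 j).
rewrite (Rintegral_EFin (iM i)) (Rintegral_EFin (iM j)) (Rintegral_EFin iall) => -[].
rewrite (RintegralD _ (ih i) (iC (M i)))// (RintegralD _ (ih j) (iC (M j)))// !Rintegral_prob_cst.
have -> : \int[P]_w ((heps i w + M i) * (heps j w + M j)) =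
  \int[P]_w (heps i w * heps j w + M j * heps i w + M i * heps j w + M i * M j).
  by apply: eq_Rintegral => w _; ring.
rewrite (RintegralD _ ihhMM (iC _))// Rintegral_prob_cst (RintegralD _ ihhM (iMh _ _))//.
rewrite (RintegralD _ (ihh i j) (iMh _ _))// !RintegralZl//.
move: (Rintegral _ _ _) (Rintegral _ _ _) (Rintegral _ _ _) => x y z.
lra.
Qed.

Let Rintegral_cent i j :
  \int[P]_w (cent i w * cent j w) = \int[P]_w (heps i w * heps j w) - m i * m j.
Proof.
have iC (c : R) : P.-integrable setT (EFin \o (fun=> c)) by exact: integrable_cstR.
have iMh (c : R) l : P.-integrable setT (EFin \o (fun w => c * heps l w)) by exact: integrableZR.
have -> : \int[P]_w (cent i w * cent j w) =
  \int[P]_w (heps i w * heps j w - m j * heps i w - m i * heps j w + m i * m j).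
  by apply: eq_Rintegral => w _; rewrite /cent; ring.
have i1 : P.-integrable setT (EFin \o (fun w => heps i w * heps j w - m j * heps i w)).
  exact: integrableBR.
have i2 : P.-integrable setT (EFin \o (fun w => heps i w * heps j w - m j * heps i w - m i * heps j w)).
  exact: integrableBR.
rewrite (RintegralD _ i2 (iC _))// Rintegral_prob_cst (RintegralB _ i1 (iMh _ _))//.
rewrite (RintegralB _ (ihh i j) (iMh _ _))// !RintegralZl//.
rewrite -/(m i) -/(m j); move: (Rintegral _ _ _) => x; ring.
Qed.

(** Cross terms vanish by pairwise independence, and a variance is at most the second moment. *)
Lemma variance_sum_le n :
  \int[P]_w ((\sum_(i < n) (h i (eps i w) - \int[P]_v h i (eps i v))) ^+ 2) <=
  \sum_(i < n) \int[P]_w (h i (eps i w) ^+ 2).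
Proof.
have -> : \int[P]_w ((\sum_(i < n) (h i (eps i w) - \int[P]_v h i (eps i v))) ^+ 2) =
  \int[P]_w (\sum_(i < n) \sum_(j < n) cent i w * cent j w).
  apply: eq_Rintegral => w _; rewrite expr2 mulr_suml; apply: eq_bigr => i _.
  by rewrite mulr_sumr.
have ii (i : 'I_n) : P.-integrable setT (EFin \o (fun w => \sum_(j < n) cent i w * cent j w)).
  exact: integrable_sumR.
rewrite Rintegral_sum//; apply: ler_sum => i _.
rewrite Rintegral_sum//.
rewrite (bigD1 i)//= big1 ?addr0.
  rewrite Rintegral_cent; have -> : \int[P]_w (h i (eps i w) ^+ 2) = \int[P]_w (heps i w * heps i w).
    by apply: eq_Rintegral => w _; rewrite expr2.
  by rewrite gerBl -expr2 sqr_ge0.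
by move=> j ji; rewrite Rintegral_cent Rintegral_indepM ?subrr// eq_sym.
Qed.

Lemma chebyshev_sum n (e : R) : 0 < e ->
  fine (P [set w | e <= `|\sum_(i < n) (h i (eps i w) - \int[P]_v h i (eps i v))|]) <=
  e ^- 2 * \sum_(i < n) \int[P]_w (h i (eps i w) ^+ 2).
Proof.
move=> e0; rewrite mulrC ler_pdivlMr ?exprn_gt0// mulrC (le_trans _ (variance_sum_le n))//.
have mS : measurable_fun setT (fun w => \sum_(i < n) cent i w).
  exact: measurable_sum.
apply: markov_le => //.
- by apply: measurable_superlevel; exact: measurableT_comp.
- apply: (@integrable_bounded _ _ _ P _ ((\sum_(i < n) (M i + M i)) ^+ 2)).
    exact: measurable_funX.
  move=> w; rewrite normrX lerXn2r ?nnegrE ?sumr_ge0//.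
    by move=> i _; rewrite addr_ge0.
  rewrite (le_trans (ler_norm_sum _ _ _))//; apply: ler_sum => i _.
  exact: (cM i w).
- by move=> w; rewrite sqr_ge0.
move=> w /= ew; rewrite -[leRHS]real_normK ?num_real// lerXn2r ?nnegrE//.
exact: ltW.
Qed.

End IndependentSums.

(** * Uniform quadratic approximation *)

Section Likely.
Context {R : realType} {dT : measure_display} {T : measurableType dT} (P : probability T R).

(* Off a measurable set of probability at most [rho], for [n] large; the
   property itself need not be measurable. *)
Definition likely (rho : R) (A : nat -> T -> Prop) : Prop :=
  \forall n \near \oo, exists B, [/\ measurable B, fine (P B) <= rho &
    forall w, ~ B w -> A n w].

Lemma likely_sub (rho rho' : R) (A A' : nat -> T -> Prop) : rho <= rho' ->
  (\forall n \near \oo, forall w, A n w -> A' n w) ->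
  likely rho A -> likely rho' A'.
Proof.
move=> rr AA; apply: filterS2 AA => n AA [B [mB PB BA]].
by exists B; split=> // [|w /BA/AA//]; exact: le_trans rr.
Qed.

Lemma likelyI (rho1 rho2 : R) (A1 A2 : nat -> T -> Prop) :
  likely rho1 A1 -> likely rho2 A2 ->
  likely (rho1 + rho2) (fun n w => A1 n w /\ A2 n w).
Proof.
apply: filterS2 => n [B1 [mB1 PB1 BA1]] [B2 [mB2 PB2 BA2]].
exists (B1 `|` B2); split; first exact: measurableU.
  by rewrite (le_trans (fine_measureU_le P mB1 mB2))// lerD.
by move=> w /not_orP[/BA1 ? /BA2].
Qed.

Lemma likely_seq (I : eqType) (s : seq I) (A : I -> nat -> T -> Prop) :
  (forall (rho : R) i, 0 < rho -> i \in s -> likely rho (A i)) ->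
  forall rho : R, 0 < rho -> likely rho (fun n w => forall i, i \in s -> A i n w).
Proof.
elim: s => [|i s IH] h rho rho0.
  by near=> n; exists set0; split => //; rewrite measure0 ltW.
have r0 : 0 < rho / 2 by rewrite divr_gt0.
have := likelyI (h _ _ r0 (mem_head i s)) (IH (fun r j r0 js => h r j r0 (mem_behead (s := i :: s) js)) _ r0).
rewrite -splitr; apply: likely_sub => //.
near=> n => w [h1 h2] j; rewrite inE => /orP[/eqP->//|]; exact: h2.
Unshelve. all: by end_near.
Qed.

End Likely.

Section Design.
Context {R : realType} {r : nat}.
Variables (X : nat -> 'cV[R]_r) (Upsilon : 'M[R]_r).
Hypotheses
  (hmax : n%:R^-1 * \big[Num.max/0]_(i < n) dotv (X i) (X i) @[n --> \oo] --> (0 : R))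
  (hUpsilon : n%:R^-1 *: (\sum_(i < n) X i *m (X i)^T) @[n --> \oo] --> Upsilon).

(** Square-root form of the first condition of (A1). It supplies both the negligibility condition
    for the score and the smallness of the arguments of [knight]. *)
Lemma design_max_small (e : R) : 0 < e ->
  \forall n \near \oo, forall i, (i < n)%N -> l2norm (X i) / Num.sqrt n%:R <= e.
Proof.
move=> e0; have e20 : 0 < e ^+ 2 by rewrite exprn_gt0.
move/cvgrPdist_le : hmax => /(_ _ e20); apply: filterS2 (nbhs_infty_gt 0) => n n0.
rewrite sub0r normrN => h i ni.
have sn0 : 0 < Num.sqrt n%:R :> R by rewrite sqrtr_gt0 ltr0n.
rewrite -(ler_pXn2r (n := 2)) ?nnegrE ?divr_ge0 ?l2norm_ge0// ?(ltW e0) ?(ltW sn0)//.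
rewrite expr_div_n sqr_l2norm sqr_sqrtr// mulrC (le_trans _ h)//.
rewrite (le_trans _ (ler_norm _))// ler_wpM2l ?invr_ge0//.
by rewrite (le_bigmax _ (fun i : 'I_n => dotv (X i) (X i)) (Ordinal ni)).
Qed.

Lemma cvg_quadratic (u : 'cV[R]_r) :
  \sum_(i < n) (dotv (X i) u / Num.sqrt n%:R) ^+ 2 @[n --> \oo] --> dotv u (Upsilon *m u).
Proof.
have h : dotv u ((n%:R^-1 *: (\sum_(i < n) X i *m (X i)^T)) *m u) @[n --> \oo] -->
    dotv u (Upsilon *m u).
  rewrite dotvE; under eq_fun do rewrite dotvE.
  apply: cvg_big => [|j _]; first exact: add_continuous.
  apply: cvgMr; rewrite mxE; under eq_fun do rewrite mxE.
  apply: cvg_big => [|l _]; first exact: add_continuous.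
  apply: cvgMl.
  exact: (continuous_cvg _ (@coord_continuous R _ _ j l Upsilon) hUpsilon).
apply: cvg_trans h; apply: near_eq_cvg; near=> n.
have n0 : (0 < n)%N by near: n; exact: nbhs_infty_gt.
rewrite -scalemxAl dotvZr mulmx_suml dotv_sumr mulr_sumr; apply: eq_bigr => i _.
by rewrite dotv_outer expr_div_n sqr_sqrtr// mulrC dotvC.
Unshelve. all: by end_near.
Qed.

(** The quadratic forms at the basis vectors, added up. This bounds the expectation of [modulus] and
    the second moment of the score. *)
Lemma cvg_design_sqr : 
  \sum_(i < n) (l2norm (X i) / Num.sqrt n%:R) ^+ 2 @[n --> \oo] --> \tr Upsilon.
Proof.
have h : \sum_j \sum_(i < n) (dotv (X i) (delta_mx j 0) / Num.sqrt n%:R) ^+ 2 @[n --> \oo] -->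
    \sum_j dotv (delta_mx j 0) (Upsilon *m delta_mx j 0).
  by apply: cvg_big => [|j _]; [exact: add_continuous|exact: cvg_quadratic].
have dE (u : 'cV[R]_r) j : dotv u (delta_mx j 0) = u j 0.
  rewrite dotvE (bigD1 j)//= mxE !eqxx mulr1 big1 ?addr0// => i ij.
  by rewrite mxE (negbTE ij) mulr0.
have <- : \sum_j dotv (delta_mx j 0) (Upsilon *m delta_mx j 0) = \tr Upsilon.
  by apply: eq_bigr => j _; rewrite dotvC dE -colE mxE.
apply: cvg_trans h; apply: near_eq_cvg; near=> n.
rewrite exchange_big/=; apply: eq_bigr => i _.
rewrite expr_div_n sqr_l2norm dotvE mulr_suml; apply: eq_bigr => j _.
by rewrite dE expr_div_n expr2.
Unshelve. all: by end_near.
Qed.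

End Design.

Section Remainder.
Context {R : realType} {r : nat}.
Variables (X : nat -> 'cV[R]_r) (Upsilon : 'M[R]_r).
Hypotheses
  (hmax : n%:R^-1 * \big[Num.max/0]_(i < n) dotv (X i) (X i) @[n --> \oo] --> (0 : R))
  (hUpsilon : n%:R^-1 *: (\sum_(i < n) X i *m (X i)^T) @[n --> \oo] --> Upsilon).
Context {dT : measure_display} {T : measurableType dT}.
Variables (P : probability T R) (eps : nat -> {RV P >-> R}) (f F : R -> R).
Hypotheses (hindep : mutually_independent eps)
  (hF : forall i x, cdf (eps i) x = (F x)%:E) (hf : is_density_of f F)
  (hf0 : \forall x \near (0 : R), {for x, continuous f} /\ 0 < f x).

Definition remainder (n : nat) (u : 'cV[R]_r) (w : T) : R :=
  \sum_(i < n) knight (dotv (X i) u / Num.sqrt n%:R) (eps i w).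

Let s n i : R := l2norm (X i) / Num.sqrt n%:R.
Let v n i u : R := dotv (X i) u / Num.sqrt n%:R.

Let s_ge0 n i : 0 <= s n i. Proof. by rewrite divr_ge0 ?l2norm_ge0. Qed.

Let v_le n i u : `|v n i u| <= s n i * l2norm u.
Proof.
rewrite normrM normfV (ger0_norm (sqrtr_ge0 _)) mulrAC ler_wpM2r ?invr_ge0//.
exact: dotv_CauchySchwarz.
Qed.

Let f00 : 0 <= f 0. Proof. by have [_ h _] := hf. Qed.

Let v_small u (del : R) : 0 < del -> \forall n \near \oo, forall i, (i < n)%N -> `|v n i u| <= del.
Proof.
move=> del0; have l0 : 0 < l2norm u + 1 by rewrite ltr_wpDl// l2norm_ge0.
apply: filterS (design_max_small hmax (divr_gt0 del0 l0)) => n h i ni.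
rewrite (le_trans (v_le _ _ _))// (le_trans (ler_wpM2r (l2norm_ge0 u) (h i ni)))//.
by rewrite mulrAC ler_pdivrMr// ler_wpM2l ?(ltW del0)// lerDl.
Qed.

Lemma cvg_expectation_remainder u :
  \sum_(i < n) \int[P]_w knight (v n i u) (eps i w) @[n --> \oo] -->
  f 0 / 2 * dotv u (Upsilon *m u).
Proof.
set q := dotv _ _; apply/cvgrPdist_le => /= e e0.
have q0 : 0 < `|q| + 1 by rewrite ltr_wpDl.
have f1 : 0 < f 0 + 1 by rewrite ltr_wpDl.
(* One half of [e] covers the density error, proportional to [Q <= |q| + 1], the other the error
   [|q - Q|]; the minimum with 1 below secures that bound on [Q]. *)
have eta0 : 0 < e / (`|q| + 1) by rewrite divr_gt0.
have [del del0 near_f] := density_bounds eta0 hf0.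
have eq0 : 0 < Num.min 1 (e / (f 0 + 1)) by rewrite lt_min ltr01 divr_gt0.
have /cvgrPdist_le := @cvg_quadratic _ _ _ _ hUpsilon u; move=> /(_ _ eq0); rewrite /= -/q.
apply: filterS2 (v_small u del0) => n hv.
set Q := \sum_(i < n) _; rewrite le_min => /andP[hQ1 hQ2].
have Q0 : 0 <= Q by apply: sumr_ge0 => i _; rewrite sqr_ge0.
have h1 : `|f 0 / 2 * Q - \sum_(i < n) \int[P]_w knight (v n i u) (eps i w)| <=
    e / (`|q| + 1) * Q / 2.
  rewrite distrC mulr_sumr mulr_sumr mulr_suml -sumrB.
  rewrite (le_trans (ler_norm_sum _ _ _))//; apply: ler_sum => i _.
  have := expectation_knight (hF i) hf near_f (hv i (ltn_ord i)).
  by rewrite -/(v n i u) [f 0 / 2 * _]mulrAC.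
have h2 : `|f 0 / 2 * q - f 0 / 2 * Q| <= e / 2.
  rewrite -mulrBr normrM ger0_norm ?divr_ge0//.
  rewrite (le_trans (ler_wpM2l _ hQ2)) ?divr_ge0//.
  rewrite mulrAC ler_pM2r ?invr_gt0// mulrCA ler_piMr ?(ltW e0)//.
  by rewrite ler_pdivrMr// mul1r lerDl.
have h3 : e / (`|q| + 1) * Q / 2 <= e / 2.
  rewrite ler_pM2r ?invr_gt0// mulrAC ler_pdivrMr// ler_pM2l//.
  by move: hQ1 => /ler_normlP[]; have := ler_norm q; lra.
rewrite -(subrKA (f 0 / 2 * Q)) (le_trans (ler_normD _ _))//.
by rewrite (splitr e) lerD// (le_trans h1).
Qed.

(** Since [0 <= knight v e <= |v|], second moments are at most [max |v|] times first moments. The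
    first moments have a bounded sum, so the variance tends to 0. *)
Lemma likely_remainder u (e rho : R) : 0 < e -> 0 < rho ->
  likely P rho (fun n w => `|remainder n u w - f 0 / 2 * dotv u (Upsilon *m u)| <= e).
Proof.
move=> e0 rho0; set q := _ * dotv _ _.
have e20 : 0 < e / 2 by rewrite divr_gt0.
have q0 : 0 < `|q| + 1 by rewrite ltr_wpDl.
(* Chosen so that Chebyshev's bound at level [e / 2], namely [t (|q| + 1) / (e / 2)^2], is exactly
   [rho]. *)
pose t := rho * (e / 2) ^+ 2 / (`|q| + 1).
have t0 : 0 < t by rewrite divr_gt0// mulr_gt0// exprn_gt0.
have em0 : 0 < Num.min 1 (e / 2) by rewrite lt_min ltr01.
have /cvgrPdist_le := @cvg_expectation_remainder u; move=> /(_ _ em0); rewrite /= -/q.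
apply: filterS2 (v_small u t0) => n hv.
set E := \sum_(i < n) _; rewrite le_min => /andP[hE1 hE2].
pose h i := knight (v n i u); pose M i := `|v n i u|.
have mh i : measurable_fun setT (h i) by exact: measurable_knight.
have hM i (x : R) : `|h i x| <= M i by rewrite ger0_norm ?knight_ge0// knight_le.
exists [set w | e / 2 <= `|\sum_(i < n) (h i (eps i w) - \int[P]_v h i (eps i v))|]; split.
- apply: measurable_superlevel; apply: measurableT_comp => //; apply: measurable_sum => i.
  by apply: measurable_funB => //; apply: measurableT_comp => //.
- rewrite (le_trans (chebyshev_sum hindep mh hM n e20))// mulrC ler_pdivrMr ?exprn_gt0//.
  apply: (@le_trans _ _ (t * E)); last first.
    rewrite /t mulrAC ler_pdivrMr// ler_wpM2l//; first by rewrite ltW// mulr_gt0// exprn_gt0.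
    by move: hE1 => /ler_normlP[]; have := ler_norm q; lra.
  rewrite mulr_sumr; apply: ler_sum => i _.
  rewrite -RintegralZl//; last exact: integrable_knight.
  apply: le_Rintegral => //.
  + apply: (@integrable_bounded _ _ _ P _ (M i ^+ 2)).
      by apply: measurable_funX; apply: measurableT_comp.
    by move=> w; rewrite normrX lerXn2r ?nnegrE//; exact: normr_ge0.
  + by apply: integrableZR; exact: integrable_knight.
  move=> w _; rewrite expr2 ler_wpM2r ?knight_ge0//.
  by rewrite (le_trans (knight_le _ _))// hv.
move=> w /=; rewrite sumrB => /negP; rewrite -ltNge => hw.
rewrite -(subrKA E) (le_trans (ler_normD _ _))// (splitr e) lerD//; first exact: ltW.
by rewrite distrC.
Qed.

Let bound_sqr : \forall n \near \oo, \sum_(i < n) s n i ^+ 2 <= `|\tr Upsilon| + 1.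
Proof.
have /cvgrPdist_le := cvg_design_sqr hUpsilon; move=> /(_ 1 ltr01).
apply: filterS => n /ler_normlP[]; rewrite -/(s n _) => h1 h2.
by have := ler_norm (\tr Upsilon); lra.
Qed.

(* A random Lipschitz constant of [remainder n] on the ball of radius [K]: the
   [i]-th term vanishes on it when [`|eps i w|] exceeds [K * s n i]. *)
Definition modulus (n : nat) (K : R) (w : T) : R :=
  \sum_(i < n) s n i * (`|eps i w| <= K * s n i)%R%:R.

Lemma remainder_lip n (K : R) w u u' : l2norm u <= K -> l2norm u' <= K ->
  `|remainder n u w - remainder n u' w| <= l2norm (u - u') * modulus n K w.
Proof.
move=> uK u'K; rewrite -sumrB mulr_sumr (le_trans (ler_norm_sum _ _ _))//.
have vK i x : l2norm x <= K -> `|v n i x| <= K * s n i.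
  by move=> xK; rewrite (le_trans (v_le _ _ _))// mulrC ler_wpM2r.
apply: ler_sum => i _; have [he|he] := leP `|eps i w| (K * s n i); last first.
  rewrite -/(v n i u) -/(v n i u') !knight_eq0 ?subrr ?normr0 ?mulr0//.
    by rewrite (le_lt_trans _ he)// vK.
  by rewrite (le_lt_trans _ he)// vK.
rewrite mulr1 (le_trans (knight_lip _ _ _))// -mulrBl -dotvBr.
by rewrite (le_trans (v_le n i (u - u')))// mulrC.
Qed.

(** Each indicator has probability of order [s n i] by [prob_small]. The expectation is therefore
    controlled by the sum of squares of the [s n i], which is bounded, instead of their plain sum,
    which need not be. *)
Lemma likely_modulus (K rho : R) : 0 <= K -> 0 < rho ->
  exists2 B, 0 <= B & likely P rho (fun n w => modulus n K w <= B).
Proof.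
move=> K0 rho0; have [del del0 near_f] := density_bounds ltr01 hf0.
pose c := 2 * (f 0 + 1) * K * (`|\tr Upsilon| + 1).
have c0 : 0 <= c by rewrite !mulr_ge0// addr_ge0.
have K1 : 0 < K + 1 by rewrite ltr_wpDl.
exists ((c + 1) / rho); first by rewrite divr_ge0 ?(ltW rho0)// addr_ge0.
apply: filterS2 bound_sqr (design_max_small hmax (divr_gt0 del0 K1)) => n hs hv.
pose A i : set T := eps i @^-1` `[- (K * s n i), K * s n i]%classic.
have mA i : measurable (A i).
  by rewrite -[X in measurable X]setTI; exact: measurable_funPT.
have modE w : modulus n K w = \sum_(i < n) s n i * \1_(A i) w.
  apply: eq_bigr => i _; rewrite indicE; congr (_ * (nat_of_bool _)%:R).
  by apply/idP/idP; rewrite inE /A /= in_itv /= -ler_norml.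
have iA (i : nat) : P.-integrable setT (EFin \o (fun w => s n i * \1_(A i) w)).
  by apply: integrableZR; exact: integrable_indicR.
have iM : P.-integrable setT (EFin \o (fun w => modulus n K w)).
  by under [X in EFin \o X]funext do rewrite modE; exact: integrable_sumR.
exists [set w | (c + 1) / rho <= modulus n K w]; split.
- apply: measurable_superlevel; apply/measurable_EFinP.
  by have /integrableP[] := iM.
- have B0 : 0 < (c + 1) / rho by rewrite divr_gt0// ltr_wpDl.
  rewrite -(ler_pM2l B0) divfK ?gt_eqF//.
  rewrite (le_trans (markov_le _ iM _ _))//.
  + apply: measurable_superlevel; apply/measurable_EFinP.
    by have /integrableP[] := iM.
  + by move=> w; apply: sumr_ge0 => i _; rewrite mulr_ge0.
  rewrite (@le_trans _ _ c)//; last by rewrite lerDl.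
  have -> : \int[P]_w modulus n K w = \sum_(i < n) s n i * fine (P (A i)).
    transitivity (\int[P]_w (\sum_(i < n) s n i * \1_(A i) w)).
      by apply: eq_Rintegral => w _; exact: modE.
    rewrite Rintegral_sum//; apply: eq_bigr => i _.
    by rewrite RintegralZl ?Rintegral_indic//; exact: integrable_indicR.
  apply: (@le_trans _ _ (2 * (f 0 + 1) * K * \sum_(i < n) s n i ^+ 2)); last first.
    by rewrite ler_wpM2l// !mulr_ge0// addr_ge0.
  rewrite mulr_sumr; apply: ler_sum => i _.
  have sd : K * s n i <= del.
    rewrite (le_trans (ler_wpM2l K0 (hv _ (ltn_ord i))))// mulrCA.
    by rewrite ler_piMr ?(ltW del0)// ler_pdivrMr// mul1r lerDl.
  have := prob_small (hF i) hf near_f (mulr_ge0 K0 (s_ge0 n i)) sd.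
  rewrite -/(A i) => /(ler_wpM2l (s_ge0 n i)) h; rewrite (le_trans h)//.
  by rewrite expr2 le_eqVlt; apply/orP; left; apply/eqP; ring.
by move=> w /= /negP; rewrite -ltNge => /ltW.
Qed.

(** The pointwise statement on a finite net of the box is carried to all its points by the random
    Lipschitz constant for [remainder] and by uniform continuity for the quadratic form. *)
Lemma likely_remainder_uniform (K e rho : R) : 0 <= K -> 0 < e -> 0 < rho ->
  likely P rho (fun n w => forall u, box K u ->
    `|remainder n u w - f 0 / 2 * dotv u (Upsilon *m u)| <= e).
Proof.
move=> K0 e0 rho0.
have rho2 : 0 < rho / 2 by rewrite divr_gt0.
have e3 : 0 < e / 3 by rewrite divr_gt0.
pose K' := r%:R * K; have K'0 : 0 <= K' by rewrite mulr_ge0.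
have boxK (u : 'cV[R]_r) : box K u -> l2norm u <= K'.
  move=> hu; rewrite (le_trans (l2norm_le_sum _))//.
  have -> : K' = \sum_(j < r) K by rewrite sumr_const card_ord /K' mulr_natl.
  by apply: ler_sum => j _; exact: hu.
have [B B0 hB] := likely_modulus K'0 rho2.
pose q u : R := f 0 / 2 * dotv u (Upsilon *m u).
have qc : continuous q.
  have -> : q = (fun u => f 0 / 2 * \sum_j u j 0 * \sum_l Upsilon j l * u l 0).
    apply/funext => x; rewrite /q dotvE; congr (_ * _); apply: eq_bigr => j _.
    by rewrite mxE.
  have cc (j : 'I_r) : continuous (fun u : 'cV[R]_r => u j 0) by exact: coord_continuous.
  have cl (j : 'I_r) : continuous (fun u : 'cV[R]_r => \sum_l Upsilon j l * u l 0).
    apply: continuous_big => [|l _ u]; first exact: add_continuous.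
    by apply: (@cvgMr _ _ (nbhs u)); exact: cc.
  have cs : continuous (fun u : 'cV[R]_r => \sum_j u j 0 * \sum_l Upsilon j l * u l 0).
    apply: continuous_big => [|j _ u]; first exact: add_continuous.
    by apply: (@cvgM _ _ (nbhs u)); [exact: cc|exact: cl].
  by move=> u; apply: (@cvgMr _ _ (nbhs u)); exact: cs.
have [del1 del10 hdel1] := box_unif_continuous K qc e3.
have rB : 0 < r%:R * B + 1 by rewrite ltr_wpDl// mulr_ge0.
(* The factor [r] converts coordinatewise distance into Euclidean distance; with this mesh
   [remainder] moves by at most [e / 3] between a point and its net point. *)
pose del := Num.min del1 (e / 3 / (r%:R * B + 1)).
have del0 : 0 < del by rewrite lt_min del10 divr_gt0.
have [D' hD' cov] : exists2 D' : {fset 'cV[R]_r}, {subset D' <= box K} &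
    box K `<=` \bigcup_(g in [set` D']) ball g del.
  have := @box_compact R r K; rewrite compact_cover => /(_ _ (box K) (fun g => ball g del)).
  case; last by move=> D' h1 h2; exists D' => // x; exact: h1.
    by move=> g _; exact: ball_open.
  by move=> g gK; exists g => //; exact: ballxx.
have pt : forall rho : R, 0 < rho -> likely P rho (fun n w => forall g, g \in enum_fset D' ->
    `|remainder n g w - q g| <= e / 3).
  by apply: likely_seq => rh g rh0 _; exact: likely_remainder.
have := likelyI hB (pt _ rho2); rewrite -splitr; apply: likely_sub => //.
near=> n => w [hM hg] u uK.
have [g /= gD /(ball_cVP _ _ del0) gu] := cov _ uK.
have gK : box K g by have := hD' _ gD; rewrite inE.
have h1 := hg _ gD.
have h2 : `|q g - q u| <= e / 3.
  apply: hdel1 => // j; rewrite (lt_le_trans (gu j))//.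
  by rewrite ge_min lexx.
have h3 : `|remainder n u w - remainder n g w| <= e / 3.
  rewrite (le_trans (remainder_lip n w (boxK _ uK) (boxK _ gK)))//.
  have l : l2norm (u - g) <= r%:R * del.
    rewrite (le_trans (l2norm_le_sum _))// mulr_natl.
    have -> : del *+ r = \sum_(j < r) del by rewrite sumr_const card_ord.
    by apply: ler_sum => j _; rewrite !mxE distrC ltW.
  rewrite (le_trans (ler_wpM2l (l2norm_ge0 _) hM))//.
  rewrite (le_trans (ler_wpM2r B0 l))//.
  apply: (@le_trans _ _ ((r%:R * B + 1) * (e / 3 / (r%:R * B + 1)))); last first.
    by rewrite mulrC divfK// gt_eqF.
  rewrite mulrAC ler_pM ?mulr_ge0 ?(ltW del0)//; first by rewrite lerDl.
  by rewrite ge_min lexx orbT.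
rewrite -/(q u) -(subrKA (remainder n g w)) -(subrKA (q g)).
move: h1 h2 h3; set a := remainder _ _ _; set b := remainder _ _ _; set x := q _; set y := q _.
by rewrite !ler_norml => /andP[? ?] /andP[? ?] /andP[? ?]; apply/andP; split; lra.
Unshelve. all: by end_near.
Qed.

End Remainder.

(** * The score: limiting transform and boundedness in probability *)

Section Score.
Context {R : realType} {r : nat}.
Variables (X : nat -> 'cV[R]_r) (Upsilon : 'M[R]_r).
Hypotheses
  (hmax : n%:R^-1 * \big[Num.max/0]_(i < n) dotv (X i) (X i) @[n --> \oo] --> (0 : R))
  (hUpsilon : n%:R^-1 *: (\sum_(i < n) X i *m (X i)^T) @[n --> \oo] --> Upsilon).
Context {dT : measure_display} {T : measurableType dT}.
Variables (P : probability T R) (eps : nat -> {RV P >-> R}) (tau : R).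
Hypotheses (tau0 : 0 < tau) (tau1 : tau < 1)
  (hindep : mutually_independent eps)
  (Pneg : forall i, P (eps i @^-1` `]-oo, 0[%classic) = tau%:E).

Definition score (n : nat) (w : T) : 'cV[R]_r :=
  \sum_(i < n) (psi tau eps i w / Num.sqrt n%:R) *: X i.

Lemma dotv_score n w c :
  dotv c (score n w) = \sum_(i < n) psi tau eps i w * (dotv (X i) c / Num.sqrt n%:R).
Proof.
rewrite dotv_sumr; apply: eq_bigr => i _.
by rewrite dotvZr dotvC mulrAC mulrA.
Qed.

Lemma measurable_score n : random_vector (score n).
Proof.
move=> j; rewrite (_ : (fun w => _) = fun w => \sum_(i < n) psi tau eps i w / Num.sqrt n%:R * X i j 0).
  apply: measurable_sum => i; apply: measurable_funM => //.
  by apply: measurable_funM => //; exact: measurable_psi.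
by apply/funext => w; rewrite summxE; apply: eq_bigr => i _; rewrite mxE.
Qed.

Lemma cvg_cos_score (c : 'cV[R]_r) (b : R) :
  \int[P]_w cos (dotv c (score n w) + b) @[n --> \oo] -->
  expR (- (tau * (1 - tau) * dotv c (Upsilon *m c) / 2)) * cos b.
Proof.
pose a n i : R := dotv (X i) c / Num.sqrt n%:R.
have -> : (fun n => \int[P]_w cos (dotv c (score n w) + b)) =
    (fun n => \int[P]_w cos (sign_sum tau eps (a n) n w + b)).
  apply/funext => n; apply: eq_Rintegral => w _; rewrite dotv_score /sign_sum.
  by congr (cos (_ + b)); apply: eq_bigr => i _; rewrite mulrC.
apply: cvg_cos_sign_sum => //; last exact: cvg_quadratic.
move=> e e0; have l0 : 0 < l2norm c + 1 by rewrite ltr_wpDl// l2norm_ge0.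
apply: filterS (design_max_small hmax (divr_gt0 e0 l0)) => n h i ni.
rewrite /a normrM normfV (ger0_norm (sqrtr_ge0 _)).
rewrite (le_trans (ler_wpM2r _ (dotv_CauchySchwarz _ _))) ?invr_ge0//.
rewrite mulrAC (le_trans (ler_wpM2r (l2norm_ge0 c) (h i ni)))//.
by rewrite mulrAC ler_pdivrMr// ler_wpM2l ?(ltW e0)// lerDl.
Qed.

Let sign_le1 (x : R) : `|tau - (x < 0)%R%:R| <= 1.
Proof.
have b0 : 0 <= (x < 0)%R%:R :> R by [].
have b1 : (x < 0)%R%:R <= 1 :> R by case: (_ < _).
move: b0 b1; set b := _%:R => b0 b1; apply/ler_normlP; split.
  by rewrite opprB lerBlDr (le_trans b1)// lerDl ltW.
by rewrite lerBlDr (le_trans (ltW tau1))// lerDl.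
Qed.

Lemma psi_le1 i w : `|psi tau eps i w| <= 1.
Proof. exact: sign_le1. Qed.

Lemma Rintegral_psi i : \int[P]_w psi tau eps i w = 0.
Proof.
pose A := eps i @^-1` `]-oo, 0%R[%classic.
have mA : measurable A.
  by rewrite -[X in measurable X]setTI; exact: measurable_funPT.
transitivity (\int[P]_w (tau - \1_A w)).
  apply: eq_Rintegral => w _; rewrite indicE; congr (_ - (nat_of_bool _)%:R).
  by apply/idP/idP; rewrite inE /A /= in_itv.
rewrite RintegralB//; last exact: integrable_indicR.
  by rewrite Rintegral_prob_cst Rintegral_indic// /A Pneg subrr.
exact: integrable_cstR.
Qed.

Lemma likely_score (rho : R) : 0 < rho ->
  exists2 C, 0 <= C & likely P rho (fun n w => l2norm (score n w) <= C).
Proof.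
move=> rho0; pose c := `|\tr Upsilon| + 1.
have c0 : 0 < c by rewrite ltr_wpDl.
(* A threshold for the squared norm, where Markov's inequality gives [c / (1 + c / rho) <= rho];
   being at least 1, it also bounds the norm. *)
exists (1 + c / rho); first by rewrite addr_ge0// divr_ge0// ltW.
have /cvgrPdist_le := cvg_design_sqr hUpsilon; move=> /(_ 1 ltr01).
apply: filterS => n /ler_normlP[hs _].
have {}hs : \sum_(i < n) (l2norm (X i) / Num.sqrt n%:R) ^+ 2 <= c.
  by rewrite /c; have := ler_norm (\tr Upsilon); lra.
pose h j i (x : R) : R := (tau - (x < 0)%R%:R) * (X i j 0 / Num.sqrt n%:R).
pose M j i : R := `|X i j 0 / Num.sqrt n%:R|.
have hM j i (x : R) : `|h j i x| <= M j i.
  by rewrite normrM ler_piMl.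
have mh j i : measurable_fun setT (h j i).
  apply: measurable_funM => //; apply: measurable_funB => //.
  rewrite (_ : (fun=> _) = \1_(`]-oo, 0%R[%classic)).
    by apply: measurable_indic.
  apply/funext => x; rewrite indicE; congr ((nat_of_bool _)%:R).
  by apply/idP/idP; rewrite inE /= in_itv.
have hE j i w : h j i (eps i w) = psi tau eps i w * (X i j 0 / Num.sqrt n%:R) by [].
have sE w j : score n w j 0 = \sum_(i < n) h j i (eps i w).
  rewrite summxE; apply: eq_bigr => i _.
  by rewrite mxE hE mulrAC mulrA.
have m0 j i : \int[P]_w h j i (eps i w) = 0.
  under eq_Rintegral do rewrite hE mulrC.
  rewrite RintegralZl// ?Rintegral_psi ?mulr0//.
  by apply: (@integrable_bounded _ _ _ P _ 1); [exact: measurable_psi|exact: psi_le1].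
have iS j : P.-integrable setT (EFin \o (fun w => score n w j 0 ^+ 2)).
  apply: (@integrable_bounded _ _ _ P _ ((\sum_(i < n) M j i) ^+ 2)).
    by apply: measurable_funX; exact: measurable_score.
  move=> w; rewrite sE normrX lerXn2r ?nnegrE//.
    by apply: sumr_ge0 => i _; exact: normr_ge0.
  by rewrite (le_trans (ler_norm_sum _ _ _))//; apply: ler_sum => i _; exact: hM.
have vj j : \int[P]_w (score n w j 0 ^+ 2) <= \sum_(i < n) (X i j 0 / Num.sqrt n%:R) ^+ 2.
  have := variance_sum_le hindep (mh j) (hM j) n.
  rewrite (_ : \int[P]_w _ = \int[P]_w (score n w j 0 ^+ 2)); last first.
    apply: eq_Rintegral => w _; rewrite sE; congr (_ ^+ 2).
    by apply: eq_bigr => i _; rewrite m0 subr0.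
  move=> /le_trans; apply; apply: ler_sum => i _.
  rewrite -[leRHS](Rintegral_prob_cst P); apply: le_Rintegral => //.
  - apply: (@integrable_bounded _ _ _ P _ (M j i ^+ 2)).
      by apply: measurable_funX; apply: measurableT_comp.
    by move=> w; rewrite normrX lerXn2r ?nnegrE//; exact: normr_ge0.
  - exact: integrable_cstR.
  move=> w _; rewrite -[leLHS]real_normK ?num_real// -[leRHS]real_normK ?num_real//.
  by rewrite lerXn2r ?nnegrE//; exact: hM.
pose N w := \sum_j score n w j 0 ^+ 2.
have iN : P.-integrable setT (EFin \o N) by exact: integrable_sumR.
have mN : measurable_fun setT N.
  by apply: measurable_sum => j; apply: measurable_funX; exact: measurable_score.
have NE w : N w = l2norm (score n w) ^+ 2.
  by rewrite sqr_l2norm dotvE; apply: eq_bigr => j _; rewrite expr2.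
exists [set w | 1 + c / rho <= N w]; split.
- exact: measurable_superlevel.
- have k0 : 0 < 1 + c / rho by rewrite ltr_pwDl// divr_ge0// ltW.
  have mk : measurable [set w | 1 + c / rho <= N w] by exact: measurable_superlevel.
  have := @markov_le _ _ _ P N _ (1 + c / rho) mk iN.
  move=> /(_ (fun w => sumr_ge0 _ (fun j _ => sqr_ge0 _)) (fun w => id)).
  have : \int[P]_w N w <= c.
    rewrite Rintegral_sum// (le_trans (ler_sum _ (fun j _ => vj j)))//.
    rewrite exchange_big/= (le_trans _ hs)//; apply: ler_sum => i _.
    rewrite expr_div_n sqr_l2norm dotvE mulr_suml; apply: ler_sum => j _.
    by rewrite expr_div_n expr2.
  set p := fine _ => h1 h2.
  have p0 : 0 <= p by rewrite fine_ge0.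
  rewrite -(ler_pM2l k0) (le_trans h2)// (le_trans h1)//.
  by rewrite mulrDl mul1r divfK ?gt_eqF// lerDr ltW.
move=> w /= /negP; rewrite -ltNge NE => hw.
have C1 : 1 <= 1 + c / rho by rewrite lerDl divr_ge0// ltW.
have [//|lt] := leP (l2norm (score n w)) (1 + c / rho).
have : 1 + c / rho <= l2norm (score n w) ^+ 2.
  rewrite (le_trans (ltW lt))// expr2 ler_peMl ?l2norm_ge0//.
  by rewrite (le_trans C1)// ltW.
by rewrite leNgt hw.
Qed.

End Score.

(** * Localization of the minimizers *)

Section Convexity.
Context {R : realType}.

Lemma check_fun_convex (tau t a b : R) : 0 <= t <= 1 ->
  check_fun tau (t * a + (1 - t) * b) <= t * check_fun tau a + (1 - t) * check_fun tau b.
Proof.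
move=> /andP[t0 t1]; have s0 : 0 <= 1 - t by lra.
have checkE u : check_fun tau u = tau * u + Num.max 0 (- u).
  rewrite /check_fun; case: ltP => u0.
    by rewrite mulr1n maxEle oppr_ge0 (ltW u0); ring.
  rewrite mulr0n maxEle oppr_ge0; case: leP => u1; last by ring.
  have -> : u = 0 by apply/eqP; rewrite eq_le u0 u1.
  by ring.
rewrite !checkE.
have m (x : R) : 0 <= Num.max 0 (- x) /\ - x <= Num.max 0 (- x) by rewrite !le_max !lexx orbT.
have [ha1 ha2] := m a; have [hb1 hb2] := m b.
suff : Num.max 0 (- (t * a + (1 - t) * b)) <= t * Num.max 0 (- a) + (1 - t) * Num.max 0 (- b).
  by move: (Num.max _ _) (Num.max _ _) (Num.max _ _) => x y z; lra.
move: ha1 ha2 hb1 hb2; set x := Num.max _ (- a); set y := Num.max _ (- b) => ha1 ha2 hb1 hb2.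
rewrite ge_max addr_ge0 ?mulr_ge0//=.
by have := ler_wpM2l t0 ha2; have := ler_wpM2l s0 hb2; lra.
Qed.

(* A convex function which is larger on the part of an [eta]-sphere met by the
   segment from its centre [u0] to [u1] than at [u0] exceeds its value at [u0]
   beyond that sphere. *)
Lemma convex_localize k (G : 'cV[R]_k -> R) (u0 u1 : 'cV[R]_k) (eta : R) :
  (forall t : R, 0 <= t <= 1 -> G (u0 + t *: (u1 - u0)) <= t * G u1 + (1 - t) * G u0) ->
  0 < eta -> G u1 <= G u0 ->
  (forall t : R, 0 <= t <= 1 -> l2norm (t *: (u1 - u0)) = eta ->
     G u0 < G (u0 + t *: (u1 - u0))) ->
  l2norm (u1 - u0) < eta.
Proof.
move=> cG eta0 G10 sph; rewrite ltNge; apply/negP => far.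
have n0 : 0 < l2norm (u1 - u0) by exact: lt_le_trans far.
pose t := eta / l2norm (u1 - u0).
have t0 : 0 <= t by rewrite divr_ge0// ltW.
have t1 : t <= 1 by rewrite ler_pdivrMr// mul1r.
have t01 : 0 <= t <= 1 by rewrite t0.
have := sph t t01; rewrite l2normZ ger0_norm// divfK ?gt_eqF// => /(_ erefl).
rewrite ltNge (le_trans (cG _ t01))//.
have := ler_wpM2l t0 G10; lra.
Qed.

End Convexity.

Section QuantileLoss.
Context {R : realType} {r : nat}.
Variables (tau : R) (X : nat -> 'cV[R]_r) (Y : nat -> R) (n : nat).

Lemma quantile_loss_convex (a b : 'cV[R]_r) (t : R) : 0 <= t <= 1 ->
  quantile_loss tau X Y n (b + t *: (a - b)) <=
  t * quantile_loss tau X Y n a + (1 - t) * quantile_loss tau X Y n b.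
Proof.
move=> t01; rewrite /quantile_loss !mulr_sumr -big_split/=; apply: ler_sum => i _.
apply: (le_trans _ (check_fun_convex tau _ _ t01)).
by rewrite dotvDr dotvZr dotvBr le_eqVlt; apply/orP; left; apply/eqP; congr check_fun; ring.
Qed.

Lemma l2norm_convex (a b : 'cV[R]_r) (t : R) : 0 <= t <= 1 ->
  l2norm (b + t *: (a - b)) <= t * l2norm a + (1 - t) * l2norm b.
Proof.
move=> /andP[t0 t1].
have -> : b + t *: (a - b) = t *: a + (1 - t) *: b.
  by rewrite scalerBr scalerBl scale1r addrCA addrA addrAC -!addrA addrCA.
by rewrite (le_trans (l2normD _ _))// !l2normZ !ger0_norm// subr_ge0.
Qed.

Lemma mulmx_l2norm_le k (A : 'M[R]_(k, r)) : exists2 c : R, 0 <= c &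
  forall u, l2norm (A *m u) <= c * l2norm u.
Proof.
exists (\sum_i \sum_j `|A i j|); first by apply: sumr_ge0 => i _; apply: sumr_ge0.
move=> u; rewrite (le_trans (l2norm_le_sum _))// mulr_suml; apply: ler_sum => i _.
rewrite mxE (le_trans (ler_norm_sum _ _ _))// mulr_suml; apply: ler_sum => j _.
by rewrite normrM ler_wpM2l// norm_coord_le.
Qed.

(* Knight's identity, summed over the sample. *)
Lemma quantile_loss_shift (b0 u : 'cV[R]_r) (e : nat -> R) (s : R) :
  (forall i, Y i = dotv (X i) b0 + e i) ->
  quantile_loss tau X Y n (b0 + s^-1 *: u) - quantile_loss tau X Y n b0 =
  - dotv (\sum_(i < n) ((tau - (e i < 0)%R%:R) / s) *: X i) u +
  \sum_(i < n) knight (dotv (X i) u / s) (e i).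
Proof.
move=> hY; rewrite /quantile_loss dotvC dotv_sumr -!sumrN -!big_split/=; apply: eq_bigr => i _.
have -> : Y i - dotv (X i) (b0 + s^-1 *: u) = e i - dotv (X i) u / s.
  by rewrite hY dotvDr dotvZr; ring.
have -> : Y i - dotv (X i) b0 = e i by rewrite hY addrC addKr.
by rewrite knight_identity dotvZr [dotv u _]dotvC; congr (_ + _); ring.
Qed.

End QuantileLoss.

(** * The penalized loss and its infinite weights *)

Section PenalizedLoss.
Context {R : realType}.
Variables (p : nat) (d : 'I_p -> nat).
Local Notation r := (\sum_(j < p) d j)%N.
Variables (tau gamma mu : R) (X : nat -> 'cV[R]_r) (Y : nat -> R) (n : nat).
Variables (bt bs : 'cV[R]_r).
Hypotheses (gamma0 : 0 < gamma) (mu0 : 0 < mu).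
Hypothesis hbs : is_adaptive_group_lasso_estimate tau gamma mu X Y n bt bs.

(* Junk value 0 for the groups of infinite weight. *)
Definition real_weight (j : 'I_p) : R := (l2norm (submxcol bt j) `^ gamma)^-1.

Definition real_penalized_loss (b : 'cV[R]_r) : R :=
  quantile_loss tau X Y n b + mu * \sum_j real_weight j * l2norm (submxcol b j).

Let wE j : submxcol bt j != 0 -> adaptive_weight gamma bt j = (real_weight j)%:E.
Proof.
rewrite -l2norm_eq0 => h; rewrite /adaptive_weight inver.
by rewrite gt_eqF// powR_gt0// lt_neqAle eq_sym h l2norm_ge0.
Qed.

Let w0 j : submxcol bt j = 0 -> adaptive_weight gamma bt j = +oo%E.
Proof.
by move=> h; rewrite /adaptive_weight h l2norm0 powR0 ?gt_eqF// inver eqxx.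
Qed.

(** Where the weight is infinite the norm of [b] is zero, and both conventions, [+oo * 0 = 0] and
    the junk weight, give 0. *)
Lemma penalized_lossE (b : 'cV[R]_r) :
  (forall j, submxcol bt j = 0 -> submxcol b j = 0) ->
  penalized_loss tau gamma mu X Y n bt b = (real_penalized_loss b)%:E.
Proof.
move=> hb; rewrite /penalized_loss /real_penalized_loss EFinD EFinM; congr (_ + _ * _)%E.
rewrite -sumEFin; apply: eq_bigr => j _.
have [/eqP e|e] := boolP (submxcol bt j == 0); last by rewrite wE.
by rewrite hb// l2norm0 mulr0 mule0.
Qed.

(** The loss at the zero vector is finite, whereas a nonzero group of infinite weight makes the loss
    infinite. *)
Lemma lasso_infinite_weight j : submxcol bt j = 0 -> submxcol bs j = 0.
Proof.
move=> e; apply/eqP; rewrite -l2norm_eq0; apply/negP => /negP ne.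
have := hbs 0; rewrite [X in (_ <= X)%E]penalized_lossE; last by move=> i _; apply/matrixP => a b; rewrite !mxE.
rewrite leNgt => /negP; apply; rewrite /penalized_loss.
have w_ge0 i : (0 <= adaptive_weight gamma bt i * (l2norm (submxcol bs i))%:E)%E.
  apply: mule_ge0; last by rewrite lee_fin l2norm_ge0.
  have [/eqP z|z] := boolP (submxcol bt i == 0); first by rewrite w0.
  by rewrite wE// lee_fin invr_ge0 powR_ge0.
have gt0 : 0 < l2norm (submxcol bs j) by rewrite lt_neqAle eq_sym ne l2norm_ge0.
have -> : (\sum_i adaptive_weight gamma bt i * (l2norm (submxcol bs i))%:E)%E = +oo%E.
  rewrite [LHS](bigD1 j)//= w0// gt0_mulye ?lte_fin// addye//.
  by rewrite gt_eqF// (lt_le_trans (ltNyr 0))// sume_ge0.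
by rewrite gt0_muley ?lte_fin// addey// ltry.
Qed.

Lemma real_penalized_loss_min (b : 'cV[R]_r) :
  (forall j, submxcol bt j = 0 -> submxcol b j = 0) ->
  real_penalized_loss bs <= real_penalized_loss b.
Proof.
move=> hb; rewrite -lee_fin -!penalized_lossE//; exact: lasso_infinite_weight.
Qed.

Lemma real_penalized_loss_convex (a b : 'cV[R]_r) (t : R) : 0 <= t <= 1 ->
  real_penalized_loss (b + t *: (a - b)) <=
  t * real_penalized_loss a + (1 - t) * real_penalized_loss b.
Proof.
move=> t01; have := quantile_loss_convex tau X Y n a b t01.
rewrite /real_penalized_loss.
suff : \sum_j real_weight j * l2norm (submxcol (b + t *: (a - b)) j) <=
    t * (\sum_j real_weight j * l2norm (submxcol a j)) +
    (1 - t) * (\sum_j real_weight j * l2norm (submxcol b j)).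
  move: (\sum_j _) (\sum_j _) (\sum_j _) (quantile_loss _ _ _ _ _) (quantile_loss _ _ _ _ _) (quantile_loss _ _ _ _ _).
  move=> x y z x' y' z' h1 h2; have := ler_wpM2l (ltW mu0) h1; lra.
rewrite !mulr_sumr -big_split/=; apply: ler_sum => j _.
have -> : submxcol (b + t *: (a - b)) j = submxcol b j + t *: (submxcol a j - submxcol b j).
  by apply/matrixP => x y; rewrite !mxE.
have wj : 0 <= real_weight j by rewrite invr_ge0 powR_ge0.
have := ler_wpM2l wj (l2norm_convex (submxcol a j) (submxcol b j) t01).
move: (l2norm _) (l2norm _) (l2norm _) => x y z; lra.
Qed.

End PenalizedLoss.

(** * Deterministic localization, for one fixed outcome *)

Section ArgMin.
Context {R : realType}.
Variables (p : nat) (d : 'I_p -> nat) (p0 : nat) (hp0 : (p0 <= p)%N).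
Local Notation r := (\sum_(j < p) d j)%N.
Variables (tau gamma mu : R) (X : nat -> 'cV[R]_r) (Y : nat -> R) (n : nat).
Variables (b0 bt bs W : 'cV[R]_r) (Rem : 'cV[R]_r -> R) (s f0 lam C K delta : R).
Variable Upsilon : 'M[R]_r.
Hypotheses (s0 : 0 < s) (f00 : 0 < f0).
Hypothesis shift : forall u, quantile_loss tau X Y n (b0 + s^-1 *: u) -
  quantile_loss tau X Y n b0 = - dotv W u + Rem u.
Hypothesis Rem_approx : forall u, l2norm u <= K ->
  `|Rem u - f0 / 2 * dotv u (Upsilon *m u)| <= delta.
Hypothesis lower : forall u, lam * dotv u u <= dotv u (Upsilon *m u).

Let rescaleK b : b0 + s^-1 *: (s *: (b - b0)) = b.
Proof. by rewrite scalerA mulVf ?gt_eqF// scale1r addrC subrK. Qed.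

Let rescale_line u v (t : R) : b0 + s^-1 *: (u + t *: (v - u)) =
  (b0 + s^-1 *: u) + t *: ((b0 + s^-1 *: v) - (b0 + s^-1 *: u)).
Proof. by apply/matrixP => i j; rewrite !mxE; ring. Qed.

(** On the sphere of radius [K1] the quadratic term exceeds the linear term, at most [C K1],
    together with the approximation error, so the loss there is above its value at the centre
    [b0]. *)
Lemma quantile_localize K1 : l2norm W <= C -> 0 < K1 -> K1 <= K ->
  C * K1 + delta < f0 / 2 * (lam * K1 ^+ 2) ->
  is_quantile_estimate tau X Y n bt -> l2norm (s *: (bt - b0)) < K1.
Proof.
move=> WC K10 K1K gap hbt.
rewrite -[s *: _]subr0; apply: (@convex_localize _ _ (fun u => quantile_loss tau X Y n (b0 + s^-1 *: u))) => //.
- by move=> t t01; rewrite rescale_line; exact: quantile_loss_convex.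
- by rewrite rescaleK; exact: hbt.
move=> t t01; rewrite subr0 add0r scaler0 addr0; set u := t *: _ => uK1.
have := shift u; have := Rem_approx (u := u); rewrite uK1 => /(_ K1K) /ler_normlP[h1 h2] h3.
have := lower u; rewrite -sqr_l2norm uK1 => h4.
have h5 : dotv W u <= C * K1.
  rewrite (le_trans (ler_norm _))// (le_trans (dotv_CauchySchwarz _ _))// uK1.
  by rewrite ler_wpM2r// ltW.
have h6 : f0 / 2 * (lam * K1 ^+ 2) <= f0 / 2 * dotv u (Upsilon *m u).
  by rewrite ler_wpM2l// divr_ge0// ltW.
rewrite -subr_gt0 h3.
move: h1 h2 h5 h6 gap; move: (dotv W u) (Rem u) (f0 / 2 * (lam * _)) (f0 / 2 * dotv _ _) (C * K1).
by move=> ? ? ? ? ?; lra.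
Qed.

Variables (u0 : 'cV[R]_r) (eta Omega : R).
Let g := f0 *: (Upsilon *m u0) - W.
Hypotheses (gamma0 : 0 < gamma) (mu0 : 0 < mu) (eta0 : 0 < eta) (Omega0 : 0 <= Omega).
Hypothesis symU : Upsilon^T = Upsilon.
Hypothesis hbs : is_adaptive_group_lasso_estimate tau gamma mu X Y n bt bs.
Hypotheses (u0_inactive : forall j : 'I_p, (p0 <= j)%N -> submxcol u0 j = 0)
  (b0_inactive : forall j : 'I_p, (p0 <= j)%N -> submxcol b0 j = 0)
  (g_active : forall j : 'I_p, (j < p0)%N -> submxcol g j = 0)
  (bt_active : forall j : 'I_p, (j < p0)%N -> submxcol bt j != 0)
  (weight_active : forall j : 'I_p, (j < p0)%N -> real_weight gamma bt j <= Omega)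
  (weight_inactive : forall j : 'I_p, (p0 <= j)%N -> submxcol bt j != 0 ->
     l2norm g * s <= mu * real_weight gamma bt j).

Let submxcolD (a b : 'cV[R]_r) j : submxcol (a + b) j = submxcol a j + submxcol b j.
Proof. by apply/matrixP => x y; rewrite !mxE. Qed.

Let submxcolZ (c : R) (a : 'cV[R]_r) j : submxcol (c *: a) j = c *: submxcol a j.
Proof. by apply/matrixP => x y; rewrite !mxE. Qed.

(* [g] is the gradient at [u0] of the quadratic approximation of the loss. It
   vanishes on the active groups, and the penalty absorbs it on the others. *)
Let group_gap (h : 'cV[R]_r) (j : 'I_p) : l2norm h = eta ->
  (submxcol bt j = 0 -> submxcol h j = 0) ->
  - (mu * Omega * eta / s) <= dotv (submxcol g j) (submxcol h j) +
   mu * (real_weight gamma bt j * l2norm (submxcol (b0 + s^-1 *: (u0 + h)) j) -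
         real_weight gamma bt j * l2norm (submxcol (b0 + s^-1 *: u0) j)).
Proof.
move=> heta hj; set w := real_weight gamma bt j.
have w0 : 0 <= w by rewrite invr_ge0 powR_ge0.
have si : 0 < s^-1 by rewrite invr_gt0.
have M0 : 0 <= mu * Omega * eta / s.
  by rewrite !mulr_ge0 ?(ltW mu0) ?(ltW eta0) ?(ltW si).
have [ja|ji] := ltnP j p0.
  rewrite g_active// dot0v add0r.
  have hn : l2norm (submxcol h j) <= eta by rewrite -heta l2norm_submxcol.
  set a := submxcol (b0 + s^-1 *: u0) j.
  have -> : submxcol (b0 + s^-1 *: (u0 + h)) j = a + s^-1 *: submxcol h j.
    by rewrite /a; apply/matrixP => x y; rewrite !mxE; ring.
  have := l2norm_distr (a + s^-1 *: submxcol h j) a.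
  rewrite [a + s^-1 *: _]addrC addrK l2normZ (gtr0_norm si) => /ler_normlP[h1 _].
  have h2 : - (eta / s) <= l2norm (s^-1 *: submxcol h j + a) - l2norm a.
    have : s^-1 * l2norm (submxcol h j) <= eta / s by rewrite mulrC ler_wpM2r// ltW.
    by move: h1; set x := l2norm _; set y := l2norm a; set z := s^-1 * _; set q := eta / s; lra.
  rewrite -mulrBr mulrA.
  have e0 : 0 <= eta / s by rewrite divr_ge0 ?(ltW eta0) ?(ltW s0).
  apply: (@le_trans _ _ (mu * w * - (eta / s))); last first.
    by rewrite ler_wpM2l// mulr_ge0// ltW.
  rewrite mulrN lerN2 -!mulrA ler_wpM2l ?(ltW mu0)//.
  by rewrite ler_wpM2r// weight_active.
rewrite (_ : submxcol (b0 + s^-1 *: (u0 + h)) j = s^-1 *: submxcol h j); last first.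
  by rewrite submxcolD submxcolZ submxcolD u0_inactive// b0_inactive// !add0r.
rewrite (_ : submxcol (b0 + s^-1 *: u0) j = 0); last first.
  by rewrite submxcolD submxcolZ u0_inactive// b0_inactive// scaler0 addr0.
rewrite l2norm0 mulr0 subr0 l2normZ gtr0_norm//.
have [/eqP z|z] := boolP (submxcol bt j == 0).
  by rewrite hj// l2norm0 dotv0 !mulr0 addr0 oppr_le0.
rewrite (@le_trans _ _ 0)// ?oppr_le0// -lerBlDl sub0r.
have hw := weight_inactive ji z.
rewrite (le_trans (ler_norm _))// normrN (le_trans (dotv_CauchySchwarz _ _))//.
rewrite (mulrA w) (mulrA mu) ler_wpM2r ?l2norm_ge0//.
rewrite (le_trans (l2norm_submxcol _ _))// mulrA ler_pdivlMr//.
Qed.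

(** For [|h| = eta] the loss at [u0 + h] minus the loss at [u0] is at least the quadratic gain, less
    [2 delta] for approximating at two points, less what [group_gap] allows each of the [p] groups
    to lose. *)
Lemma lasso_localize : l2norm u0 + eta <= K ->
  2 * delta + p%:R * (mu * Omega * eta / s) < f0 / 2 * (lam * eta ^+ 2) ->
  l2norm (s *: (bs - b0) - u0) < eta.
Proof.
move=> u0K gap.
pose G u := real_penalized_loss tau gamma mu X Y n bt (b0 + s^-1 *: u).
have bt0_inactive j : submxcol bt j = 0 -> (p0 <= j)%N.
  by move=> e; rewrite leqNgt; apply/negP => /bt_active; rewrite e eqxx.
apply: (@convex_localize _ _ G) => //.
- by move=> t t01; rewrite /G rescale_line; exact: real_penalized_loss_convex.
- rewrite /G rescaleK; apply: real_penalized_loss_min => // j /bt0_inactive ji.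
  by rewrite submxcolD submxcolZ u0_inactive// b0_inactive// scaler0 addr0.
move=> t t01; set h := t *: _ => heta.
(* The segment from [u0] to the minimizer never leaves the subspace of finite loss, as both ends
   vanish on groups of infinite weight. *)
have hj j : submxcol bt j = 0 -> submxcol h j = 0.
  move=> e; have ji := bt0_inactive _ e.
  have bsj := lasso_infinite_weight gamma0 mu0 hbs e.
  have -> : submxcol h j = t *: (s *: (submxcol bs j - submxcol b0 j) - submxcol u0 j).
    by apply/matrixP => x y; rewrite !mxE.
  by rewrite bsj b0_inactive// u0_inactive// !subr0 !scaler0.
have hK : l2norm (u0 + h) <= K by rewrite (le_trans (l2normD _ _))// heta.
have uK : l2norm u0 <= K by rewrite (le_trans _ u0K)// lerDl ltW.
have /ler_normlP[a1 a2] := Rem_approx hK; have /ler_normlP[a3 a4] := Rem_approx uK.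
have quad : dotv (u0 + h) (Upsilon *m (u0 + h)) =
    dotv u0 (Upsilon *m u0) + 2 * dotv (Upsilon *m u0) h + dotv h (Upsilon *m h).
  rewrite mulmxDr !dotvDr !dotvDl.
  have -> : dotv u0 (Upsilon *m h) = dotv (Upsilon *m u0) h by rewrite dotv_mulmx symU.
  have -> : dotv h (Upsilon *m u0) = dotv (Upsilon *m u0) h by rewrite dotvC.
  ring.
have low : f0 / 2 * (lam * eta ^+ 2) <= f0 / 2 * dotv h (Upsilon *m h).
  by rewrite ler_wpM2l ?divr_ge0 ?(ltW f00)// -heta sqr_l2norm.
have gh : dotv g h = f0 * dotv (Upsilon *m u0) h - dotv W h by rewrite dotvBl dotvZl.
have dQ : dotv g h + f0 / 2 * (lam * eta ^+ 2) - 2 * delta <=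
  quantile_loss tau X Y n (b0 + s^-1 *: (u0 + h)) - quantile_loss tau X Y n (b0 + s^-1 *: u0).
  have := shift (u0 + h); have := shift u0; rewrite dotvDr gh.
  move: a1 a2 a3 a4 low; rewrite quad.
  move: (dotv W h) (dotv W u0) (Rem _) (Rem _) (dotv (Upsilon *m u0) h) (dotv h (Upsilon *m h)) (dotv u0 _).
  move: (quantile_loss _ _ _ _ _) (quantile_loss _ _ _ _ _) (quantile_loss _ _ _ _ _) (f0 / 2 * (lam * _)).
  move=> q1 q2 q3 k x1 x2 x3 x4 x5 x6 x7; lra.
have pen : - (p%:R * (mu * Omega * eta / s)) <= dotv g h +
   mu * (\sum_j real_weight gamma bt j * l2norm (submxcol (b0 + s^-1 *: (u0 + h)) j) -
         \sum_j real_weight gamma bt j * l2norm (submxcol (b0 + s^-1 *: u0) j)).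
  rewrite dotv_submxcol -sumrB mulr_sumr -big_split/=.
  have -> : - (p%:R * (mu * Omega * eta / s)) = \sum_(j < p) - (mu * Omega * eta / s).
    by rewrite sumr_const card_ord mulr_natl mulNrn.
  by apply: ler_sum => j _; apply: group_gap => //; exact: hj.
rewrite -subr_gt0 /G /real_penalized_loss.
move: dQ pen gap.
move: (dotv g h) (quantile_loss _ _ _ _ _) (quantile_loss _ _ _ _ _) (f0 / 2 * (lam * _)).
move: (p%:R * _) (\sum_j _) (\sum_j _) => x1 x2 x3 x4 x5 x6 x7; lra.
Qed.

End ArgMin.

(** * Slutsky's lemma for cosine transforms *)

Section CloseVectors.
Context {R : realType} {dT : measure_display} {T : measurableType dT}.
Variables (P : probability T R) (k : nat) (Zn Vn : nat -> T -> 'cV[R]_k).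
Hypotheses (mZ : forall n, random_vector (Zn n)) (mV : forall n, random_vector (Vn n)).
Hypothesis close : forall eta rho : R, 0 < eta -> 0 < rho ->
  likely P rho (fun n w => l2norm (Zn n w - Vn n w) <= eta).

Lemma dist_cos_le (x y : R) : `|cos x - cos y| <= `|x - y|.
Proof.
have h (a b : R) : `|cos (a + b) - cos (a - b)| <= `|2 * b|.
  rewrite cosD cosB (_ : _ - _ = (-2) * (sin a * sin b)); last by ring.
  rewrite !normrM normrN; apply: ler_wpM2l => //.
  by apply: le_trans (norm_sin_le b); rewrite ler_piMl// sin_max.
have := h ((x + y) / 2) ((x - y) / 2).
have -> : (x + y) / 2 + (x - y) / 2 = x by field.
have -> : (x + y) / 2 - (x - y) / 2 = y by field.
by rewrite mulrC divfK.
Qed.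

Lemma cvg_cos_close (t : 'cV[R]_k) (c l : R) :
  \int[P]_w cos (dotv t (Vn n w) + c) @[n --> \oo] --> l ->
  \int[P]_w cos (dotv t (Zn n w) + c) @[n --> \oo] --> l.
Proof.
move=> hV; apply/cvgrPdist_le => /= e e0.
have t0 : 0 < l2norm t + 1 by rewrite ltr_wpDl// l2norm_ge0.
pose eta := e / 3 / (l2norm t + 1).
have eta0 : 0 < eta by rewrite !divr_gt0.
(* Off the exceptional set the cosines differ by at most [|t| eta <= e / 3]; on it by at most 2,
   which costs [2 (e / 6)]. The last third is the convergence for [Vn]. *)
have rho0 : 0 < e / 6 by rewrite divr_gt0.
have e3 : 0 < e / 3 by rewrite divr_gt0.
move/cvgrPdist_le : hV => /(_ _ e3); apply: filterS2 (close eta0 rho0) => n [A [mA PA hA]] hl.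
have iZ := @integrable_cos_dotv _ _ _ P _ _ t c (mZ n).
have iV := @integrable_cos_dotv _ _ _ P _ _ t c (mV n).
have hd : `|\int[P]_w cos (dotv t (Vn n w) + c) - \int[P]_w cos (dotv t (Zn n w) + c)| <= e / 3 + 2 * (e / 6).
  rewrite -RintegralB//.
  apply: (@le_trans _ _ (\int[P]_w (e / 3 + 2 * \1_A w))); last first.
    rewrite RintegralD//; last 2 first.
    - exact: integrable_cstR.
    - by apply: integrableZR; exact: integrable_indicR.
    rewrite Rintegral_prob_cst RintegralZl//; last exact: integrable_indicR.
    by rewrite Rintegral_indic// lerD2l ler_wpM2l.
  apply: norm_Rintegral_le.
  - exact: integrableBR.
  - apply: integrableDR; first exact: integrable_cstR.
    by apply: integrableZR; exact: integrable_indicR.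
  move=> w; rewrite indicE; case: (boolP (w \in A)) => [_|]; last first.
    rewrite notin_setE => /hA hw; rewrite mulr0 addr0 (le_trans (dist_cos_le _ _))//.
    rewrite opprD addrACA subrr addr0 -dotvBr (le_trans (dotv_CauchySchwarz _ _))//.
    rewrite -(l2normN (Vn n w - _)) opprB (le_trans (ler_wpM2l (l2norm_ge0 _) hw))//.
    by rewrite /eta mulrCA ler_piMr ?(ltW e3)// ler_pdivrMr// mul1r lerDl.
  rewrite mulr1 (le_trans (ler_normB _ _))// (@le_trans _ _ 2)//; last by rewrite lerDr ltW.
  by rewrite (_ : 2 = 1 + 1 :> R)// lerD// cos_max.
rewrite -(subrKA (\int[P]_w cos (dotv t (Vn n w) + c))) (le_trans (ler_normD _ _))//.
by rewrite (le_trans (lerD hl hd))//; lra.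
Qed.

Lemma tight_close : (forall rho : R, 0 < rho -> exists C : R,
    likely P rho (fun n w => l2norm (Vn n w) <= C)) ->
  forall e : R, 0 < e -> exists L : R,
     \forall n \near \oo, fine (P (~` (Zn n @^-1` box L))) <= e.
Proof.
move=> tV e e0; have e2 : 0 < e / 2 by rewrite divr_gt0.
have [C hC] := tV _ e2; exists (1 + C).
have := likelyI (close ltr01 e2) hC; rewrite -splitr; apply: filterS => n [A [mA PA hA]].
apply: le_trans PA; apply: fine_le_measure => //.
  by apply: measurableC; exact: measurable_box.
move=> w; apply: contra_notP => /hA[h1 h2] j.
rewrite (le_trans (norm_coord_le _ _))// -(subrK (Vn n w) (Zn n w)).
by rewrite (le_trans (l2normD _ _))// lerD.
Qed.

End CloseVectors.

(** * Asymptotic normality *)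

Section AdaptiveGroupLasso.
Context {R : realType} {dT : measure_display} {T : measurableType dT} (P : probability T R).
Variables (p : nat) (d : 'I_p -> nat) (p0 : nat) (hp0 : (p0 <= p)%N).
Local Notation r := (\sum_(j < p) d j)%N.
Local Notation r0 := (\sum_(j < p0) d (widen_ord hp0 j))%N.
Variable beta0 : 'cV[R]_r.
Hypothesis hbeta0 : forall j : 'I_p, l2norm (submxcol beta0 j) != 0 <-> (j < p0)%N.
Variables (X : nat -> 'cV[R]_r) (eps : nat -> {RV P >-> R}) (Y : nat -> T -> R).
Hypothesis hY : forall i w, Y i w = dotv (X i) beta0 + eps i w.
Variable tau : R.
Hypotheses (htau0 : 0 < tau) (htau1 : tau < 1).
Variable Upsilon : 'M[R]_r.
Hypotheses
  (hmax : n%:R^-1 * \big[Num.max/0]_(i < n) dotv (X i) (X i) @[n --> \oo] --> (0 : R))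
  (hUpsilon : n%:R^-1 *: (\sum_(i < n) X i *m (X i)^T) @[n --> \oo] --> Upsilon)
  (hposdef : posdefmx Upsilon).
Variables (F f : R -> R).
Hypotheses (hindep : mutually_independent eps)
  (hF : forall i x, cdf (eps i) x = (F x)%:E)
  (hf : is_density_of f F)
  (hf0 : \forall x \near (0 : R), {for x, continuous f} /\ 0 < f x)
  (htau : tau = F 0).
Variables (mu : nat -> R) (gamma : R).
Hypotheses (hmu_gt0 : forall n, 0 < mu n) (hgamma : 0 < gamma)
  (hmu_sqrt : mu n / Num.sqrt n%:R @[n --> \oo] --> (0 : R))
  (hmu_gamma : n%:R `^ ((gamma - 1) / 2) * mu n @[n --> \oo] --> +oo).
Variables betat betas : nat -> T -> 'cV[R]_r.
Hypotheses (hbetat : forall n w, is_quantile_estimate tau X (Y^~ w) n (betat n w))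
  (hbetas : forall n w, is_adaptive_group_lasso_estimate
              tau gamma (mu n) X (Y^~ w) n (betat n w) (betas n w)).

Local Notation J := (active_proj d hp0 : 'M[R]_(r0, r)).
Local Notation A := (active_mx hp0 Upsilon).

Let f0_gt0 : 0 < f 0. Proof. by have [] := nbhs_singleton hf0. Qed.

Let Pneg i : P (eps i @^-1` `]-oo, 0[%classic) = tau%:E.
Proof. by rewrite htau; exact: (prob_neg (hF i) hf). Qed.

(* The linearization of the rescaled estimator of the active groups. *)
Definition leading_term (n : nat) (w : T) : 'cV[R]_r0 :=
  (f 0)^-1 *: (invmx A *m (J *m score X eps tau n w)).

Let unitA : A \in unitmx.
Proof. by apply: posdefmx_unit; exact: posdefmx_active. Qed.

Lemma l2norm_active_projT (x : 'cV[R]_r0) : l2norm (J^T *m x) = l2norm x.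
Proof.
by rewrite /l2norm dotv_mulmx trmxK mulmxA active_proj_mulT mul1mx.
Qed.

Lemma l2norm_active_proj_le (u : 'cV[R]_r) : l2norm (J *m u) <= l2norm u.
Proof.
have [->|ne] := eqVneq (J *m u) 0; first by rewrite l2norm0 l2norm_ge0.
have g0 : 0 < l2norm (J *m u) by rewrite lt_neqAle eq_sym l2norm_eq0 ne l2norm_ge0.
rewrite -(ler_pM2r g0) -expr2 sqr_l2norm dotv_mulmx.
rewrite (le_trans (ler_norm _))// (le_trans (dotv_CauchySchwarz _ _))//.
by rewrite l2norm_active_projT mulrC.
Qed.

Lemma active_norm_lower : exists2 m : R, 0 < m &
  forall j : 'I_p, (j < p0)%N -> m <= l2norm (submxcol beta0 j).
Proof.
(* The default value 1 keeps the minimum positive when no group is active. *)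
exists (\big[Num.min/1]_(j : 'I_p | (j < p0)%N) l2norm (submxcol beta0 j)).
  apply: lt_bigmin => // j jp.
  by rewrite lt_neqAle eq_sym l2norm_ge0 andbT; apply/hbeta0.
by move=> j jp; exact: bigmin_le_cond.
Qed.

(** An inactive group of the quantile estimator has norm at most [K / sqrt n], hence weight at least
    [K^(-gamma) n^(gamma/2)]. Multiplied by [mu n] and divided by [sqrt n], this is
    [n^((gamma-1)/2) mu n] up to a constant, which tends to infinity. *)
Lemma near_inactive_penalty (a K : R) : 0 < K ->
  \forall n \near \oo,
    a * Num.sqrt n%:R <= mu n * ((K / Num.sqrt n%:R) `^ gamma)^-1.
Proof.
move=> K0; have /cvgryPge /(_ (a * K `^ gamma)) := hmu_gamma.
apply: filterS2 (nbhs_infty_gt 0) => n n0 h.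
have nR : 0 < n%:R :> R by rewrite ltr0n.
have Kg : 0 < K `^ gamma by rewrite powR_gt0.
have s0 : 0 < Num.sqrt n%:R :> R by rewrite sqrtr_gt0.
have e1 : (K / Num.sqrt n%:R) `^ gamma = K `^ gamma / n%:R `^ (gamma / 2).
  rewrite powRM ?invr_ge0 ?(ltW K0) ?(ltW s0)//; congr (_ * _).
  by rewrite -powR12_sqrt ?(ltW nR)// -(powRN _ 2^-1) -powRrM -powRN mulNr mulrC.
have e2 : n%:R `^ (gamma / 2) = n%:R `^ ((gamma - 1) / 2) * Num.sqrt n%:R :> R.
  rewrite -powR12_sqrt ?(ltW nR)// -powRD; last by rewrite (gt_eqF nR) implybT.
  by congr (_ `^ _); field.
rewrite e1 invf_div e2 mulrAC mulrA ler_pM2r// mulrA ler_pdivlMr// mulrC.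
by rewrite mulrC (le_trans h)// mulrC.
Qed.

(** [leading_term] solves the normal equations of the active groups, [f 0 A x = J W], so the
    gradient at [J^T x] has no active component, as [lasso_localize] demands. *)
Lemma active_score_eq n w :
  J *m (f 0 *: (Upsilon *m (J^T *m leading_term n w)) - score X eps tau n w) = 0.
Proof.
rewrite /leading_term mulmxBr -!scalemxAr scalerA mulfV ?gt_eqF// scale1r.
by rewrite !mulmxA -active_mxE mulmxV// mul1mx subrr.
Qed.

(** Half of [rho] pays for bounding the score, half for the uniform quadratic approximation. Off
    these two events, for [n] large, [quantile_localize] controls the weights and [lasso_localize]
    concludes. *)
Lemma likely_lasso_close (eta rho : R) : 0 < eta -> 0 < rho ->
  likely P rho (fun n w =>
    l2norm (Num.sqrt n%:R *: active_vec hp0 (betas n w - beta0) - leading_term n w) <= eta).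
Proof.
move=> eta0 rho0; have rho2 : 0 < rho / 2 by rewrite divr_gt0.
have [C C0 hC] := likely_score hUpsilon htau0 htau1 hindep Pneg rho2.
have [lam lam0 lower] := posdefmx_lower hposdef.
have fl : 0 < f 0 * lam by rewrite mulr_gt0.
(* [u0] and the gradient [g] are fixed linear images of the score, so the bound [C] on the score
   bounds both. *)
have [cD cD0 hcD] := mulmx_l2norm_le (J^T *m ((f 0)^-1 *: (invmx A *m J))).
have [cG cG0 hcG] := mulmx_l2norm_le
  (f 0 *: (Upsilon *m (J^T *m ((f 0)^-1 *: (invmx A *m J)))) - 1%:M).
have u0E n w : J^T *m leading_term n w =
    J^T *m ((f 0)^-1 *: (invmx A *m J)) *m score X eps tau n w.
  by rewrite /leading_term -!scalemxAr -scalemxAl -!mulmxA.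
have gE n w : f 0 *: (Upsilon *m (J^T *m leading_term n w)) - score X eps tau n w =
    (f 0 *: (Upsilon *m (J^T *m ((f 0)^-1 *: (invmx A *m J)))) - 1%:M) *m score X eps tau n w.
  by rewrite u0E; move: (J^T *m _) => D; rewrite mulmxBl mul1mx -scalemxAl mulmxA.
(* Makes [f 0 lam K1^2 / 2] exceed [C K1 + K1], with [K1 >= 1] covering the error [delta <= 1/2]. *)
pose K1 := 2 * (C + 1) / (f 0 * lam) + 1.
have K10 : 0 < K1 by rewrite ltr_wpDl// divr_ge0 ?(ltW fl)// mulr_ge0// addr_ge0.
(* A radius serving both localizations: the sphere of radius [K1] around 0 and that of radius [eta]
   around [u0]. *)
pose K := K1 + (cD * C + eta).
have cDC : 0 <= cD * C by rewrite mulr_ge0.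
have K1K : K1 <= K by rewrite lerDl addr_ge0// ltW.
have K0 : 0 <= K by rewrite (le_trans (ltW K10)).
pose gap := f 0 / 2 * (lam * eta ^+ 2).
have gap0 : 0 < gap by rewrite mulr_gt0 ?divr_gt0// mulr_gt0// exprn_gt0.
(* [1/2] serves the first localization. For the second, [2 delta] and the active penalty are each at
   most [gap / 4]. *)
pose delta := Num.min (1 / 2) (gap / 8).
have delta0 : 0 < delta by rewrite lt_min !divr_gt0.
have delta1 : delta <= 1 / 2 by rewrite ge_min lexx.
have delta2 : delta <= gap / 8 by rewrite ge_min lexx orbT.
have gap1 : C * K1 + delta < f 0 / 2 * (lam * K1 ^+ 2).
  have e : f 0 / 2 * (lam * K1 ^+ 2) = K1 * (C + 1 + f 0 * lam / 2).
    by rewrite {1 2}/K1; field; rewrite !gt_eqF.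
  rewrite e; have K11 : 1 <= K1.
    by rewrite lerDr divr_ge0 ?(ltW fl)// mulr_ge0// addr_ge0.
  have := mulr_gt0 K10 fl; rewrite (_ : K1 * (_ + _) = C * K1 + K1 + K1 * (f 0 * lam) / 2); last by ring.
  by move: (K1 * (f 0 * lam)) (C * K1) => x y; lra.
have [m m0 hm] := active_norm_lower.
(* Active groups of the quantile estimator keep norm at least [m / 2] once [K1 / sqrt n <= m / 2],
   so their weights are at most [Omega]. *)
pose Omega := ((m / 2) `^ gamma)^-1.
have m20 : 0 < m / 2 by rewrite divr_gt0.
have Omega0 : 0 < Omega by rewrite invr_gt0 powR_gt0.
have pO : 0 < p%:R * (Omega * eta) + 1.
  by rewrite ltr_wpDl// !mulr_ge0 ?(ltW eta0)// ltW.
have n1 : \forall n \near \oo, p%:R * (mu n * Omega * eta / Num.sqrt n%:R) <= gap / 4.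
  have e4 : 0 < gap / 4 / (p%:R * (Omega * eta) + 1) by rewrite !divr_gt0.
  have /cvgrPdist_le /(_ _ e4) := hmu_sqrt; apply: filterS => n.
  rewrite sub0r normrN => /(le_trans (ler_norm _)) h.
  have -> : p%:R * (mu n * Omega * eta / Num.sqrt n%:R) =
     p%:R * (Omega * eta) * (mu n / Num.sqrt n%:R) by ring.
  have x0 : 0 <= mu n / Num.sqrt n%:R by rewrite divr_ge0// ltW.
  apply: (@le_trans _ _ ((p%:R * (Omega * eta) + 1) * (mu n / Num.sqrt n%:R))).
    by rewrite ler_wpM2r// lerDl.
  by rewrite mulrC -ler_pdivlMr.
have n2 : \forall n \near \oo, K1 / Num.sqrt n%:R <= m / 2.
  apply: filterS (nbhs_infty_gtr ((K1 / (m / 2)) ^+ 2)) => n hn.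
  have k0 : 0 <= K1 / (m / 2) by rewrite ltW// divr_gt0.
  have s0 : 0 < Num.sqrt n%:R :> R by rewrite sqrtr_gt0 (le_lt_trans _ hn)// sqr_ge0.
  rewrite ler_pdivrMr// mulrC -ler_pdivrMr//.
  by rewrite -[leLHS]ger0_norm// -sqrtr_sqr ler_wsqrtr// ltW.
have n3 := near_inactive_penalty (cG * C) K10.
have n0 : \forall n \near \oo, (0 < n)%N by exact: nbhs_infty_gt.
have hR := likely_remainder_uniform hmax hUpsilon hindep hF hf hf0 K0 delta0 rho2.
have := likelyI hC hR; rewrite -splitr; apply: likely_sub => //.
near=> n.
have s0 : 0 < Num.sqrt n%:R :> R by rewrite sqrtr_gt0 ltr0n; near: n.
have mn : K1 / Num.sqrt n%:R <= m / 2 by near: n.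
have mn1 : p%:R * (mu n * Omega * eta / Num.sqrt n%:R) <= gap / 4 by near: n.
have mn3 : cG * C * Num.sqrt n%:R <= mu n * ((K1 / Num.sqrt n%:R) `^ gamma)^-1 by near: n.
move=> w [hW hRem]; set s := Num.sqrt n%:R in s0 mn mn1 mn3 *.
set W := score X eps tau n w in hW.
set u0 := J^T *m leading_term n w.
have Rem_approx u : l2norm u <= K ->
    `|remainder X eps n u w - f 0 / 2 * dotv u (Upsilon *m u)| <= delta.
  by move=> uK; apply: hRem => j; rewrite (le_trans (norm_coord_le _ _)).
have shift u : quantile_loss tau X (Y^~ w) n (beta0 + s^-1 *: u) -
  quantile_loss tau X (Y^~ w) n beta0 = - dotv W u + remainder X eps n u w.
  exact: (@quantile_loss_shift _ _ tau X (Y^~ w) n beta0 u (fun i => eps i w) s (fun i => hY i w)).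
have bt_close : l2norm (s *: (betat n w - beta0)) < K1.
  by apply: (quantile_localize s0 f0_gt0 shift Rem_approx lower hW K10 K1K gap1).
have bt_j j : l2norm (submxcol (betat n w) j - submxcol beta0 j) <= K1 / s.
  have -> : submxcol (betat n w) j - submxcol beta0 j = submxcol (betat n w - beta0) j.
    by apply/matrixP => x y; rewrite !mxE.
  rewrite (le_trans (l2norm_submxcol _ _))// ler_pdivlMr// mulrC.
  by move: bt_close; rewrite l2normZ gtr0_norm// => /ltW.
have bt_active (j : 'I_p) : (j < p0)%N -> m / 2 <= l2norm (submxcol (betat n w) j).
  move=> jp; have := hm j jp; have := bt_j j; have := l2norm_distr (submxcol (betat n w) j) (submxcol beta0 j).
  move=> /ler_normlP[h1 h2]; move: mn h1 h2.
  move: (l2norm _) (l2norm _) (l2norm _) (K1 / s) => x y z t; lra.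
have b0_inactive (j : 'I_p) : (p0 <= j)%N -> submxcol beta0 j = 0.
  move=> jp; apply/eqP; rewrite -l2norm_eq0; apply/negPn/negP => /hbeta0.
  by rewrite ltnNge jp.
have : l2norm (s *: (betas n w - beta0) - u0) < eta.
  apply: (@lasso_localize _ _ _ p0 tau gamma (mu n) X (Y^~ w) n beta0 (betat n w) (betas n w)
    W (fun u => remainder X eps n u w) s (f 0) lam K delta Upsilon s0 f0_gt0 shift Rem_approx lower
    u0 eta Omega hgamma (hmu_gt0 n) eta0 (ltW Omega0)) => //.
  - by have [] := hposdef.
  - by move=> j; exact: submxcol_active_projT.
  - move=> j jp; have -> : j = widen_ord hp0 (Ordinal jp) by exact: val_inj.
    by rewrite submxcol_active active_score_eq; apply/matrixP => x y; rewrite !mxE.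
  - move=> j jp; rewrite -l2norm_eq0 gt_eqF// (lt_le_trans m20)//; exact: bt_active.
  - move=> j jp; rewrite /real_weight /Omega lef_pV2 ?posrE ?powR_gt0//.
      by apply: ge0_ler_powR; rewrite ?nnegrE ?(ltW hgamma) ?(ltW m20) ?l2norm_ge0//; exact: bt_active.
    by rewrite (lt_le_trans m20)//; exact: bt_active.
  - move=> j jp btj; rewrite /u0 gE.
    have h1 : l2norm ((f 0 *: (Upsilon *m (J^T *m ((f 0)^-1 *: (invmx A *m J)))) - 1%:M) *m W) <= cG * C.
      by rewrite (le_trans (hcG _))// ler_wpM2l.
    rewrite (le_trans (ler_wpM2r (ltW s0) h1))// (le_trans mn3)//.
    rewrite ler_wpM2l ?(ltW (hmu_gt0 n))// /real_weight.
    have lj : 0 < l2norm (submxcol (betat n w) j).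
      by rewrite lt_neqAle eq_sym l2norm_eq0 btj l2norm_ge0.
    rewrite lef_pV2 ?posrE ?powR_gt0 ?divr_gt0//.
    apply: ge0_ler_powR; rewrite ?nnegrE ?(ltW hgamma) ?(ltW lj) ?divr_ge0 ?(ltW K10) ?(ltW s0)//.
    by have := bt_j j; rewrite b0_inactive// subr0.
  - rewrite /K (le_trans _ (_ : cD * C + eta <= _))//; last by rewrite lerDr ltW.
    by rewrite lerD2r /u0 u0E (le_trans (hcD _))// ler_wpM2l.
  rewrite -/gap; move: (p%:R * _) delta2 gap0 mn1 => x; lra.
move=> /ltW; apply: le_trans.
have -> : s *: active_vec hp0 (betas n w - beta0) - leading_term n w =
    J *m (s *: (betas n w - beta0) - u0).
  by rewrite mulmxBr /u0 mulmxA active_proj_mulT mul1mx active_vecE scalemxAr.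
exact: l2norm_active_proj_le.
Unshelve. all: by end_near.
Qed.

End AdaptiveGroupLasso.

Theorem theorem1 (R : realType)
  (dT : measure_display) (T : measurableType dT) (P : probability T R)
  (* groups, true parameter *)
  (p : nat) (d : 'I_p -> nat) (p0 : nat) (hp0 : (p0 <= p)%N)
  (beta0 : 'cV[R]_(\sum_(j < p) d j))
  (hbeta0 : forall j : 'I_p, l2norm (submxcol beta0 j) != 0 <-> (j < p0)%N)
  (* linear model *)
  (X : nat -> 'cV[R]_(\sum_(j < p) d j))
  (eps : nat -> {RV P >-> R})
  (Y : nat -> T -> R)
  (hY : forall i w, Y i w = dotv (X i) beta0 + eps i w)
  (tau : R) (htau0 : 0 < tau) (htau1 : tau < 1)
  (* (A1) *)
  (Upsilon : 'M[R]_(\sum_(j < p) d j))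
  (hmax : n%:R^-1 * \big[Num.max/0]_(i < n) dotv (X i) (X i)
            @[n --> \oo] --> (0 : R))
  (hUpsilon : n%:R^-1 *: (\sum_(i < n) X i *m (X i)^T)
            @[n --> \oo] --> Upsilon)
  (hposdef : posdefmx Upsilon)
  (* (A2) *)
  (F f : R -> R) (B : set R)
  (hindep : mutually_independent eps)
  (hF : forall i x, cdf (eps i) x = (F x)%:E)
  (hB0 : B 0)
  (hf : is_density_of f F)
  (hf0 : \forall x \near (0 : R), {for x, continuous f} /\ 0 < f x)
  (htau : tau = F 0)
  (hlim : forall e, B° e ->
     n%:R^-1 * \sum_(i < n)
        oriented_integral 0 (dotv (X i) onev)
          (fun v => Num.sqrt n%:R * (F (e + v / Num.sqrt n%:R) - F e))
       @[n --> \oo] --> 2^-1 * f e * dotv onev (Upsilon *m onev))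
  (* tuning parameters *)
  (mu : nat -> R) (gamma : R)
  (hmu_gt0 : forall n, 0 < mu n) (hgamma : 0 < gamma)
  (hmu : mu n @[n --> \oo] --> +oo)
  (hmu_sqrt : mu n / Num.sqrt n%:R @[n --> \oo] --> (0 : R))
  (hmu_gamma : n%:R `^ ((gamma - 1) / 2) * mu n @[n --> \oo] --> +oo)
  (* quantile and adaptive group LASSO quantile estimators *)
  (betat betas : nat -> T -> 'cV[R]_(\sum_(j < p) d j))
  (hbetat_rv : forall n, random_vector (betat n))
  (hbetas_rv : forall n, random_vector (betas n))
  (hbetat : forall n w, is_quantile_estimate tau X (Y^~ w) n (betat n w))
  (hbetas : forall n w, is_adaptive_group_lasso_estimate
              tau gamma (mu n) X (Y^~ w) n (betat n w) (betas n w)) :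
  cvg_in_law_normal P
    (fun n w => Num.sqrt n%:R *: active_vec hp0 (betas n w - beta0))
    0 ((tau * (1 - tau) * (f 0) ^- 2) *: invmx (active_mx hp0 Upsilon)).
Proof.
have f00 : 0 < f 0 by have [] := nbhs_singleton hf0.
have Pneg i : P (eps i @^-1` `]-oo, 0[%classic) = tau%:E.
  by rewrite htau; exact: (prob_neg (hF i) hf).
have pA := posdefmx_active hp0 hposdef; have [symA _] := pA.
have uA := posdefmx_unit pA; have [symB _] := posdefmx_inv pA.
set S := (_ *: invmx _).
have pS : posdefmx S.
  apply: posdefmxZ; last exact: posdefmx_inv.
  by rewrite !mulr_gt0 ?subr_gt0// invr_gt0 exprn_gt0.
(* The limit is realized on a space of its own, as the existential in [cvg_in_law_normal]
   permits. *)
have [L SL] := cholesky pS.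
have [d' [T' [P' [Z [nZ cfZ]]]]] := normal_vector_exists SL.
exists d', T', P', Z; split => //.
pose V n w := leading_term hp0 X eps tau Upsilon f n w.
have close (eta rho : R) : 0 < eta -> 0 < rho -> likely P rho (fun n w =>
    l2norm (Num.sqrt n%:R *: active_vec hp0 (betas n w - beta0) - V n w) <= eta).
  move=> eta0 rho0.
  exact: (likely_lasso_close hp0 hbeta0 hY htau0 htau1 hmax hUpsilon hposdef hindep hF hf hf0
    htau hmu_gt0 hgamma hmu_sqrt hmu_gamma hbetat hbetas eta0 rho0).
have mZn n : random_vector (fun w => Num.sqrt n%:R *: active_vec hp0 (betas n w - beta0)).
  move=> i; rewrite (_ : (fun w => _) = fun w =>
      Num.sqrt n%:R * (betas n w (active_index i) 0 - beta0 (active_index i) 0)).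
    by apply: measurable_funM => //; apply: measurable_funB => //; exact: hbetas_rv.
  by apply/funext => w; rewrite !mxE.
pose J : 'M[R]_(_, _) := active_proj d hp0; pose A := active_mx hp0 Upsilon.
(* [V n] is the fixed linear image [E W_n] of the score, so its transform at [t] is that of the
   score at [E^T t]. *)
pose E := (f 0)^-1 *: (invmx (active_mx hp0 Upsilon) *m active_proj d hp0).
have VE n w : V n w = E *m score X eps tau n w.
  by rewrite /V /leading_term /E -scalemxAl -mulmxA.
have tVE n w t : dotv t (V n w) = dotv (E^T *m t) (score X eps tau n w).
  by rewrite VE dotv_mulmx.
have mV n : random_vector (V n).
  move=> i; rewrite (_ : (fun w => _) = fun w => \sum_j E i j * score X eps tau n w j 0).
    apply: measurable_sum => j; apply: measurable_funM => //.
    exact: measurable_score.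
  by apply/funext => w; rewrite VE mxE.
apply: levy_continuity => //.
- by have [] := nZ.
- apply: (tight_close mZn close) => rho rho0.
  have [C C0 hC] := likely_score hUpsilon htau0 htau1 hindep Pneg rho0.
  have [c c0 hc] := mulmx_l2norm_le E.
  exists (c * C); apply: likely_sub hC => //; near=> n => w hw.
  by rewrite VE (le_trans (hc _))// ler_wpM2l.
move=> t c; apply: (cvg_cos_close mZn mV close); rewrite cfZ.
have -> : (fun n => \int[P]_w cos (dotv t (V n w) + c)) =
    (fun n => \int[P]_w cos (dotv (E^T *m t) (score X eps tau n w) + c)).
  by apply/funext => n; apply: eq_Rintegral => w _; rewrite tVE.
(* The sandwich [A^-1 (J Upsilon J^T) A^-1] collapses to [A^-1], because the middle factor is [A]
   itself. *)
have -> : dotv t (S *m t) = tau * (1 - tau) * dotv (E^T *m t) (Upsilon *m (E^T *m t)).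
  rewrite -dotv_mulmx !mulmxA.
  have -> : E *m Upsilon *m E^T = (f 0) ^- 2 *: invmx (active_mx hp0 Upsilon).
    rewrite /E linearZ/= trmx_mul symB -!scalemxAl -scalemxAr scalerA.
    have -> : invmx A *m J *m Upsilon *m (J^T *m invmx A) =
        invmx A *m (J *m Upsilon *m J^T) *m invmx A by rewrite !mulmxA.
    by rewrite -active_mxE mulVmx// mul1mx -invfM -expr2.
  by rewrite -scalemxAl dotvZr -scalemxAl dotvZr mulrA.
exact: cvg_cos_score.
Unshelve. all: by end_near.
Qed.
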